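(* There is a countable set $\mathfrak{E}\subset(1,\infty)$ of algebraic numbers such that, whenever $q\in(1,\infty)\setminus\mathfrak{E}$, for all $\zeta,\eta\in\mathbb{T}$ and all $N\ge1$, $$\Big\|\sum_{j=0}^{N-1}Q^jA\Big\|_{Y\to X}=2N.$$ Consequently (for such $q$ and all $\zeta,\eta\in\mathbb{T}$), $\mathfrak{D}_{q,\zeta,\eta}$ is a proper and meagre subset of $Y$, and $\mathsf{G}:\mathfrak{D}_{q,\zeta,\eta}\to X$ is unbounded with respect to the ambient $L^1$ norm of $Y$.
   Context: $\mathbb{T}=\{z\in\mathbb{C}:|z|=1\}$, $X=L^1((0,1))$, $Y=L^1((1,q))$; functions on a subinterval of $(0,\infty)$ are extended by zero outside it. For $\omega\in\mathbb{T}$, $$(\mathcal{L}_{\omega,q}h)(x)=\sum_{n\ge1}\omega^n\frac{q}{(n+x)^2}h\Big(\frac{q}{n+x}\Big)\quad(h\in X,\ 0<x<1),$$ $(J_qh)(x)=\frac{q}{x^2}h(q/x)$ for $x>0$, and $(S_\omega h)(x)=\sum_{n\ge1}\omega^nh(x+n)$ for $0<x<1$. Put $$Q=Q_{q,\zeta,\eta}=\mathcal{L}_{\zeta,q}\mathcal{L}_{\eta,q}:X\to X,\qquad A=A_{q,\zeta,\eta}:Y\to X,\quad Av=-S_\zeta v+\mathcal{L}_{\zeta,q}(S_\eta J_qv).$$ For $v\in Y$ let $\mathsf{G}_Nv=\sum_{j=0}^{N-1}Q^jAv$; the maximal Green domain is $\mathfrak{D}_{q,\zeta,\eta}=\{v\in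 Y:(\mathsf{G}_Nv)_{N\ge1}\text{ converges in }X\}$, and $\mathsf{G}v=\lim_{N\to\infty}\mathsf{G}_Nv$ for $v\in\mathfrak{D}_{q,\zeta,\eta}$. *)

(* Defs.v *)
From HB Require Import structures.
From mathcomp Require Import all_boot all_order all_algebra.
From mathcomp Require Import generic_quotient complex.
From mathcomp Require Import all_classical all_reals all_analysis.
From mathcomp Require Import measurable_realfun.

Set Implicit Arguments.
Unset Strict Implicit.
Unset Printing Implicit Defensive.

Import Order.TTheory GRing.Theory Num.Theory.
Import numFieldNormedType.Exports.

Local Open Scope classical_set_scope.
Local Open Scope ring_scope.

(* [Rcomplex R] is R[i] seen as an R-module, normed by the modulus.  The space
   [L1 i] of classes of complex-valued functions integrable on [i] is likewise
   built as a normed module over R: multiplication by complex scalars affects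
   neither its norm nor its topology. *)
Section L1_functions.
Context {R : realType}.
Implicit Types (i : interval R) (f g : R -> Rcomplex R).

Local Notation mu := (@lebesgue_measure R).
Local Notation re f := (EFin \o (@complex.Re R \o f)).
Local Notation im f := (EFin \o (@complex.Im R \o f)).

Definition cintegrable i : {pred R -> Rcomplex R} :=
  fun f => mu.-integrable [set` i] (re f) && mu.-integrable [set` i] (im f).

Lemma cintegrable_submod i : submod_closed (cintegrable i).
Proof.
split=> [|a f g /andP[fr fi] /andP[gr gi]].
  by apply/andP; split; exact: integrable0.
apply/andP; split.
- rewrite (_ : re _ = (fun x => a%:E * (re f) x)%E \+ re g)%E.
    by apply: integrableD => //; exact: integrableZl.
  by apply/funext => x /=; rewrite !fctE /=; case: (f x) (g x) => ? ? [].
- rewrite (_ : im _ = (fun x => a%:E * (im f) x)%E \+ im g)%E.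
    by apply: integrableD => //; exact: integrableZl.
  by apply/funext => x /=; rewrite !fctE /=; case: (f x) (g x) => ? ? [].
Qed.

HB.instance Definition _ i :=
  GRing.isSubmodClosed.Build R (R -> Rcomplex R) (cintegrable i)
    (cintegrable_submod i).

Record L1fun i := L1Fun {
  L1fun_val :> R -> Rcomplex R ; L1fun_prop : L1fun_val \in cintegrable i }.

HB.instance Definition _ i := [isSub for @L1fun_val i].
HB.instance Definition _ i := [Choice of L1fun i by <:].
HB.instance Definition _ i := [SubChoice_isSubLmodule of L1fun i by <:].


Lemma measurable_modulus i (u : L1fun i) :
  measurable_fun [set` i] (fun x => `|u x| : R).
Proof.
have /andP[/measurable_int ur /measurable_int ui] := L1fun_prop u.
move/measurable_EFinP: ur => ur; move/measurable_EFinP: ui => ui.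
rewrite (_ : (fun x => _) = Num.sqrt (R := R) \o
    (fun x => complex.Re (u x) ^+ 2 + complex.Im (u x) ^+ 2)).
  apply: measurableT_comp.
    by apply: continuous_measurable_fun; exact: sqrt_continuous.
  by apply: measurable_funD; exact: measurable_funX.
by apply/funext => x /=; case: (u x).
Qed.

Lemma integrable_modulus i (u : L1fun i) :
  mu.-integrable [set` i] (EFin \o (fun x => `|u x| : R)).
Proof.
have /andP[ur ui] := L1fun_prop u.
apply: (@le_integrable _ _ _ mu _ _ _
    ((abse \o re u) \+ (abse \o im u))%E) => //.
- by apply/measurable_EFinP; exact: measurable_modulus.
- move=> x _ /=; rewrite lee_fin normr_id [leRHS]ger0_norm//.
  rewrite -[`|u x|]/(ComplexField.Normc.normc (u x)); case: (u x) => a b /=.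
  rewrite -[leRHS]ger0_norm ?addr_ge0// -sqrtr_sqr ler_wsqrtr// sqrrD.
  rewrite !real_normK ?num_real// -addrA [_ *+ 2 + _]addrC addrA lerDl.
  by rewrite mulrn_wge0// mulr_ge0.
- by apply: integrableD => //; exact: integrable_abse.
Qed.

Definition aezero i : {pred L1fun i} :=
  fun u => `[< {ae mu, forall x, x \in i -> u x = 0} >].

Let ae_mu : Filter (nbhs (almost_everywhere mu)).
Proof. exact: ae_filter_ringOfSetsType. Qed.

Lemma aezero_submod i : submod_closed (@aezero i).
Proof.
split=> [|a u v /asboolP u0 /asboolP v0]; apply/asboolP.
  exact: nearW.
apply: (@filterS2 _ _ ae_mu _ _ _ _ u0 v0) => x {}u0 {}v0 xi.
rewrite [L1fun_val _ x](_ : _ = a *: u x + v x)//.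
by rewrite u0// v0// scaler0 addr0.
Qed.

HB.instance Definition _ i :=
  GRing.isSubmodClosed.Build R (L1fun i) (@aezero i) (aezero_submod i).

End L1_functions.

Definition L1 {R : realType} (i : interval R) : Type := {ideal_quot @aezero R i}.

Section L1_space.
Context {R : realType} (i : interval R).
Local Notation mu := (@lebesgue_measure R).
Local Notation L1 := (L1 i).
Local Open Scope quotient_scope.

HB.instance Definition _ := Choice.on L1.
HB.instance Definition _ := EqQuotient.on L1.
HB.instance Definition _ := GRing.Zmodule.on L1.
HB.instance Definition _ := ZmodQuotient.on L1.

Implicit Types (u v : L1fun i) (f g : L1).

Let ae_mu : Filter (nbhs (almost_everywhere mu)).
Proof. exact: ae_filter_ringOfSetsType. Qed.

Lemma L1_eqP u v :
  \pi_L1 u = \pi_L1 v <-> {ae mu, forall x, x \in i -> u x = v x}.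
Proof.
split=> [/eqP|uv].
  rewrite -[L1]/{ideal_quot @aezero R i} -Quotient.idealrBE => /asboolP.
  move=> ae; apply: (@filterS _ _ ae_mu _ _ _ ae) => x {}uv xi.
  have /eqP := uv xi; rewrite [X in X == 0](_ : _ = u x - v x)//.
  by rewrite subr_eq0 => /eqP.
apply/eqP; rewrite -[L1]/{ideal_quot @aezero R i} -Quotient.idealrBE; apply/asboolP.
apply: (@filterS _ _ ae_mu _ _ _ uv) => x {}uv xi.
by rewrite [LHS](_ : _ = u x - v x)// uv// subrr.
Qed.

Lemma L1_reprP u : {ae mu, forall x, x \in i -> repr (\pi_L1 u) x = u x}.
Proof. by apply/L1_eqP; rewrite reprK. Qed.

Definition L1_scale (a : R) f : L1 := \pi_L1 (a *: repr f).

Lemma pi_L1_scale a u : L1_scale a (\pi_L1 u) = \pi_L1 (a *: u).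
Proof.
apply/L1_eqP; apply: (@filterS _ _ ae_mu _ _ _ (L1_reprP u)) => x uE xi.
by rewrite [LHS](_ : _ = a *: (repr (\pi_L1 u) x))// uE.
Qed.

Lemma L1_scaleA a b f : L1_scale a (L1_scale b f) = L1_scale (a * b) f.
Proof.
rewrite -[f]reprK (pi_L1_scale b) (pi_L1_scale a) (pi_L1_scale (a * b)).
by rewrite scalerA.
Qed.

Lemma L1_scale1 : left_id 1 L1_scale.
Proof. by move=> f; rewrite -[f]reprK pi_L1_scale scale1r. Qed.

Lemma L1_scaleDr : right_distributive L1_scale +%R.
Proof.
move=> a f g; rewrite -[f]reprK -[g]reprK.
by rewrite -[_ + _](raddfD (\pi_L1)) !pi_L1_scale scalerDr raddfD.
Qed.

Lemma L1_scaleDl f : {morph L1_scale^~ f : a b / a + b}.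
Proof.
by move=> a b; rewrite -[f]reprK !pi_L1_scale scalerDl raddfD.
Qed.

HB.instance Definition _ :=
  GRing.Zmodule_isLmodule.Build R L1 L1_scaleA L1_scale1 L1_scaleDr L1_scaleDl.

Definition L1_norm f : R := (\int[mu]_(x in [set` i]) `|repr f x|)%R.

Lemma L1_normE u : L1_norm (\pi_L1 u) = (\int[mu]_(x in [set` i]) `|u x|)%R.
Proof.
rewrite /L1_norm /Rintegral; congr fine.
apply: ae_eq_integral => //.
- by apply/measurable_EFinP; exact: measurable_modulus.
- by apply/measurable_EFinP; exact: measurable_modulus.
by apply: (@filterS _ _ ae_mu _ _ _ (L1_reprP u)) => x uE /= xi; rewrite uE.
Qed.

Lemma L1_ler_normD f g : L1_norm (f + g) <= L1_norm f + L1_norm g.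
Proof.
rewrite -[f]reprK -[g]reprK -[\pi_L1 _ + _](raddfD (\pi_L1)) !L1_normE.
rewrite -RintegralD//; try exact: integrable_modulus.
apply: le_Rintegral => //; first exact: integrable_modulus.
  by apply: (integrableD _ (integrable_modulus _) (integrable_modulus _)).
by move=> x _; exact: ler_normD.
Qed.

Lemma L1_normrZ a f : L1_norm (a *: f) = `|a| * L1_norm f.
Proof.
rewrite -[f]reprK -[a *: _]/(L1_scale a _) pi_L1_scale !L1_normE.
rewrite -RintegralZl//; last exact: integrable_modulus.
apply: eq_Rintegral => x _.
rewrite [L1fun_val _ x](_ : _ = a *: repr f x)//.
rewrite -[LHS]/(ComplexField.Normc.normc _).
rewrite -[`|repr f x|]/(ComplexField.Normc.normc _); case: (repr f x) => b c /=.
by rewrite !exprMn -mulrDr sqrtrM ?sqr_ge0// sqrtr_sqr.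
Qed.

Lemma L1_normr0_eq0 f : L1_norm f = 0 -> f = 0.
Proof.
rewrite -[f]reprK -(raddf0 (\pi_L1)) L1_normE => f0; apply/L1_eqP.
have : (\int[mu]_(x in [set` i]) `|(`|repr f x| : R)%:E| = 0)%E.
  have fi := integrable_modulus (repr f).
  under eq_integral do rewrite /= normr_id.
  by rewrite -[LHS]fineK ?[fine _]f0//; exact: integrable_fin_num.
have [ae _] := ae_eq_integral_abs mu (measurable_itv i)
  (measurable_int mu (integrable_modulus (repr f))).
move=> {}/ae ae.
by apply: (@filterS _ _ ae_mu _ _ _ ae) => x f0x /f0x[] /normr0_eq0.
Qed.

HB.instance Definition _ :=
  Lmodule_isNormed.Build R L1 L1_ler_normD L1_normrZ L1_normr0_eq0.

End L1_space.

Section general_notions.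
Context {R : realType}.

Definition opnorm (V W : normedModType R) (T : V -> W) : \bar R :=
  ereal_sup [set `|T v|%:E | v in [set v | `|v| <= 1]].

Definition nowhere_dense (V : topologicalType) (A : set V) : Prop :=
  (closure A)° = set0.

Definition meagre (V : topologicalType) (A : set V) : Prop :=
  exists2 F : (set V)^nat, (forall n, nowhere_dense (F n)) & A = \bigcup_n F n.

Definition unbounded_on (V W : normedModType R) (D : set V) (T : V -> W) :
  Prop := ~ exists C : R, forall v, D v -> `|T v| <= C * `|v|.

End general_notions.

Section operators.
Context {R : realType}.
Implicit Types (i j : interval R) (h : R -> Rcomplex R) (w : R[i]) (q x : R).

Local Open Scope quotient_scope.
Local Open Scope complex_scope.
Local Notation X := (L1 (`]0, 1[ : interval R)).
Local Notation Y q := (L1 (`]1, q[ : interval R)).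

Definition extend0 i (f : L1 i) : R -> Rcomplex R :=
  fun x => if x \in i then repr f x else 0.

(* The value 0 given to functions that are not integrable on i is never used
   below: for q > 0 and |w| = 1, each of [L_fun], [J_fun] and [S_fun] maps the
   functions to which it is applied to functions integrable on the target
   interval, and respects almost everywhere equality. *)
Definition L1_class i h : L1 i := \pi_(L1 i) (insubd (0 : L1fun i) h).

Definition lift_L1 {i j} (T : (R -> Rcomplex R) -> (R -> Rcomplex R)) :
  L1 i -> L1 j := fun f => L1_class j (T (extend0 f)).

(* sum over n >= 1; in all the uses below the series converges absolutely for
   almost every x *)
Definition cseries (u : nat -> R[i]) : R[i] :=
  limn (fun N => \sum_(1 <= n < N) complex.Re (u n)) +i*
  limn (fun N => \sum_(1 <= n < N) complex.Im (u n)).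

Definition L_fun w q h : R -> Rcomplex R := fun x =>
  cseries (fun n => w ^+ n * (q / (n%:R + x) ^+ 2)%:C * h (q / (n%:R + x))).

Definition J_fun q h : R -> Rcomplex R := fun x =>
  (q / x ^+ 2)%:C * h (q / x).

Definition S_fun w h : R -> Rcomplex R := fun x =>
  cseries (fun n => w ^+ n * h (x + n%:R)).

Definition L_op w q : X -> X := lift_L1 (L_fun w q).

(* x |-> q / x maps (1, q) onto itself, so that J v vanishes outside (1, q)
   for v in L^1((1, q)). *)
Definition J_op q : Y q -> Y q := lift_L1 (J_fun q).

Definition S_op w q : Y q -> X := lift_L1 (S_fun w).

Variables (q : R) (zeta eta : R[i]).

Definition Q_op : X -> X := L_op zeta q \o L_op eta q.

Definition A_op : Y q -> X :=
  fun v => - S_op zeta v + L_op zeta q (S_op eta (J_op v)).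

Definition green_sum (N : nat) : Y q -> X :=
  fun v => \sum_(j < N) iter j Q_op (A_op v).

Definition green_domain : set (Y q) :=
  [set v | cvgn (fun N => green_sum N v)].

Definition green : Y q -> X := fun v => limn (fun N => green_sum N v).

End operators.

Arguments Q_op {R} q zeta eta _.
Arguments A_op {R} q zeta eta _.
Arguments green_sum {R} q zeta eta N _.
Arguments green_domain {R} q zeta eta _.
Arguments green {R} q zeta eta _.

(* Main.v *)
From HB Require Import structures.
Require Import Defs.
From mathcomp Require Import all_boot all_order all_algebra complex.
From mathcomp Require Import all_classical all_reals all_analysis.
From mathcomp Require Import measurable_realfun generic_quotient.
From mathcomp Require Import lra ring.

(** Call T x = q/x - floor (q/x) the Gauss map; L_w is its transfer operator,
    each inverse branch x |-> q/(n+x) being twisted by w^n.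

    Upper bound.  L_w, S_w and the inversion J have norm at most one, because
    the norms of the images under the separate branches add up to the norm of
    the function.  So each Q^j A has norm at most 2.

    Lower bound.  E is the set of the algebraic numbers above 1.  If q is
    transcendental, there is y in (1, q) algebraically independent from q.  Take
    v to be a constant on a tiny interval around y.  Then A v is carried by two
    tiny intervals, around the fractional part of y and around T (T y), and as
    long as the interval stays inside one branch domain, Q only moves it along
    the orbit of T^2.  The 2N points visited are distinct: an equality between
    two of them is a polynomial relation between q and y with rational
    coefficients, and it is not trivial, as one sees by specialising q to 0
    ([convergent_det], [orbit_distinct]).  Hence the 2N terms of the Green sum
    have disjoint supports and all have the norm of v, so that nothing cancels
    ([green_sum_spike]).

    The domain.  Since the norms of the Green sums are unbounded, the domain is
    meagre by the Baire type argument of [meagre_cvg_domain]; it is a proper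
    subset by a gliding hump ([cvg_domain_proper]), which uses that L1 is
    complete.

    Unboundedness.  It is enough that the spikes v used above lie in the
    domain: from G_N v = G v - Q^N G v one gets 2N |v| <= 2 |G v|.  So one has
    to show that the norms of Q^j A v are summable.  Here A v is a combination
    of atoms, that is of functions c rho 1_(a,b), c unimodular, with a density
    whose logarithm is Lipschitz with a fixed constant; the branches send atoms
    to atoms.  The cost of an atom is its mass plus a small multiple of the
    bound of its density, and costs are extended to L1 as a gauge ([hull]).
    [growth] is a Lasota-Yorke inequality: the bound of the density gets
    contracted while the mass is kept up to a small error.  On the other hand
    an atom which is not concentrated on a very short interval contains two
    cylinders sent onto (0, 1) by the same iterate of Q, with different phases:
    a fixed part of their images cancels ([long_atom]).  If zeta = eta = 1 there
    are no phases; one subtracts instead a multiple of the total integral, which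
    is preserved by Q and which vanishes for A v.  In both cases an iterate of Q
    contracts the cost ([contraction]), and the decay is geometric. *)

Set Implicit Arguments.
Unset Strict Implicit.
Unset Printing Implicit Defensive.

Import Order.TTheory GRing.Theory Num.Theory.
Import numFieldNormedType.Exports.

Local Open Scope classical_set_scope.
Local Open Scope ring_scope.

(** * Change of variables for nonnegative measurable functions *)
Section transport.
Local Open Scope ereal_scope.
Context d1 d2 (T1 : measurableType d1) (T2 : measurableType d2) (R : realType).
Variables (m1 : {measure set T1 -> \bar R}) (m2 : {measure set T2 -> \bar R}).
Variables (D : set T1) (E : set T2) (phi : T1 -> T2) (psi : T1 -> R).
Hypotheses (mD : measurable D) (mphi : measurable_fun [set: T1] phi).
Hypotheses (mpsi : measurable_fun [set: T1] psi).
Hypothesis psi0 : forall x, (0 <= psi x)%R.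

Let mpre A : measurable A -> measurable (phi @^-1` A).
Proof. by move=> mA; rewrite -[_ @^-1` _]setTI; exact: mphi. Qed.

(** The measure A |-> int_(D, phi in A) psi: the measurability and positivity
    proofs are arguments so that the measure structure can be attached to it. *)
Definition transported (_ : measurable D) (_ : measurable_fun [set: T1] phi)
    (_ : measurable_fun [set: T1] psi) (_ : forall x, (0 <= psi x)%R) :
    set T2 -> \bar R :=
  fun A => \int[m1]_(x in D `&` phi @^-1` A) (psi x)%:E.

Local Notation nu := (transported mD mphi mpsi psi0).

Let nu_set0 : nu set0 = 0.
Proof. by rewrite /transported preimage_set0 setI0 integral_set0. Qed.

Let nu_ge0 A : 0 <= nu A.
Proof. by apply: integral_ge0 => x _; rewrite lee_fin. Qed.

Let nu_sigma_additive : semi_sigma_additive nu.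
Proof.
move=> /= F mF tF mUF; apply: cvg_toP.
  apply: ereal_nondecreasing_is_cvgn => m n mn.
  exact: lee_sum_nneg_natr.
rewrite /transported preimage_bigcup setI_bigcupr ge0_integral_bigcup//=.
- by move=> k; apply: measurableI => //; exact: mpre.
- by apply: measurable_funTS; exact/measurable_EFinP.
- by move=> x _; rewrite lee_fin.
- move=> m n _ _ [x [[_ Fm] [_ Fn]]]; apply: tF => //.
  by exists (phi x).
Qed.

HB.instance Definition _ := isMeasure.Build _ _ _ nu
  nu_set0 nu_ge0 nu_sigma_additive.

Hypothesis mE : measurable E.
Hypothesis phim : forall A, measurable A ->
  \int[m1]_(x in D `&` phi @^-1` A) (psi x)%:E = m2 (A `&` E).

Import HBNNSimple.

Let transported_nnsfun (f : {nnsfun T2 >-> R}) :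
  \int[m1]_(x in D) ((psi x)%:E * (f (phi x))%:E) = \int[m2]_(x in E) (f x)%:E.
Proof.
under [RHS]eq_integral do rewrite fimfunE -fsumEFin//.
rewrite [RHS]ge0_integral_fsum//; last 2 first.
  - by move=> r; exact/measurable_EFinP/measurable_funTS/measurable_funM.
  - by move=> n x _; rewrite EFinM nnfun_muleindic_ge0.
under [LHS]eq_integral.
  move=> x xD; rewrite (fimfunE f) -fsumEFin// ge0_mule_fsumr; last first.
    by move=> r; rewrite EFinM nnfun_muleindic_ge0.
  over.
have mi r : measurable (phi @^-1` (f @^-1` [set r])) by apply: mpre.
have mpi r : measurable_fun D (fun x => (\1_(f @^-1` [set r]) (phi x) : R)%R).
  rewrite (_ : (fun _ => _) = \1_(phi @^-1` (f @^-1` [set r])))//.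
rewrite [LHS]ge0_integral_fsum//; last 2 first.
  - move=> r; under eq_fun do rewrite -EFinM.
    apply/measurable_EFinP/measurable_funM; first exact: measurable_funTS.
    by apply: measurable_funM.
  - move=> n x _; rewrite EFinM mule_ge0 ?lee_fin//.
    by rewrite -lee_fin EFinM nnfun_muleindic_ge0.
apply: eq_fsbigr => r _; have [r0|r0] := ltP r 0%R.
  rewrite !integral0_eq// => x _; rewrite (preimage_nnfun0 _ r0) indic0 mulr0//.
  by rewrite mule0.
rewrite integralZl_indic_nnsfun//= integral_indic// -phim//.
transitivity (\int[m1]_(x in D)
    (r%:E * ((psi x)%:E * (\1_(phi @^-1` (f @^-1` [set r])) x)%:E))).
  by apply: eq_integral => x _; rewrite EFinM muleCA.
rewrite ge0_integralZl//; last first.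
- by move=> x _; rewrite mule_ge0 ?lee_fin.
- under eq_fun do rewrite -EFinM.
  apply/measurable_EFinP/measurable_funM; first exact: measurable_funTS.
  exact: mpi.
congr (_ * _); rewrite integral_mkcondr; apply: eq_integral => x _.
rewrite patchE indicE; case: ifPn => _; first by rewrite mule1.
by rewrite mule0.
Qed.

(** The identity holds for simple functions by linearity, and in general by
    monotone convergence on both sides. *)
Lemma ge0_change_of_variables (g : T2 -> \bar R) :
  measurable_fun [set: T2] g -> (forall x, 0 <= g x) ->
  \int[m1]_(x in D) ((psi x)%:E * g (phi x)) = \int[m2]_(x in E) g x.
Proof.
move=> mg g0; pose f_ := nnsfun_approx measurableT mg.
transitivity (lim (\int[m1]_(x in D)
    ((psi x)%:E * (f_ n (phi x))%:E) @[n --> \oo])).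
  rewrite -monotone_convergence//=.
  - apply: eq_integral => x _; rewrite limeMl//; last first.
      apply/ereal_nondecreasing_is_cvgn => m n mn; rewrite lee_fin.
      exact/lefP/nd_nnsfun_approx.
    congr (_ * _); apply/esym/cvg_lim => //=.
    exact: cvg_nnsfun_approx.
  - move=> n; under eq_fun do rewrite -EFinM.
    apply/measurable_EFinP/measurable_funM; first exact: measurable_funTS.
    by apply/measurable_funTS; exact: measurableT_comp.
  - by move=> n x _; rewrite mule_ge0 ?lee_fin.
  - move=> x _ m n mn; rewrite lee_wpmul2l ?lee_fin//.
    exact/lefP/nd_nnsfun_approx.
transitivity (lim (\int[m2]_(x in E) (f_ n x)%:E @[n --> \oo])).
  by apply: congr_lim; apply/funext => n /=; exact: transported_nnsfun.
rewrite -monotone_convergence//=.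
- apply: eq_integral => x _; apply/cvg_lim => //.
  exact: cvg_nnsfun_approx.
- by move=> n; exact/measurable_EFinP/measurable_funTS.
- by move=> n x _; rewrite lee_fin.
- by move=> x _ m n mn; rewrite lee_fin; exact/lefP/nd_nnsfun_approx.
Qed.

End transport.

Section change_of_variables_real.
Context {R : realType}.
Local Notation mu := (@lebesgue_measure R).
Local Open Scope ereal_scope.

(** Since 0^-1 = 0, inversion is x |-> x |x|^(-2) everywhere, 0 included, and
    real powers are known to be measurable. *)
Lemma measurable_invr : measurable_fun [set: R] (@GRing.inv R).
Proof.
rewrite (_ : GRing.inv = (fun x : R => x * powR (x ^+ 2) (-1))%R); last first.
  apply/funext => x; rewrite powR_inv1 ?sqr_ge0// expr2 invfM mulrA.
  by have [->|x0] := eqVneq x 0%R; rewrite ?invr0 ?mulr0// divff// mul1r.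
apply: measurable_funM => //.
apply: (measurableT_comp (f := fun y => powR y (-1))).
  exact: measurable_powR.
exact: exprn_measurable.
Qed.

(** Half-open intervals determine Lebesgue measure: adding to the transported
    measure the restriction of Lebesgue measure outside E yields a measure that
    agrees with Lebesgue measure on them, hence on all Borel sets. *)
Lemma change_of_variables_itv (D E : set R) (phi psi : R -> R)
  (mD : measurable D) (mphi : measurable_fun [set: R] phi)
  (mpsi : measurable_fun [set: R] psi) (psi0 : forall x, (0 <= psi x)%R) :
  measurable E -> D `<=` phi @^-1` E ->
  (forall u v : R, \int[mu]_(x in D `&` phi @^-1` `]u, v]) (psi x)%:E =
    mu (`]u, v] `&` E)) ->
  forall g : R -> \bar R, measurable_fun [set: R] g -> (forall x, 0 <= g x) ->
  \int[mu]_(x in D) ((psi x)%:E * g (phi x)) = \int[mu]_(x in E) g x.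
Proof.
move=> mE DE nuE; apply: (@ge0_change_of_variables _ _ _ _ R mu mu) => // A mA.
have mCE : measurable (~` E) by exact: measurableC.
pose nu := measure_add
  (@transported _ _ (measurableTypeR R) (measurableTypeR R) R mu D phi psi
     mD mphi mpsi psi0) (mrestr mu mCE).
have nuB B : nu B = \int[mu]_(x in D `&` phi @^-1` B) (psi x)%:E + mu (B `&` ~` E).
  by rewrite /nu measure_addE.
have muE : forall B : set R, measurable B -> mu B = nu B.
  apply: lebesgue_measure_unique => _ [[u v] _ <-].
  apply: (etrans _ (esym (nuB _))); rewrite [X in X + _]nuE.
  rewrite -measureU//; last 3 first.
  - exact: measurableI.
  - exact: measurableI.
  - by rewrite setIACA setICr setI0.
  by rewrite -setIUr setUv setIT.
apply/esym; apply: (etrans (muE _ (measurableI _ _ mA mE))).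
rewrite nuB -setIA setICr setI0.
rewrite measure0 adde0 preimage_setI [_ `&` (_ @^-1` E)]setIC.
by rewrite setIA [X in X `&` _](_ : _ = D)//; apply/setIidPl.
Qed.

Lemma integral_itv_sandwich (A : set R) (s t : R) (f : R -> \bar R) :
  measurable A -> measurable_fun [set: R] f -> (forall x, 0 <= f x) ->
  `]s, t[ `<=` A -> A `<=` `[s, t] ->
  \int[mu]_(x in A) f x = \int[mu]_(x in `[s, t]) f x.
Proof.
move=> mA mf f0 sA As; apply/eqP; rewrite eq_le; apply/andP; split.
  apply: ge0_subset_integral => //; exact: measurable_funTS.
have -> : \int[mu]_(x in `[s, t]) f x = \int[mu]_(x in `]s, t[) f x.
  rewrite integral_itv_bndo_bndc//; last exact: measurable_funTS.
  by rewrite integral_itv_obnd_cbnd//; exact: measurable_funTS.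
apply: ge0_subset_integral => //; exact: measurable_funTS.
Qed.

(** Ends of intervals do not matter; this spares the bookkeeping of which of
    them belong to an intersection. *)
Lemma lebesgue_measure_sandwich (A : set R) (s t : R) :
  measurable A -> `]s, t[ `<=` A -> A `<=` `[s, t] ->
  mu A = (Num.max 0%R (t - s)%R)%:E.
Proof.
move=> mA sA As; have [st|ts] := ltP s t.
  rewrite max_r ?subr_ge0 ?ltW//; apply/eqP; rewrite eq_le; apply/andP; split.
    have /= := @lebesgue_measure_itv R `[s, t]; rewrite lte_fin st -EFinB => <-.
    by apply: le_measure; rewrite ?inE.
  have /= := @lebesgue_measure_itv R `]s, t[; rewrite lte_fin st -EFinB => <-.
  by apply: le_measure; rewrite ?inE.
rewrite max_l ?subr_le0//; apply/eqP; rewrite eq_le measure_ge0 andbT.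
rewrite -[0%:E]/0.
have /= := @lebesgue_measure_itv R `[s, t]; rewrite lte_fin ltNge ts/= => <-.
by apply: le_measure; rewrite ?inE.
Qed.

Lemma change_of_variables_translation (n : R) (a b : R) (g : R -> \bar R) :
  measurable_fun [set: R] g -> (forall x, 0 <= g x) ->
  \int[mu]_(x in `]a, b[) g (x + n)%R = \int[mu]_(x in `](a + n)%R, (b + n)%R[) g x.
Proof.
move=> mg g0.
have m1 : measurable_fun [set: R] (fun=> 1%R : R) by exact: measurable_cst.
have mn : measurable_fun [set: R] (fun x => x + n)%R by exact: measurable_funD.
rewrite -(@change_of_variables_itv `]a, b[ `](a + n)%R, (b + n)%R[
  (fun x => x + n)%R (fun=> 1%R))//.
- by apply: eq_integral => x _; rewrite mul1e.
- by move=> x /=; rewrite !in_itv/= !ltrD2r.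
move=> u v.
have mI : measurable (`]a, b[ `&` (fun x : R => x + n)%R @^-1` `]u, v]).
  by apply: measurableI => //; rewrite -[_ @^-1` _]setTI; exact: mn.
rewrite integral_cst// mul1e.
apply: (etrans (@lebesgue_measure_sandwich _ (Num.max a (u - n)%R) (Num.min b (v - n)%R) mI _ _)).
- move=> x /=; rewrite !in_itv/= !(gt_max, lt_min) !(ltrBlDr, ltrBrDr).
  by move=> /andP[/andP[-> ->] /andP[-> /ltW ->]].
- move=> x /=; rewrite !in_itv/= !(ge_max, le_min) !(lerBlDr, lerBrDr).
  by move=> [/andP[/ltW -> /ltW ->] /andP[/ltW -> ->]].
apply/esym; apply: (etrans (@lebesgue_measure_sandwich _
  (Num.max (a + n)%R u) (Num.min (b + n)%R v) _ _ _)).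
- exact: measurableI.
- move=> x /=; rewrite !in_itv/= !(gt_max, lt_min).
  by move=> /andP[/andP[-> ->] /andP[-> /ltW ->]].
- move=> x /=; rewrite !in_itv/= !(ge_max, le_min).
  by move=> [/andP[/ltW -> ->] /andP[/ltW -> /ltW ->]].
congr EFin; congr Num.max.
rewrite -[X in (Num.max (a + n)%R X)](subrK n) -[X in (Num.min (b + n)%R X)](subrK n).
by rewrite -addr_maxl -addr_minl opprD addrACA subrr addr0.
Qed.

Lemma integral_inv_sqr (q s t : R) : (0 < s)%R -> (s < t)%R ->
  \int[mu]_(x in `[s, t]) (q / x ^+ 2)%:E = (q / s - q / t)%:E.
Proof.
move=> s0 st.
have dF (x : R) : (0 < x)%R ->
    is_derive x 1%R (fun y => (- q) *: y^-1 : R)%R (q / x ^+ 2)%R.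
  move=> x0; have x0' : x != 0%R by rewrite gt_eqF.
  rewrite (_ : (q / x ^+ 2)%R = (- q) *: (- x ^- 2 *: 1))%R; last first.
    by rewrite /GRing.scale/= mulr1 mulrNN.
  by apply: is_deriveZ; apply: is_deriveV.
have cF (x : R) : (0 < x)%R -> {for x, continuous (fun y : R => (- q) *: y^-1 : R)%R}.
  move=> x0; apply: (@differentiable_continuous R R R).
  by apply/derivable1_diffP; have [] := dF _ x0.
have t0 := lt_trans s0 st.
rewrite (@continuous_FTC2 R _ (fun y => (- q) *: y^-1)%R)//.
- by rewrite -EFinB /GRing.scale/= !mulNr opprK addrC.
- apply: continuous_in_subspaceT => x; rewrite inE/= in_itv/= => /andP[sx _].
  have x0 := lt_le_trans s0 sx.
  apply: cvgM; first exact: cvg_cst.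
  by apply: cvgV; [rewrite expf_neq0// gt_eqF|exact: exprn_continuous].
- split.
  + by move=> x; rewrite in_itv/= => /andP[sx _]; have [] := dF _ (lt_trans s0 sx).
  + by apply: cvg_at_right_filter; exact: cF.
  + by apply: cvg_at_left_filter; exact: cF.
- move=> x; rewrite in_itv/= => /andP[sx _]; rewrite derive1E.
  by have [_ ->] := dF _ (lt_trans s0 sx).
Qed.

Lemma change_of_variables_inversion (q a b : R) (g : R -> \bar R) :
  (0 < q)%R -> (0 < a)%R -> (a < b)%R ->
  measurable_fun [set: R] g -> (forall x, 0 <= g x) ->
  \int[mu]_(x in `]a, b[) ((q / x ^+ 2)%:E * g (q / x)%R) =
  \int[mu]_(x in `](q / b)%R, (q / a)%R[) g x.
Proof.
move=> q0 a0 ab mg g0; have b0 := lt_trans a0 ab.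
have mphi : measurable_fun [set: R] (fun x => q / x)%R.
  by apply: measurable_funM => //; exact: measurable_invr.
have mpsi : measurable_fun [set: R] (fun x => q / x ^+ 2)%R.
  apply: measurable_funM => //.
  by apply: (measurableT_comp measurable_invr); exact: exprn_measurable.
have psi0 (x : R) : (0 <= q / x ^+ 2)%R by rewrite divr_ge0 ?sqr_ge0// ltW.
rewrite (@change_of_variables_itv _ `](q / b)%R, (q / a)%R[ _ _ _ mphi mpsi psi0)//.
  move=> x /=; rewrite !in_itv/= => /andP[ax xb]; have x0 := lt_trans a0 ax.
  by rewrite !ltr_pM2l// !ltf_pV2 ?posrE// ax xb.
move=> u v.
have mI : measurable (`]a, b[ `&` (fun x : R => q / x)%R @^-1` `]u, v]).
  by apply: measurableI => //; rewrite -[_ @^-1` _]setTI; exact: mphi.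
set u' := Num.max u (q / b)%R; set v' := Num.min v (q / a)%R.
have u'0 : (0 < u')%R by rewrite lt_max divr_gt0// orbT.
rewrite (@lebesgue_measure_sandwich (`]u, v] `&` _) u' v')//; last first.
- move=> x /=; rewrite !in_itv/= !(ge_max, le_min).
  by move=> [/andP[/ltW -> ->] /andP[/ltW -> /ltW ->]].
- move=> x /=; rewrite !in_itv/= !(gt_max, lt_min).
  by move=> /andP[/andP[-> ->] /andP[/ltW -> ->]].
- exact: measurableI.
have key (x : R) : (0 < x)%R -> (a < x < b)%R = (q / b < q / x < q / a)%R.
  by move=> x0; rewrite !ltr_pM2l// !ltf_pV2 ?posrE// andbC.
have [uv|vu] := ltP u' v'; last first.
  rewrite max_l ?subr_le0// (_ : _ `&` _ = set0) ?integral_set0//.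
  apply/seteqP; split => // x [] /=; rewrite !in_itv/= => axb /andP[ux xv].
  have x0 : (0 < x)%R by case/andP: axb => ax _; exact: lt_trans ax.
  move: axb; rewrite key// => /andP[bx xa].
  have : (u' < v')%R.
    by apply: (@lt_le_trans _ _ (q / x)%R); rewrite ?(gt_max, le_min) ?ux ?bx ?xv ?ltW.
  by rewrite ltNge vu.
have v'0 := lt_trans u'0 uv.
rewrite max_r ?subr_ge0 ?(ltW uv)//.
rewrite (@integral_itv_sandwich _ (q / v')%R (q / u')%R)//.
- rewrite integral_inv_sqr ?divr_gt0//; last by rewrite ltr_pM2l// ltf_pV2.
  by rewrite !invfM !invrK !mulrA !divff ?gt_eqF// !mul1r.
- exact/measurable_EFinP.
- move=> x /=; rewrite !in_itv/= => /andP[vx xu].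
  have x0 : (0 < x)%R by apply: lt_trans vx; rewrite divr_gt0.
  have {}vx : (q / x < v')%R by rewrite ltr_pdivrMr// mulrC -ltr_pdivrMr.
  have {}xu : (u' < q / x)%R by rewrite ltr_pdivlMr// mulrC -ltr_pdivlMr.
  rewrite key//; move: vx xu.
  by rewrite lt_min gt_max => /andP[/ltW -> ->] /andP[-> ->].
- move=> x /= []; rewrite !in_itv/= => axb /andP[ux xv].
  have x0 : (0 < x)%R by case/andP: axb => ax _; exact: lt_trans ax.
  move: axb; rewrite key// => /andP[bx xa].
  have -> : (q / v' <= x)%R.
    by rewrite ler_pdivrMr// mulrC -ler_pdivrMr// le_min xv (ltW xa).
  by rewrite ler_pdivlMr// mulrC -ler_pdivlMr// ge_max (ltW ux) (ltW bx).
Qed.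

End change_of_variables_real.

(** * The modulus, and limits of measurable functions *)
(** The norm of R[i] takes its values in R[i]; the modulus as a real number is
    the norm of the R-module [Rcomplex R]. *)
Notation cmod z := (Num.norm (z : Rcomplex _)).

Section Rcomplex_norm.
Context {R : realType}.
Implicit Types (z w : Rcomplex R) (a : R).
Local Open Scope complex_scope.

Lemma RcnormE z : `|z| = Num.sqrt (complex.Re z ^+ 2 + complex.Im z ^+ 2).
Proof. by case: z. Qed.

Lemma RcnormM z w : cmod (z * w) = `|z| * `|w|.
Proof. exact: ComplexField.Normc.normcM. Qed.

Lemma Rcnorm_real a : cmod (a%:C) = `|a|.
Proof. by rewrite RcnormE/= expr0n/= addr0 sqrtr_sqr. Qed.

Lemma RcnormX z n : cmod (z ^+ n) = `|z| ^+ n.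
Proof.
elim: n => [|n IHn]; last by rewrite !exprS RcnormM IHn.
by rewrite !expr0 (Rcnorm_real 1) normr1.
Qed.

Lemma Rcnorm1 (w : R[i]) : `|w| = 1 -> cmod w = 1.
Proof. by case: w => a b; rewrite normc_def => -[]. Qed.

Lemma ler_Re_norm z : `|complex.Re z| <= `|z|.
Proof.
by rewrite RcnormE -sqrtr_sqr ler_wsqrtr// lerDl sqr_ge0.
Qed.

Lemma ler_Im_norm z : `|complex.Im z| <= `|z|.
Proof.
by rewrite RcnormE -sqrtr_sqr ler_wsqrtr// lerDr sqr_ge0.
Qed.

Lemma ler_norm_ReIm z : `|z| <= `|complex.Re z| + `|complex.Im z|.
Proof.
rewrite RcnormE -[leRHS]ger0_norm ?addr_ge0// -sqrtr_sqr ler_wsqrtr// sqrrD.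
rewrite !real_normK ?num_real// -addrA [_ *+ 2 + _]addrC addrA lerDl.
by rewrite mulrn_wge0// mulr_ge0.
Qed.

Lemma ReB z w : complex.Re (z - w) = complex.Re z - complex.Re w.
Proof. by case: z w => [? ?] []. Qed.

Lemma ImB z w : complex.Im (z - w) = complex.Im z - complex.Im w.
Proof. by case: z w => [? ?] []. Qed.

Lemma Re_sum (I : Type) (s : seq I) (F : I -> Rcomplex R) :
  complex.Re (\sum_(k <- s) F k) = \sum_(k <- s) complex.Re (F k).
Proof.
elim: s => [|k s IHs]; first by rewrite !big_nil.
by rewrite !big_cons -IHs; case: (F k) (\sum_(_ <- _) _) => [? ?] [].
Qed.

Lemma Im_sum (I : Type) (s : seq I) (F : I -> Rcomplex R) :
  complex.Im (\sum_(k <- s) F k) = \sum_(k <- s) complex.Im (F k).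
Proof.
elim: s => [|k s IHs]; first by rewrite !big_nil.
by rewrite !big_cons -IHs; case: (F k) (\sum_(_ <- _) _) => [? ?] [].
Qed.

End Rcomplex_norm.

Section measurable_limit.
Context d (T : measurableType d) (R : realType).

(** On the set C of the points where the sequence is Cauchy, which is
    measurable, the limit is a pointwise limit of measurable functions; off C,
    [limn] takes a constant default value. *)
Lemma measurable_limn (D : set T) (h : nat -> T -> R) : measurable D ->
  (forall n, measurable_fun D (h n)) ->
  measurable_fun D (fun x => limn (h^~ x)).
Proof.
move=> mD mh; pose C := [set x | cvgn (h^~ x)].
have CE : D `&` C = \bigcap_k \bigcup_N \bigcap_(n in [set n | (N <= n)%N])
    (D `&` (fun x => `|h n x - h N x|) @^-1` `]-oo, k.+1%:R^-1]).
  apply/seteqP; split=> [x [Dx /cvg_cauchy/cauchy_ballP Cx] k _|x Cx].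
    have /Cx[[A B]/= [[N _ NA] [M _ MB]] AB] : 0 < k.+1%:R^-1 :> R by rewrite invr_gt0.
    exists (maxn N M) => // n /=; rewrite geq_max => /andP[Nn Mn]; split => //.
    have /= := AB (h n x, h (maxn N M) x).
    rewrite in_itv/= -ball_normE/= => /(_ _)/ltW; apply.
    split; first exact: NA.
    by apply: MB; rewrite /= leq_maxr.
  have Dx : D x by have [N _ /(_ N (leqnn N))[]] := Cx 0%N Logic.I.
  split => //; apply/cauchy_cvgP/cauchy_ballP => e e0.
  pose k := Num.truncn (e / 2)^-1.
  have ke : k.+1%:R^-1 < e / 2.
    by rewrite invf_plt ?posrE ?divr_gt0//; exact: truncnS_gt.
  have [N _ CN] := Cx k Logic.I.
  pose A := [set y | `|y - h N x| < e / 2].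
  exists (A, A) => /=.
    by split; exists N => // n Nn; have [_] := CN n Nn;
      rewrite /A/= in_itv/= => /le_lt_trans; exact.
  move=> [a b] /= [Aa Ab]; rewrite -ball_normE/= [e]splitr.
  rewrite -(subrK (h N x) a) -addrA (le_lt_trans (ler_normD _ _))// ltrD//.
  by rewrite distrC.
have mC : measurable (D `&` C).
  rewrite CE; apply: bigcap_measurable => // k _; apply: bigcup_measurable => N _.
  apply: bigcap_measurable; first by exists N; rewrite /= leqnn.
  move=> n _.
  have : measurable_fun D (fun x => `|h n x - h N x|).
    by apply: measurableT_comp => //; exact: measurable_funB.
  by apply.
rewrite (_ : D = (D `&` C) `|` (D `\` C)); last by rewrite setDE -setIUr setUv setIT.
have mDC : measurable (D `\` C) by rewrite -[D `\` C]set0U -(setDv D) -setDIr; exact: measurableD.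
apply/measurable_funU => //; split.
  apply: (@measurable_fun_cvg _ _ _ _ h).
    by move=> n; apply: measurable_funS (mh n) => //; exact: subIsetl.
  by move=> x [].
apply: (@eq_measurable_fun _ _ _ _ _ (cst point)) => //.
by move=> x; rewrite inE => -[_ nC]; rewrite dvgP.
Qed.

End measurable_limit.

(** * Classes of integrable functions *)
Section L1_classes.
Context {R : realType}.
Implicit Types (i j : interval R) (h : R -> Rcomplex R).
Local Notation mu := (@lebesgue_measure R).
Local Open Scope quotient_scope.

Lemma ae_lebesgue_filter : Filter (nbhs (almost_everywhere mu)).
Proof. exact: ae_filter_ringOfSetsType. Qed.

Lemma cintegrable_measurable i h : h \in cintegrable i ->
  measurable_fun [set` i] (fun x => complex.Re (h x)) /\
  measurable_fun [set` i] (fun x => complex.Im (h x)).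
Proof.
move=> /andP[/measurable_int/measurable_EFinP mr /measurable_int/measurable_EFinP mi].
by split.
Qed.

Lemma measurable_norm i h :
  measurable_fun [set` i] (fun x => complex.Re (h x)) ->
  measurable_fun [set` i] (fun x => complex.Im (h x)) ->
  measurable_fun [set` i] (fun x => `|h x| : R).
Proof.
move=> mr mi; rewrite (_ : (fun x => _) = Num.sqrt (R := R) \o
    (fun x => complex.Re (h x) ^+ 2 + complex.Im (h x) ^+ 2)); last first.
  by apply/funext => x /=; rewrite RcnormE.
apply: (measurableT_comp (f := @Num.sqrt R)).
  by apply: continuous_measurable_fun; exact: sqrt_continuous.
by apply: measurable_funD; exact: measurable_funX.
Qed.

Lemma cintegrableP i h :
  measurable_fun [set` i] (fun x => complex.Re (h x)) ->
  measurable_fun [set` i] (fun x => complex.Im (h x)) ->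
  (\int[mu]_(x in [set` i]) (`|h x|)%:E < +oo)%E -> h \in cintegrable i.
Proof.
move=> mr mi hoo; have mn := measurable_norm mr mi.
have hi : mu.-integrable [set` i] (fun x => (`|h x| : R)%:E).
  apply/integrableP; split; first exact/measurable_EFinP.
  by under eq_integral do rewrite /= normr_id.
apply/andP; split; apply: le_integrable hi => //.
- exact/measurable_EFinP.
- by move=> x _ /=; rewrite lee_fin normr_id ler_Re_norm.
- exact/measurable_EFinP.
- by move=> x _ /=; rewrite lee_fin normr_id ler_Im_norm.
Qed.

Lemma L1_class_norm i h : h \in cintegrable i ->
  (`|L1_class i h|)%:E = (\int[mu]_(x in [set` i]) (`|h x|)%:E)%E.
Proof.
move=> hi; rewrite /L1_class -[`|_|]/(L1_norm _) L1_normE.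
have := @integrable_modulus R i (insubd (0 : L1fun i) h).
rewrite -[L1fun_val _]/(\val _) insubdK// => hI.
by rewrite /Rintegral fineK//; exact: integrable_fin_num.
Qed.

Lemma L1_class_eq i h h' : h \in cintegrable i -> h' \in cintegrable i ->
  {ae mu, forall x, x \in i -> h x = h' x} -> L1_class i h = L1_class i h'.
Proof.
move=> hi hi' hh'; apply/L1_eqP.
by rewrite -!/(\val _) !insubdK.
Qed.

Lemma L1_class_eqin i h h' : h \in cintegrable i -> 
  (forall x, x \in i -> h x = h' x) ->
  h' \in cintegrable i /\ L1_class i h = L1_class i h'.
Proof.
move=> hi hh'.
have hi' : h' \in cintegrable i.
  move: hi => /andP[hr hi]; apply/andP; split.
  - by apply: eq_integrable hr => // x; rewrite inE => /hh' /= ->.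
  - by apply: eq_integrable hi => // x; rewrite inE => /hh' /= ->.
split => //; apply: L1_class_eq => //.
apply: (@filterE _ _ ae_lebesgue_filter) => x; exact: hh'.
Qed.

Lemma L1_classD i h h' : h \in cintegrable i -> h' \in cintegrable i ->
  L1_class i (h + h') = L1_class i h + L1_class i h'.
Proof.
move=> hi hi'; rewrite /L1_class -[RHS](raddfD (\pi_(L1 i))).
congr (\pi _); apply/val_inj; rewrite /= insubdK ?rpredD//.
transitivity (\val (insubd (0 : L1fun i) h) + \val (insubd (0 : L1fun i) h')).
  by rewrite !insubdK.
by [].
Qed.

Lemma L1_class0 i : L1_class i (0 : R -> Rcomplex R) = 0.
Proof.
rewrite /L1_class -(raddf0 (\pi_(L1 i))); congr (\pi _); apply/val_inj.
by rewrite /= insubdK ?rpred0.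
Qed.

Lemma L1_class_sum i (I : Type) (s : seq I) (u : I -> R -> Rcomplex R) :
  (forall k, u k \in cintegrable i) ->
  L1_class i (\sum_(k <- s) u k) = \sum_(k <- s) L1_class i (u k).
Proof.
move=> ui; elim: s => [|k s IHs]; first by rewrite !big_nil L1_class0.
by rewrite !big_cons L1_classD ?rpred_sum// IHs.
Qed.

Lemma extend0_cintegrable i (f : L1 i) : extend0 f \in cintegrable i.
Proof.
apply: (@L1_class_eqin i (repr f) _ _ _).1; first exact: L1fun_prop.
by move=> x xi; rewrite /extend0 xi.
Qed.

Lemma L1_class_extend0 i (f : L1 i) : L1_class i (extend0 f) = f.
Proof.
rewrite -(@L1_class_eqin i (repr f) _ _ _).2; first last.
- by move=> x xi; rewrite /extend0 xi.
- exact: L1fun_prop.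
rewrite -[RHS]reprK /L1_class; congr (\pi _); apply/val_inj.
by rewrite insubdK// L1fun_prop.
Qed.

Lemma L1_norm_extend0 i (f : L1 i) :
  (`|f|)%:E = (\int[mu]_(x in [set` i]) (`|extend0 f x|)%:E)%E.
Proof. by rewrite -{1}[f]L1_class_extend0 L1_class_norm// extend0_cintegrable. Qed.

Lemma extend0_out i (f : L1 i) x : x \notin i -> extend0 f x = 0.
Proof. by rewrite /extend0 => /negbTE ->. Qed.

Lemma extend0_L1_class i h : h \in cintegrable i ->
  {ae mu, forall x, x \in i -> extend0 (L1_class i h) x = h x}.
Proof.
move=> hi; have := @L1_reprP R i (insubd (0 : L1fun i) h).
apply: (@filterS _ _ ae_lebesgue_filter) => x + xi => /(_ xi).
by rewrite /extend0 xi /L1_class => ->; rewrite -/(\val _) insubdK.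
Qed.

End L1_classes.

(** * Series of functions, completeness of L1 *)
Section dominated_series.
Context d (T : measurableType d) (R : realType).
Variables (mu : {measure set T -> \bar R}) (D : set T) (mD : measurable D).
Local Open Scope ereal_scope.

(** The sum G of the majorants is integrable by monotone convergence, hence
    finite almost everywhere, and dominated convergence applies to the partial
    sums with the majorant G. *)
Lemma dominated_series (r w : nat -> T -> R) (M : R) :
  (forall n, measurable_fun D (r n)) -> (forall n, measurable_fun D (w n)) ->
  (forall n x, `|r n x| <= w n x)%R ->
  (forall N, \sum_(0 <= n < N) \int[mu]_(x in D) (w n x)%:E <= M%:E) ->
  let f := fun x => limn (fun N => \sum_(0 <= n < N) r n x)%R in
  mu.-integrable D (EFin \o f) /\
  (fun N => \int[mu]_(x in D) `|(\sum_(0 <= n < N) r n x)%R%:E - (f x)%:E|) @ \oo --> 0.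
Proof.
move=> mr mw rw wM f.
have w0 n x : (0 <= w n x)%R by exact: le_trans (rw n x).
pose G x := \sum_(n <oo) (w n x)%:E.
have mG : measurable_fun D G.
  by apply: ge0_emeasurable_sum => // n *; rewrite ?lee_fin//; exact/measurable_EFinP.
have G0 x : 0 <= G x by apply: nneseries_ge0 => n _ _; rewrite lee_fin.
have iG : mu.-integrable D G.
  apply/integrableP; split => //.
  under eq_integral do rewrite gee0_abs//.
  rewrite integral_nneseries//; last 2 first.
  - by move=> n; exact/measurable_EFinP.
  - by move=> n x _; rewrite lee_fin.
  apply: (@le_lt_trans _ _ M%:E); last exact: ltry.
  apply: lime_le; last exact: nearW.
  by apply: is_cvg_ereal_nneg_natsum => n _; apply: integral_ge0 => x _; rewrite lee_fin.
have wG N x : (\sum_(0 <= n < N) w n x)%R%:E <= G x.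
  rewrite -sumEFin; apply: nneseries_lim_ge => n _; by rewrite lee_fin.
have rG N x : `|(\sum_(0 <= n < N) r n x)%R%:E| <= G x.
  apply: le_trans (wG N x); rewrite lee_fin.
  by apply: le_trans (ler_norm_sum _ _ _) _; exact: ler_sum.
have cvr x : G x \is a fin_num -> cvgn (fun N => \sum_(0 <= n < N) r n x)%R.
  move=> Gx; apply: (@normed_cvg R R (fun n => r n x)).
  apply: nondecreasing_is_cvgn.
    exact: (@nondecreasing_series _ (fun n => `|r n x|)%R).
  exists (fine (G x)) => _ [N _ <-].
  rewrite -lee_fin fineK//; apply: le_trans (wG N x); rewrite lee_fin.
  by apply: ler_sum => n _; exact: rw.
have mS N : measurable_fun D (fun x => \sum_(0 <= n < N) r n x)%R.
  exact: measurable_sum.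
have := @dominated_convergence _ _ _ mu D mD
  (fun N x => (\sum_(0 <= n < N) r n x)%R%:E) (EFin \o f) G.
case.
- by move=> N; exact/measurable_EFinP.
- apply/measurable_EFinP; exact: measurable_limn.
- have /= := integrable_ae mD iG; apply: filterS => x + Dx => /(_ Dx)/cvr rx.
  by apply: cvg_EFin => //; exact: nearW.
- exact: iG.
- by apply: (@filterE _ _ (ae_filter_ringOfSetsType mu)) => x N _; exact: rG.
- by [].
Qed.

End dominated_series.

Section L1_series.
Context {R : realType} (i : interval R).
Implicit Types (u : nat -> R -> Rcomplex R).
Local Notation mu := (@lebesgue_measure R).

Let L1_series0 u (M : R) : (forall n, u n \in cintegrable i) ->
  (forall N, \sum_(0 <= n < N) `|L1_class i (u n)| <= M) ->
  let f : R -> Rcomplex R := fun x =>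
    (limn (fun N => \sum_(0 <= n < N) complex.Re (u n x)) +i*
     limn (fun N => \sum_(0 <= n < N) complex.Im (u n x)))%C in
  f \in cintegrable i /\
  (fun N => \sum_(0 <= n < N) L1_class i (u n)) @ \oo --> L1_class i f.
Proof.
move=> ui uM f.
have mi : measurable [set` i] by exact: measurable_itv.
have mr n := (cintegrable_measurable (ui n)).1.
have mI n := (cintegrable_measurable (ui n)).2.
have mn n : measurable_fun [set` i] (fun x => `|u n x| : R) by exact: measurable_norm.
have uM' N : (\sum_(0 <= n < N) \int[mu]_(x in [set` i]) (`|u n x| : R)%:E <= M%:E)%E.
  have := uM N; rewrite -lee_fin; apply: le_trans.
  by rewrite -sumEFin lee_sum// => n _; rewrite L1_class_norm.
have [ri rc] := @dominated_series _ (measurableTypeR R) R mu _ mi _ _ M mr mn (fun n x => ler_Re_norm (u n x)) uM'.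
have [Ii Ic] := @dominated_series _ (measurableTypeR R) R mu _ mi _ _ M mI mn (fun n x => ler_Im_norm (u n x)) uM'.
have fi : f \in cintegrable i by apply/andP; split.
split=> //; apply/cvgrPdist_le => /= e e0.
have e20 : 0 < e / 2 by rewrite divr_gt0.
move/fine_cvgP : rc => [rfin /cvgrPdist_le/(_ _ e20) rc].
move/fine_cvgP : Ic => [Ifin /cvgrPdist_le/(_ _ e20) Ic].
have := @filterI _ _ eventually_filter _ _ (@filterI _ _ eventually_filter _ _ rfin rc)
  (@filterI _ _ eventually_filter _ _ Ifin Ic).
apply: filterS => N [[Rfin rcN] [Imfin IcN]].
have fNi : f - \sum_(0 <= n < N) u n \in cintegrable i by rewrite rpredB// rpred_sum.
have -> : L1_class i f - \sum_(0 <= n < N) L1_class i (u n) =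
    L1_class i (f - \sum_(0 <= n < N) u n).
  apply/eqP; rewrite subr_eq -L1_class_sum// -L1_classD ?rpred_sum//.
  by rewrite subrK.
rewrite -lee_fin L1_class_norm// [e]splitr.
have fE x : (f - \sum_(0 <= n < N) u n) x = f x - \sum_(0 <= n < N) u n x.
  by rewrite !fctE; congr (_ - _); rewrite fct_sumE.
have [mfr mfi] := cintegrable_measurable fi.
have mSr : measurable_fun [set` i] (fun x => \sum_(0 <= n < N) complex.Re (u n x)).
  exact: measurable_sum.
have mSi : measurable_fun [set` i] (fun x => \sum_(0 <= n < N) complex.Im (u n x)).
  exact: measurable_sum.
have mar : measurable_fun [set` i] (fun x => `|(\sum_(0 <= n < N) complex.Re (u n x))%:E -
   (complex.Re (f x))%:E|)%E.
  apply: measurableT_comp => //.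
  by apply/measurable_EFinP; exact: measurable_funB.
have mai : measurable_fun [set` i] (fun x => `|(\sum_(0 <= n < N) complex.Im (u n x))%:E -
   (complex.Im (f x))%:E|)%E.
  apply: measurableT_comp => //.
  by apply/measurable_EFinP; exact: measurable_funB.
apply: (@le_trans _ _ (\int[mu]_(x in [set` i])
  (`|(\sum_(0 <= n < N) complex.Re (u n x))%:E - (complex.Re (f x))%:E| +
   `|(\sum_(0 <= n < N) complex.Im (u n x))%:E - (complex.Im (f x))%:E|))%E).
  apply: ge0_le_integral => //.
  - by apply/measurable_EFinP; have [? ?] := cintegrable_measurable fNi; exact: measurable_norm.
  - by apply: emeasurable_funD.
  - move=> x _; rewrite fE /= lee_fin (le_trans (ler_norm_ReIm _))//.
    by rewrite ReB ImB Re_sum Im_sum distrC lerD2l distrC.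
rewrite ge0_integralD// EFinD leeD//.
- rewrite -[leLHS]fineK// lee_fin.
  apply: le_trans (ler_norm _) _; rewrite -normrN -sub0r.
  exact: rcN.
- rewrite -[leLHS]fineK// lee_fin.
  apply: le_trans (ler_norm _) _; rewrite -normrN -sub0r.
  exact: IcN.
Qed.

Theorem L1_cseries u (M : R) : (forall n, u n \in cintegrable i) ->
  (forall N, \sum_(1 <= n < N) `|L1_class i (u n)| <= M) ->
  (fun x => cseries (u^~ x)) \in cintegrable i /\
  (fun N => \sum_(1 <= n < N) L1_class i (u n)) @ \oo -->
    L1_class i (fun x => cseries (u^~ x)).
Proof.
move=> ui uM; pose v n : R -> Rcomplex R := if n is 0 then 0 else u n.
have vi n : v n \in cintegrable i by case: n => [|n]; [exact: rpred0|exact: ui].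
have sumv (V : zmodType) (F : (R -> Rcomplex R) -> V) N : F 0 = 0 ->
    \sum_(1 <= n < N) F (u n) = \sum_(0 <= n < N) F (v n).
  move=> F0; case: N => [|N]; first by rewrite !big_geq.
  by rewrite [RHS]big_ltn//= F0 add0r; apply: eq_big_nat => -[].
have vM N : \sum_(0 <= n < N) `|L1_class i (v n)| <= M.
  rewrite -(sumv _ (fun h => `|L1_class i h|)) ?L1_class0 ?normr0//.
have [cv lv] := L1_series0 vi vM.
have csE : (fun x => cseries (u^~ x)) = (fun x =>
    (limn (fun N => \sum_(0 <= n < N) complex.Re (v n x)) +i*
     limn (fun N => \sum_(0 <= n < N) complex.Im (v n x)))%C).
  apply/funext => x; rewrite /cseries; congr (_ +i* _)%C.
    congr (limn _); apply/funext => N.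
    by rewrite -(sumv _ (fun h : R -> Rcomplex R => complex.Re (h x))).
  congr (limn _); apply/funext => N.
  by rewrite -(sumv _ (fun h : R -> Rcomplex R => complex.Im (h x))).
rewrite csE; split => //.
rewrite (_ : (fun N => _) = (fun N => \sum_(0 <= n < N) L1_class i (v n)))//.
by apply/funext => N; rewrite -(sumv _ (L1_class i)) ?L1_class0.
Qed.

(** Absolutely convergent series converge, in the form used for completeness:
    their sum is the class of the pointwise sum. *)
Theorem L1_complete_series (g : nat -> L1 i) (M : R) :
  (forall N, \sum_(0 <= n < N) `|g n| <= M) -> cvgn (series g).
Proof.
move=> gM; have := @L1_series0 (fun n => extend0 (g n)) M.
case.
- by move=> n; exact: extend0_cintegrable.
- by move=> N; under eq_bigr do rewrite L1_class_extend0.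
move=> _; set f := L1_class _ _ => gf.
apply/cvg_ex; exists f; move: gf; apply: cvg_trans.
apply: near_eq_cvg; apply: nearW => N.
by apply: eq_bigr => n _; rewrite L1_class_extend0.
Qed.

End L1_series.

(** * Transfer operators *)
Section branch.
Context {R : realType}.
Local Notation mu := (@lebesgue_measure R).
Local Open Scope complex_scope.
Implicit Types (h : R -> Rcomplex R) (c : R[i]) (phi psi : R -> R).

Definition supported (i : interval R) h : Prop :=
  h \in cintegrable i /\ forall x, x \notin i -> h x = 0.

Lemma supported_extend0 i (f : L1 i) : supported i (extend0 f).
Proof. by split; [exact: extend0_cintegrable|exact: extend0_out]. Qed.

Lemma supportedD i h h' : supported i h -> supported i h' -> supported i (h + h').
Proof.
move=> [hi h0] [hi' h0']; split; first exact: rpredD.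
by move=> x xi; rewrite [LHS](_ : _ = h x + h' x)// h0// h0'// addr0.
Qed.

Lemma supportedB i h h' : supported i h -> supported i h' -> supported i (h - h').
Proof.
move=> [hi h0] [hi' h0']; split; first exact: rpredB.
by move=> x xi; rewrite [LHS](_ : _ = h x - h' x)// h0// h0'// subr0.
Qed.

Lemma supported_measurable i h : supported i h ->
  measurable_fun [set: R] (fun x => complex.Re (h x)) /\
  measurable_fun [set: R] (fun x => complex.Im (h x)).
Proof.
move=> [hi h0]; have [mr mi] := cintegrable_measurable hi; split.
  have := (measurable_restrictT (fun x => complex.Re (h x)) (measurable_itv i)).1 mr.
  congr measurable_fun; apply/funext => x; rewrite patchE; case: ifPn => //.
  by rewrite notin_setE/= => /negP xi; rewrite h0.
have := (measurable_restrictT (fun x => complex.Im (h x)) (measurable_itv i)).1 mi.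
congr measurable_fun; apply/funext => x; rewrite patchE; case: ifPn => //.
by rewrite notin_setE/= => /negP xi; rewrite h0.
Qed.

Lemma measurableT_norm h :
  measurable_fun [set: R] (fun x => complex.Re (h x)) ->
  measurable_fun [set: R] (fun x => complex.Im (h x)) ->
  measurable_fun [set: R] (fun x => `|h x| : R).
Proof. by rewrite -set_itvNyy; exact: measurable_norm. Qed.

Lemma integral_supported i (E : set R) h : supported i h -> measurable E ->
  [set` i] `<=` E ->
  (\int[mu]_(x in E) (`|h x| : R)%:E = \int[mu]_(x in [set` i]) (`|h x| : R)%:E)%E.
Proof.
move=> [_ h0] mE iE; rewrite [LHS]integral_mkcond [RHS]integral_mkcond.
apply: eq_integral => x _; rewrite !patchE.
have [xi|xi] := boolP (x \in i).
  by rewrite !mem_set//; exact: iE.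
by rewrite h0// normr0; case: ifP; case: ifP.
Qed.

Lemma supported_norm i h : supported i h ->
  (`|L1_class i h|)%:E = (\int[mu]_x (`|h x| : R)%:E)%E.
Proof. by move=> hi; rewrite (integral_supported hi)// L1_class_norm//; case: hi. Qed.

Definition branch_fun c phi psi h : R -> Rcomplex R :=
  fun x => c * (psi x)%:C * h (phi x).

Definition branch_op {i j : interval R} c phi psi : L1 i -> L1 j :=
  lift_L1 (branch_fun c phi psi).

(** Think of phi as a bijection of j onto E with derivative psi up to sign: all
    that is ever used of it is the change of variables formula, which is taken
    as the definition. *)
Record is_branch (j : interval R) (E : set R) phi psi : Prop := IsBranch {
  branch_phi : measurable_fun [set: R] phi ;
  branch_psi : measurable_fun [set: R] psi ;
  branch_ge0 : forall x, 0 <= psi x ;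
  branch_set : measurable E ;
  branch_cov : forall g : R -> \bar R, measurable_fun [set: R] g ->
    (forall x, (0 <= g x)%E) ->
    (\int[mu]_(x in [set` j]) ((psi x)%:E * g (phi x)) = \int[mu]_(x in E) g x)%E
}.

Context (i j : interval R) (E : set R) (phi psi : R -> R) (c : R[i]).
Hypotheses (B : is_branch j E phi psi) (c1 : cmod c = 1).

Lemma norm_branch_fun h x : `|branch_fun c phi psi h x| = psi x * `|h (phi x)|.
Proof.
by rewrite /branch_fun !RcnormM c1 mul1r Rcnorm_real ger0_norm// (branch_ge0 B).
Qed.

Lemma integral_branch_fun h : supported i h ->
  (\int[mu]_(x in [set` j]) (`|branch_fun c phi psi h x| : R)%:E =
   \int[mu]_(x in E) (`|h x| : R)%:E)%E.
Proof.
move=> hi; have [mr mi] := supported_measurable hi.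
have mn := measurableT_norm mr mi.
rewrite -(branch_cov B (g := fun x => (`|h x| : R)%:E)).
- by apply: eq_integral => x _; rewrite norm_branch_fun EFinM.
- exact/measurable_EFinP.
- by move=> x; rewrite lee_fin.
Qed.

Lemma branch_fun_cintegrable h : supported i h ->
  branch_fun c phi psi h \in cintegrable j.
Proof.
move=> hi; have [mr mi] := supported_measurable hi.
have mrp : measurable_fun [set: R] (fun x => complex.Re (h (phi x))).
  by apply: (measurableT_comp mr); exact: branch_phi B.
have mip : measurable_fun [set: R] (fun x => complex.Im (h (phi x))).
  by apply: (measurableT_comp mi); exact: branch_phi B.
have mpsi := branch_psi B.
apply: cintegrableP.
- apply: (@measurable_funS _ _ _ _ setT) => //.
  rewrite (_ : (fun x => _) = (fun x => (complex.Re c * psi x) * complex.Re (h (phi x))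
     - (complex.Im c * psi x) * complex.Im (h (phi x)))); last first.
    apply/funext => x; rewrite /branch_fun; case: (c) (h (phi x)) => [a b] [e f] /=.
    by rewrite !mulr0 subr0 add0r.
  apply: measurable_funB; apply: measurable_funM => //; exact: measurable_funM.
- apply: (@measurable_funS _ _ _ _ setT) => //.
  rewrite (_ : (fun x => _) = (fun x => (complex.Re c * psi x) * complex.Im (h (phi x))
     + (complex.Im c * psi x) * complex.Re (h (phi x)))); last first.
    apply/funext => x; rewrite /branch_fun; case: (c) (h (phi x)) => [a b] [e f] /=.
    by rewrite !mulr0 subr0 add0r.
  apply: measurable_funD; apply: measurable_funM => //; exact: measurable_funM.
rewrite integral_branch_fun//.
apply: (@le_lt_trans _ _ (\int[mu]_x (`|h x| : R)%:E)%E).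
  apply: ge0_subset_integral => //; first exact: branch_set B.
  - by apply/measurable_EFinP; exact: measurableT_norm.
by rewrite -(supported_norm hi) ltry.
Qed.

Lemma branch_op_norm (f : L1 i) :
  (`|branch_op c phi psi f : L1 j|)%:E = (\int[mu]_(x in E) (`|extend0 f x| : R)%:E)%E.
Proof.
have sf := supported_extend0 f.
by rewrite L1_class_norm ?integral_branch_fun//; exact: branch_fun_cintegrable.
Qed.

(** [branch_op] is computed on a chosen representative; another one differs
    from it by a function with vanishing integral of the modulus, and this is
    transported to the image. *)
Lemma branch_op_class h : supported i h ->
  branch_op c phi psi (L1_class i h) = L1_class j (branch_fun c phi psi h).
Proof.
move=> hi; have si := supported_extend0 (L1_class i h).
apply/eqP; rewrite -subr_eq0 -normr_eq0 -eqe.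
rewrite /branch_op /lift_L1.
have -> : branch_fun c phi psi h =
   branch_fun c phi psi (extend0 (L1_class i h)) +
   branch_fun c phi psi (h - extend0 (L1_class i h)).
  apply/funext => x; rewrite [RHS](_ : _ = branch_fun c phi psi (extend0 (L1_class i h)) x +
   branch_fun c phi psi (h - extend0 (L1_class i h)) x)//.
  by rewrite /branch_fun -mulrDr addrC subrK.
have sB := supportedB hi si.
rewrite L1_classD; [|exact: branch_fun_cintegrable..].
rewrite opprD addrA subrr add0r normrN L1_class_norm; last exact: branch_fun_cintegrable.
rewrite integral_branch_fun// eq_le; apply/andP; split; last first.
  by apply: integral_ge0 => x _; rewrite lee_fin.
apply: (@le_trans _ _ (\int[mu]_x (`|(h - extend0 (L1_class i h)) x| : R)%:E)%E).
  have [mr mi] := supported_measurable sB.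
  apply: ge0_subset_integral => //; first exact: branch_set B.
  by apply/measurable_EFinP; exact: measurableT_norm.
rewrite -(supported_norm sB) lee_fin.
have -> : L1_class i (h - extend0 (L1_class i h)) = 0; last by rewrite normr0.
have [hc _] := hi; have [ec _] := si.
apply/eqP; rewrite -(inj_eq (addIr (L1_class i h))) add0r.
rewrite -{2}[L1_class i h]L1_class_extend0 -L1_classD ?rpredB//.
by rewrite subrK.
Qed.

Lemma branch_opD (f g : L1 i) :
  branch_op c phi psi (f + g) = branch_op c phi psi f + branch_op c phi psi g :> L1 j.
Proof.
have sf := supported_extend0 f; have sg := supported_extend0 g.
rewrite -{1}[f]L1_class_extend0 -{1}[g]L1_class_extend0.
rewrite -L1_classD; [|by case: sf|by case: sg].
rewrite branch_op_class; last exact: supportedD.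
rewrite /branch_op /lift_L1 -L1_classD; [|exact: branch_fun_cintegrable..].
by congr L1_class; apply/funext => x; rewrite /branch_fun -mulrDr.
Qed.

End branch.

Section branch_series.
Context {R : realType} (i j : interval R).
Local Notation mu := (@lebesgue_measure R).
Variables (c : nat -> R[i]) (phi psi : nat -> R -> R) (E : nat -> set R).
Hypotheses (B : forall n, (0 < n)%N -> is_branch j (E n) (phi n) (psi n)).
Hypothesis c1 : forall n, cmod (c n) = 1.
Hypothesis disjE : forall m n, (0 < m)%N -> (0 < n)%N -> E m `&` E n !=set0 -> m = n.
Hypothesis coverE : forall x, x \in i -> exists2 n, (0 < n)%N & E n x.

Definition transfer_op : L1 i -> L1 j :=
  lift_L1 (fun h x => cseries (fun n => branch_fun (c n) (phi n) (psi n) h x)).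

Local Notation br n := (@branch_op R i j (c n) (phi n) (psi n)).

(** The n-th branch sees exactly the restriction of f to E n, and the E n
    partition the interval. *)
Lemma transfer_norm_series (f : L1 i) :
  (fun N => \sum_(0 <= n < N) `|br n.+1 f|) @ \oo --> `|f|.
Proof.
have sf := supported_extend0 f; have [mr mi] := supported_measurable sf.
have mn := measurableT_norm mr mi.
have mU : measurable (\bigcup_n E n.+1).
  by apply: bigcup_measurable => n _; exact: branch_set (B _).
have iU : [set` i] `<=` \bigcup_n E n.+1.
  by move=> x /= /coverE[[//|n] _ En]; exists n.
have := integral_supported sf mU iU.
rewrite -L1_norm_extend0 ge0_integral_bigcup//; first last.
- by move=> m n _ _ /(disjE (ltn0Sn m) (ltn0Sn n))[].
- by apply/measurable_EFinP; exact: measurable_funTS.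
- by move=> n; exact: branch_set (B _).
move=> fE.
have : (fun N => \sum_(0 <= n < N) \int[mu]_(x in E n.+1) (`|extend0 f x| : R)%:E)%E
    @ \oo --> (`|f|)%:E.
  rewrite -fE; apply: is_cvg_ereal_nneg_natsum => n _.
  by apply: integral_ge0 => x _; rewrite lee_fin.
move=> /fine_cvg; apply: cvg_trans; apply: near_eq_cvg; apply: nearW => N /=.
rewrite (eq_bigr (fun n => (`|br n.+1 f|)%:E)) ?sumEFin// => n _.
by rewrite (branch_op_norm (B (ltn0Sn _)) (c1 _)).
Qed.

Lemma transfer_norm_partial (f : L1 i) N : \sum_(0 <= n < N) `|br n.+1 f| <= `|f|.
Proof.
have cf := @transfer_norm_series f.
rewrite -(cvg_lim _ cf)//; apply: nondecreasing_cvgn_le.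
  by apply/nondecreasing_seqP => m; rewrite big_nat_recr//= lerDl.
by apply/cvg_ex; exists `|f|.
Qed.

Lemma transfer_series (f : L1 i) :
  (fun N => \sum_(0 <= n < N) br n.+1 f) @ \oo --> transfer_op f.
Proof.
pose u n : R -> Rcomplex R := if n is 0 then 0 else branch_fun (c n) (phi n) (psi n) (extend0 f).
have ui n : u n \in cintegrable j.
  case: n => [|n]; first exact: rpred0.
  exact: (branch_fun_cintegrable (B (ltn0Sn n)) (c1 _) (supported_extend0 f)).
have [||cu lu] := @L1_cseries R j u `|f|.
- exact: ui.
- move=> [|N]; first by rewrite big_geq.
  rewrite big_add1/=; exact: transfer_norm_partial.
have -> : transfer_op f = L1_class j (fun x => cseries (u^~ x)).
  rewrite /transfer_op /lift_L1; congr L1_class; apply/funext => x.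
  by rewrite /cseries; congr (_ +i* _)%C; congr (limn _); apply/funext => N;
    apply: eq_big_nat => -[].
rewrite -cvg_shiftS in lu; move: lu; apply: cvg_trans; apply: near_eq_cvg; apply: nearW => N /=.
by rewrite big_add1.
Qed.

Lemma transfer_op_norm (f : L1 i) : `|transfer_op f| <= `|f|.
Proof.
have /(_ eventually_filter) cf := cvg_norm (@transfer_series f).
rewrite -(cvg_lim _ cf)//; apply: limr_le; first by apply/cvg_ex; eexists; exact: cf.
apply: nearW => N /=; apply: le_trans (transfer_norm_partial f N).
exact: ler_norm_sum.
Qed.

Lemma transfer_opD (f g : L1 i) : transfer_op (f + g) = transfer_op f + transfer_op g.
Proof.
have cfg := @transfer_series (f + g).
have /(_ eventually_filter) := cvgD (@transfer_series f) (@transfer_series g).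
rewrite (_ : _ + _ = (fun N => \sum_(0 <= n < N) br n.+1 (f + g))); last first.
  apply/funext => N; rewrite [LHS](_ : _ =
    \sum_(0 <= n < N) br n.+1 f + \sum_(0 <= n < N) br n.+1 g)// -big_split/=.
  apply: eq_bigr => n _.
  by rewrite (branch_opD (B (ltn0Sn n)) (c1 _)).
by move=> cD; exact: (cvg_unique _ cfg cD).
Qed.

End branch_series.

(** * The operators L, S and J *)
Section operators_as_transfers.
Context {R : realType}.
Local Notation mu := (@lebesgue_measure R).
Implicit Types (q x : R) (w : R[i]).

(** The inverse branches of the Gauss map, and the absolute values of their
    derivatives. *)
Definition gphi q (n : nat) : R -> R := fun x => q / (n%:R + x).
Definition gpsi q (n : nat) : R -> R := fun x => q / (n%:R + x) ^+ 2.

Lemma measurable_addl (n : nat) : measurable_fun [set: R] (fun x => n%:R + x).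
Proof. exact: measurable_funD. Qed.

Lemma measurable_divl q (f : R -> R) : measurable_fun [set: R] f ->
  measurable_fun [set: R] (fun x => q / f x).
Proof.
move=> mf; apply: measurable_funM => //.
exact: (measurableT_comp measurable_invr mf).
Qed.

Lemma gphi_branch q n : 1 < q -> (0 < n)%N ->
  is_branch `]0, 1[ [set` `]q / n.+1%:R, q / n%:R]] (gphi q n) (gpsi q n).
Proof.
move=> q1 n0; have q0 : 0 < q by exact: lt_trans q1.
have n0' : 0 < n%:R :> R by rewrite ltr0n.
split.
- exact: measurable_divl (measurable_addl n).
- by apply: measurable_divl; apply: measurable_funX; exact: measurable_addl.
- by move=> x; rewrite divr_ge0 ?sqr_ge0// ltW.
- exact: measurable_itv.
move=> g mg g0.
have m2 : measurable_fun [set: R] (fun x => (q / x ^+ 2)%:E * g (q / x)%R)%E.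
  apply: emeasurable_funM.
    by apply/measurable_EFinP; apply: measurable_divl; exact: exprn_measurable.
  apply: (measurableT_comp mg); exact: measurable_divl.
have := @change_of_variables_translation R n%:R 0 1
  (fun x => (q / x ^+ 2)%:E * g (q / x)%R)%E m2.
rewrite add0r => cov.
transitivity (\int[mu]_(x in `]n%:R, (1 + n%:R)%R[) ((q / x ^+ 2)%:E * g (q / x)%R))%E.
  rewrite -cov; last by move=> x; rewrite mule_ge0// lee_fin divr_ge0 ?sqr_ge0// ltW.
  by apply: eq_integral => x _; rewrite /gphi /gpsi addrC.
rewrite change_of_variables_inversion//; last by rewrite ltrDr.
rewrite -natr1 addrC integral_itv_bndo_bndc//; exact: measurable_funTS.
Qed.

Lemma gphi_disjoint q m n : 0 < q -> (0 < m)%N -> (0 < n)%N ->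
  [set` `]q / m.+1%:R, q / m%:R]] `&` [set` `]q / n.+1%:R, q / n%:R]] !=set0 -> m = n.
Proof.
move=> q0 m0 n0 [x [/=]]; rewrite !in_itv/= => /andP[xm mx] /andP[xn nx].
have x0 : 0 < x by apply: lt_trans xm; rewrite divr_gt0.
have key (k : nat) : (0 < k)%N -> q / k.+1%:R < x -> x <= q / k%:R -> k = Num.truncn (q / x).
  move=> k0 h1 h2; apply/esym/eqP; rewrite truncn_eq; last by rewrite divr_ge0 ?ltW.
  apply/andP; split; first by rewrite ler_pdivlMr// mulrC -ler_pdivlMr ?ltr0n.
  by rewrite ltr_pdivrMr// mulrC -ltr_pdivrMr ?ltr0n.
by rewrite (key m)// (key n).
Qed.

Lemma gphi_cover q x : 1 < q -> x \in `]0, 1[ ->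
  exists2 n, (0 < n)%N & [set` `]q / n.+1%:R, q / n%:R]] x.
Proof.
move=> q1; rewrite in_itv/= => /andP[x0 x1]; have q0 : 0 < q by exact: lt_trans q1.
have qx0 : 0 <= q / x by rewrite divr_ge0 ?ltW.
have n0 : (0 < Num.truncn (q / x))%N.
  rewrite truncn_gt0 ler_pdivlMr// mul1r; exact/ltW/(lt_trans x1).
exists (Num.truncn (q / x)) => //=; rewrite in_itv/=.
have /andP[h1 h2] := truncn_itv qx0.
rewrite ltr_pdivrMr ?ltr0n// mulrC -ltr_pdivrMr// h2/=.
by rewrite ler_pdivlMr ?ltr0n// mulrC -ler_pdivlMr.
Qed.

Lemma shift_branch n : is_branch `]0, 1[ [set` `[n%:R, n.+1%:R[] (fun x : R => x + n%:R) (fun=> 1).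
Proof.
split => //.
- exact: measurable_funD.
move=> g mg g0; under eq_integral do rewrite mul1e.
rewrite change_of_variables_translation// add0r -natr1 addrC.
by rewrite integral_itv_obnd_cbnd//; exact: measurable_funTS.
Qed.

Lemma shift_disjoint m n :
  [set` `[m%:R : R, m.+1%:R[] `&` [set` `[n%:R, n.+1%:R[] !=set0 -> m = n.
Proof.
move=> [x [/=]]; rewrite !in_itv/= => mx nx.
have x0 : 0 <= x by case/andP: mx => mx _; apply: le_trans mx.
by have := truncn_def mx; rewrite (truncn_def nx).
Qed.

Lemma shift_cover q x : x \in `]1, q[ ->
  exists2 n, (0 < n)%N & [set` `[n%:R, n.+1%:R[] x.
Proof.
rewrite in_itv/= => /andP[x1 _]; have x0 : 0 <= x by apply: ltW; exact: lt_trans x1.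
exists (Num.truncn x); first by rewrite truncn_gt0 ltW.
by rewrite /= in_itv/=; exact: truncn_itv.
Qed.

Lemma inversion_branch q : 1 < q ->
  is_branch `]1, q[ [set` `]1, q[] (fun x => q / x) (fun x => q / x ^+ 2).
Proof.
move=> q1; have q0 : 0 < q by exact: lt_trans q1.
split => //.
- exact: measurable_divl.
- by apply: measurable_divl; exact: exprn_measurable.
- by move=> x; rewrite divr_ge0 ?sqr_ge0// ltW.
move=> g mg g0; rewrite change_of_variables_inversion//.
by rewrite divr1 divff// gt_eqF.
Qed.

Lemma cmodX_1 w n : cmod w = 1 -> cmod (w ^+ n) = 1.
Proof. by move=> w1; rewrite RcnormX w1 expr1n. Qed.

Section L_op.
Variables (q : R) (w : R[i]).
Hypotheses (q1 : 1 < q) (w1 : cmod w = 1).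
Local Notation X := (L1 (`]0, 1[ : interval R)).

Definition L_branch n : X -> X := branch_op (w ^+ n) (gphi q n) (gpsi q n).

Let wX n : cmod (w ^+ n) = 1. Proof. exact: cmodX_1. Qed.
Let Bn n := @gphi_branch q n q1.
Let q0 : 0 < q. Proof. exact: lt_trans q1. Qed.

Lemma L_opE : L_op w q =
  @transfer_op R `]0, 1[ `]0, 1[ (fun n => w ^+ n) (gphi q) (gpsi q).
Proof. by []. Qed.

Lemma L_opD f g : L_op w q (f + g) = L_op w q f + L_op w q g.
Proof.
rewrite L_opE; apply: (transfer_opD Bn wX) => [m n|x]; last exact: gphi_cover.
exact: gphi_disjoint.
Qed.

Lemma L_op_norm f : `|L_op w q f| <= `|f|.
Proof.
rewrite L_opE; apply: (transfer_op_norm Bn wX) => [m n|x]; last exact: gphi_cover.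
exact: gphi_disjoint.
Qed.

Lemma L_op_series f : (fun N => \sum_(0 <= n < N) L_branch n.+1 f) @ \oo --> L_op w q f.
Proof.
rewrite L_opE; apply: (transfer_series Bn wX) => [m n|x]; last exact: gphi_cover.
exact: gphi_disjoint.
Qed.

Lemma L_norm_series f : (fun N => \sum_(0 <= n < N) `|L_branch n.+1 f|) @ \oo --> `|f|.
Proof.
apply: (transfer_norm_series Bn wX) => [m n|x]; last exact: gphi_cover.
exact: gphi_disjoint.
Qed.

Lemma L_norm_partial f N : \sum_(0 <= n < N) `|L_branch n.+1 f| <= `|f|.
Proof.
apply: (transfer_norm_partial Bn wX) => [m n|x]; last exact: gphi_cover.
exact: gphi_disjoint.
Qed.

End L_op.

Section S_op.
Variables (q : R) (w : R[i]).
Hypothesis w1 : cmod w = 1.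
Local Notation X := (L1 (`]0, 1[ : interval R)).
Local Notation Y := (L1 (`]1, q[ : interval R)).

Definition S_branch n : Y -> X := branch_op (w ^+ n) (fun x => x + n%:R) (fun=> 1).

Let wX n : cmod (w ^+ n) = 1. Proof. exact: cmodX_1. Qed.
Let Bn n (_ : (0 < n)%N) := @shift_branch n.

Lemma S_opE : @S_op R w q = @transfer_op R `]1, q[ `]0, 1[
  (fun n => w ^+ n) (fun n x => x + n%:R) (fun _ _ => 1).
Proof.
apply/funext => f; rewrite /S_op /transfer_op /lift_L1; congr L1_class.
apply/funext => x; rewrite /S_fun; congr cseries; apply/funext => n.
by rewrite /branch_fun mulr1.
Qed.

Lemma S_opD (f g : Y) : S_op w (f + g) = S_op w f + S_op w g.
Proof.
rewrite S_opE; apply: (transfer_opD Bn wX) => [m n _ _|x]; last exact: shift_cover.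
exact: shift_disjoint.
Qed.

Lemma S_op_norm (f : Y) : `|S_op w f| <= `|f|.
Proof.
rewrite S_opE; apply: (transfer_op_norm Bn wX) => [m n _ _|x]; last exact: shift_cover.
exact: shift_disjoint.
Qed.

Lemma S_op_series f : (fun N => \sum_(0 <= n < N) S_branch n.+1 f) @ \oo --> S_op w f.
Proof.
rewrite S_opE; apply: (transfer_series Bn wX) => [m n _ _|x]; last exact: shift_cover.
exact: shift_disjoint.
Qed.

End S_op.

Section J_op.
Variables (q : R).
Hypotheses (q1 : 1 < q).
Local Notation Y := (L1 (`]1, q[ : interval R)).

Lemma cmod1 : cmod (1 : R[i]) = 1.
Proof. by apply: Rcnorm1; rewrite normr1. Qed.

Lemma J_opE : @J_op R q = branch_op 1 (fun x => q / x) (fun x => q / x ^+ 2).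
Proof.
apply/funext => f; rewrite /J_op /branch_op /lift_L1; congr L1_class.
by apply/funext => x; rewrite /J_fun /branch_fun mul1r.
Qed.

Lemma J_opD (f g : Y) : J_op (f + g) = J_op f + J_op g.
Proof. by rewrite J_opE (branch_opD (inversion_branch q1) cmod1). Qed.

End J_op.
End operators_as_transfers.

(** * Bumps: a density on an interval, with a phase *)
Section bumps.
Context {R : realType}.
Local Notation mu := (@lebesgue_measure R).
Implicit Types (i j : interval R) (c : R[i]) (a b s : R) (rho : R -> R).
Local Open Scope complex_scope.

Definition bump_fun c a b rho : R -> Rcomplex R :=
  fun x => if a < x < b then c * (rho x)%:C else 0.

Definition bump i c a b rho : L1 i := L1_class i (bump_fun c a b rho).

Record density a b rho s : Prop := Density {
  density_measurable : measurable_fun [set: R] rho ;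
  density_ge0 : forall x, 0 <= rho x ;
  density_le : forall x, a < x < b -> rho x <= s
}.

Lemma normr_bump_fun c a b rho x : (forall x, 0 <= rho x) ->
  (`|bump_fun c a b rho x| = if a < x < b then cmod c * rho x else 0)%R.
Proof.
move=> r0; rewrite /bump_fun; case: ifPn => _; last by rewrite normr0.
by rewrite RcnormM Rcnorm_real ger0_norm.
Qed.

Lemma integral_bump_fun i c a b rho s : density a b rho s ->
  (forall x, a < x < b -> x \in i) ->
  (\int[mu]_(x in [set` i]) (`|bump_fun c a b rho x| : R)%:E =
   \int[mu]_(x in `]a, b[) (cmod c * rho x)%:E)%E.
Proof.
move=> [mr r0 rs] abi; rewrite [LHS]integral_mkcond [RHS]integral_mkcond.
apply: eq_integral => x _; rewrite !patchE mem_setE (@normr_bump_fun c a b rho)//.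
have -> : (x \in [set` `]a, b[]) = (a < x < b) by rewrite mem_setE in_itv.
case: ifPn => [xi|xi]; case: ifPn => // axb.
by rewrite abi in xi.
Qed.

Lemma integrable_density a b rho s : density a b rho s ->
  mu.-integrable `]a, b[ (EFin \o rho).
Proof.
move=> [mr r0 rs].
apply: (@le_integrable _ _ _ mu _ _ _ (cst s%:E)) => //.
- exact/measurable_EFinP/measurable_funTS.
- move=> x /=; rewrite in_itv/= => /rs rxs.
  by rewrite lee_fin ger0_norm// (le_trans rxs)// ler_norm.
- apply/integrableP; split; first exact: measurable_cst.
  rewrite (eq_integral (fun=> (`|s|)%:E))// integral_cst//.
  have abE := @lebesgue_measure_itv R `]a, b[.
  rewrite [X in (_ * X < _)%E]abE /=.
  by case: ifPn => _; rewrite ?mule0// -EFinB -EFinM ltry.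
Qed.

Lemma bump_cintegrable i c a b rho s : density a b rho s ->
  (forall x, a < x < b -> x \in i) -> bump_fun c a b rho \in cintegrable i.
Proof.
move=> dr abi; have [mr r0 rs] := dr.
have mcond : measurable_fun [set: R] (fun x => a < x < b).
  by apply: measurable_and; apply: measurable_fun_ltr.
apply: cintegrableP.
- apply: (@measurable_funS _ _ _ _ setT) => //.
  rewrite (_ : (fun x => _) = (fun x => if a < x < b then complex.Re c * rho x else 0)).
    by apply: measurable_fun_ifT => //; exact: measurable_funM.
  apply/funext => x; rewrite /bump_fun; case: ifP => // _.
  by case: (c) => u v /=; rewrite mulr0 subr0.
- apply: (@measurable_funS _ _ _ _ setT) => //.
  rewrite (_ : (fun x => _) = (fun x => if a < x < b then complex.Im c * rho x else 0)).
    by apply: measurable_fun_ifT => //; exact: measurable_funM.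
  apply/funext => x; rewrite /bump_fun; case: ifP => // _.
  by case: (c) => u v /=; rewrite mulr0 add0r.
rewrite (integral_bump_fun _ dr)//.
under eq_integral do rewrite EFinM.
rewrite ge0_integralZl//; last first.
- by move=> x _; rewrite lee_fin.
- exact/measurable_EFinP/measurable_funTS.
rewrite lte_mul_pinfty ?lee_fin//.
have /integrableP[_] := integrable_density dr.
by congr (_ < _)%E; apply: eq_integral => x _ /=; rewrite ger0_norm.
Qed.

Lemma bump_supported i c a b rho s : density a b rho s ->
  (forall x, a < x < b -> x \in i) -> supported i (bump_fun c a b rho).
Proof.
move=> dr abi; split; first exact: bump_cintegrable dr abi.
by move=> x xi; rewrite /bump_fun; case: ifPn => // /abi; rewrite (negbTE xi).
Qed.

Lemma bump_norm i c a b rho s : density a b rho s ->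
  (forall x, a < x < b -> x \in i) -> cmod c = 1 ->
  `|bump i c a b rho| = \int[mu]_(x in `]a, b[) rho x.
Proof.
move=> dr abi c1; have := L1_class_norm (bump_cintegrable c dr abi).
rewrite (integral_bump_fun _ dr)// /bump => /(congr1 fine)/= ->.
by rewrite c1; under eq_integral do rewrite mul1r.
Qed.

(** A branch moves a bump to a bump as soon as the preimage of its interval is
    an interval. *)
Lemma branch_op_bump i j (E : set R) (phi psi : R -> R) d c a b a' b' rho s :
  is_branch j E phi psi -> cmod d = 1 -> density a b rho s ->
  (forall x, a < x < b -> x \in i) ->
  (forall x, x \in j -> (a < phi x < b) = (a' < x < b')) ->
  branch_op d phi psi (bump i c a b rho) =
    bump j (d * c) a' b' (fun x => psi x * rho (phi x)).
Proof.
move=> B d1 dr abi abj; rewrite /bump (branch_op_class B)//; last first.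
  exact: bump_supported dr abi.
have ci := branch_fun_cintegrable B d1 (bump_supported c dr abi).
apply: (L1_class_eqin ci _).2 => x xj; rewrite /branch_fun /bump_fun abj//.
case: ifP => _; last by rewrite mulr0.
by rewrite rmorphM/= mulrACA.
Qed.

End bumps.

(** * Bounded additive maps and the gliding hump *)
Section bounded_additive.
Context {R : realType}.

(** Additivity suffices for all the arguments, and is easier to establish than
    linearity for operators defined on classes of functions. *)
Record bounded_additive (V W : normedModType R) (K : R) (T : V -> W) : Prop :=
  BoundedAdditive {
    badditiveD : forall f g, T (f + g) = T f + T g ;
    badditive_norm : forall f, `|T f| <= K * `|f| }.

Section theory.
Context {V W : normedModType R} (K : R) (T : V -> W).
Hypothesis bT : bounded_additive K T.

Lemma badditive0 : T 0 = 0.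
Proof. by apply: (addrI (T 0)); rewrite -(badditiveD bT) !addr0. Qed.

Lemma badditiveN f : T (- f) = - T f.
Proof. by apply: (addrI (T f)); rewrite -(badditiveD bT) !subrr badditive0. Qed.

Lemma badditiveB f g : T (f - g) = T f - T g.
Proof. by rewrite (badditiveD bT) badditiveN. Qed.

Lemma badditive_sum (I : Type) (s : seq I) (F : I -> V) :
  T (\sum_(k <- s) F k) = \sum_(k <- s) T (F k).
Proof.
elim: s => [|k s IHs]; first by rewrite !big_nil badditive0.
by rewrite !big_cons (badditiveD bT) IHs.
Qed.

Lemma badditive_cvg (u : nat -> V) l : u @ \oo --> l -> (T \o u) @ \oo --> T l.
Proof.
move=> /cvgrPdist_lt ul; apply/cvgrPdist_le => e e0.
have K0 : 0 < `|K| + 1 by rewrite ltr_wpDl.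
have /ul : 0 < e / (`|K| + 1) by rewrite divr_gt0.
apply: filterS => n; rewrite ltr_pdivlMr// => une /=.
rewrite -badditiveB (le_trans (badditive_norm bT _))//.
apply/ltW/(le_lt_trans _ une); rewrite mulrC ler_wpM2l//.
by rewrite (le_trans (ler_norm _))// lerDl.
Qed.

End theory.

Lemma bounded_additive_comp (U V W : normedModType R) (K L : R)
    (S : U -> V) (T : V -> W) : 0 <= L ->
  bounded_additive K S -> bounded_additive L T -> bounded_additive (L * K) (T \o S).
Proof.
move=> L0 bS bT; split => [f g|f] /=.
  by rewrite (badditiveD bS) (badditiveD bT).
rewrite (le_trans (badditive_norm bT _))// -mulrA ler_wpM2l//.
exact: badditive_norm bS _.
Qed.

Lemma bounded_additiveD (V W : normedModType R) (K L : R) (S T : V -> W) :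
  bounded_additive K S -> bounded_additive L T ->
  bounded_additive (K + L) (fun f => S f + T f).
Proof.
move=> bS bT; split => [f g|f] /=.
  by rewrite (badditiveD bS) (badditiveD bT) addrACA.
rewrite (le_trans (ler_normD _ _))// mulrDl lerD//.
  exact: badditive_norm bS _.
exact: badditive_norm bT _.
Qed.

Lemma bounded_additive_iter (V : normedModType R) (T : V -> V) n :
  bounded_additive 1 T -> bounded_additive 1 (iter n T).
Proof.
move=> bT; elim: n => [|n IHn]; first by split => // f; rewrite mul1r.
rewrite -[X in bounded_additive X]mulr1.
exact: (bounded_additive_comp ler01 IHn bT).
Qed.

Lemma bounded_additive_sum (V W : normedModType R) (K : R) (T : nat -> V -> W) N :
  (forall j, bounded_additive K (T j)) ->
  bounded_additive (K * N%:R) (fun f => \sum_(j < N) T j f).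
Proof.
move=> bT; split => [f g|f].
  by rewrite -big_split/=; apply: eq_bigr => j _; rewrite (badditiveD (bT j)).
rewrite (le_trans (ler_norm_sum _ _ _))//.
apply: (@le_trans _ _ (\sum_(j < N) K * `|f|)).
  by apply: ler_sum => j _; exact: badditive_norm (bT j) _.
by rewrite sumr_const card_ord -mulrA [N%:R * _]mulrC mulrA mulr_natr.
Qed.

End bounded_additive.

Section uniform_boundedness.
Context {R : realType} (V W : normedModType R).
Variables (G : nat -> V -> W) (K : nat -> R).
Hypothesis bG : forall N, bounded_additive (K N) (G N).

Let D := [set v | cvgn (fun N => G N v)].

Lemma cvgn_normr_bounded (u : nat -> W) : cvgn u -> exists C : R, forall n, `|u n| <= C.
Proof.
move=> /cvg_seq_bounded[C [_ /(_ (C + 1))]]; rewrite ltrDl ltr01 => /(_ isT) uC.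
by exists (C + 1) => n; exact: uC.
Qed.

(** Where the sequence G N v converges, it is bounded, so the domain is the
    union of its parts F n where the bound n holds.  The closure of F n still
    satisfies the bound; if it contained a ball, taking differences would bound
    all the G N by 2n on a ball around 0. *)
Lemma meagre_cvg_domain :
  (forall C r, 0 < r -> exists N v, `|v| <= r /\ C < `|G N v|) -> meagre D.
Proof.
move=> unb; pose F n := D `&` [set v | forall N, `|G N v| <= n%:R].
exists F; last first.
  apply/seteqP; split=> [v Dv|v [n _ []]//].
  have [C vC] := cvgn_normr_bounded Dv.
  exists (Num.truncn `|C|).+1 => //; split => // N.
  by rewrite (le_trans (vC N))// (le_trans (ler_norm _))// ltW// truncnS_gt.
move=> n; apply/seteqP; split => // v.
rewrite /interior => /nbhs_ballP[r /= r0 vr].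
have clF w : closure (F n) w -> forall N, `|G N w| <= n%:R.
  move=> cw N; apply/ler_addgt0Pl => e e0.
  have K0 : 0 < `|K N| + 1 by rewrite ltr_wpDl.
  have /cw[u [[_ /(_ N) un]]] : nbhs w (ball w (e / (`|K N| + 1))).
    by apply: nbhsx_ballx; rewrite divr_gt0.
  rewrite -ball_normE/= ltr_pdivlMr// => wu.
  rewrite -(subrK u w) (badditiveD (bG N)) (le_trans (ler_normD _ _))// lerD//.
  rewrite (le_trans (badditive_norm (bG N) _))//.
  apply/ltW/(le_lt_trans _ wu); rewrite mulrC ler_wpM2l//.
  by rewrite (le_trans (ler_norm _))// lerDl.
have r20 : 0 < r / 2 by rewrite divr_gt0.
have [N [u [ur]]] := unb (n%:R + n%:R) _ r20.
apply/negP; rewrite -leNgt.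
rewrite -[u](addrK v) (badditiveB (bG N)) (le_trans (ler_normB _ _))// lerD//.
- apply: clF; apply: vr; rewrite -ball_normE/= opprD addrCA subrr addr0 normrN.
  by rewrite (le_lt_trans ur)// ltr_pdivrMr// ltr_pMr// ltr1n.
- by apply: clF; apply: vr; exact: ballxx.
Qed.

Hypothesis complete_series : forall (g : nat -> V) (M : R),
  (forall N, \sum_(0 <= n < N) `|g n| <= M) -> cvgn (series g).

Section gliding_hump.
Variables (v : nat -> V) (m : nat -> nat).

(** One of |G (x + v)| and |G (x - v)| is at least |G v|: the sign is chosen
    at each step so that the hump v k is not lost under G (m k). *)
Fixpoint hump k : V :=
  if k is k'.+1 then
    if `|G (m k') (v k')| <= `|G (m k') (hump k' + v k')| then hump k' + v k'
    else hump k' - v k'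
  else 0.

Lemma hump_step k : `|hump k.+1 - hump k| = `|v k|.
Proof.
rewrite /=; case: ifPn => _; rewrite addrAC subrr add0r// normrN//.
Qed.

Lemma hump_large k : `|G (m k) (v k)| <= `|G (m k) (hump k.+1)|.
Proof.
rewrite /=; case: ifPn => // /negP; apply: contra_notT; rewrite -ltNge => lt2.
have bk := bG (m k).
have : `|G (m k) (v k) + G (m k) (v k)| <=
    `|G (m k) (hump k + v k)| + `|G (m k) (hump k - v k)|.
  rewrite (le_trans _ (ler_normB _ _))// -(badditiveB bk) -(badditiveD bk).
  by rewrite opprB [hump k + _]addrC -addrA [hump k + _]addrC subrK.
rewrite -mulr2n normrMn mulr2n => le1.
by rewrite leNgt; apply/negP => lt1; have := ltrD lt1 lt2; rewrite ltNge le1.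
Qed.

End gliding_hump.

(** With |v k| = 4^-k and m k = 8^k, the k-th hump has size 2 * 2^k under
    G (m k), whereas all the later humps together have norm at most
    (4/3) 4^-(k+1), hence contribute at most (2/3) 2^k: along the sequence m k
    the values at the limit are unbounded. *)
Lemma cvg_domain_proper : (forall N, K N = 2 * N%:R) ->
  (forall N r, (0 < N)%N -> 0 < r -> exists2 v, `|v| = r & `|G N v| = 2 * N%:R * r) ->
  D `<` setT.
Proof.
move=> KE hyp; split => // DT.
pose m k := (8 ^ k)%N; pose e k : R := 4%:R ^- k.
have e0 k : 0 < e k by rewrite invr_gt0 exprn_gt0.
have m0 k : (0 < m k)%N by rewrite expn_gt0.
have /choice[v vP] k : exists v, `|v| = e k /\ `|G (m k) v| = 2 * (m k)%:R * e k.
  by have [v ? ?] := hyp _ _ (m0 k) (e0 k); exists v.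
pose x := hump v m; pose g k := x k.+1 - x k.
have gE k : `|g k| = e k by rewrite /g hump_step; have [] := vP k.
have esum a b : \sum_(a <= k < b) e k <= 4 / 3 * e a.
  have [ab|ba] := leqP a b; last first.
    by rewrite big_geq ?(ltnW ba)// mulr_ge0// ltW.
  suff : \sum_(a <= k < b) e k + 4 / 3 * e b = 4 / 3 * e a.
    by move=> <-; rewrite lerDl mulr_ge0// ltW.
  rewrite -(subnKC ab); elim: (b - a)%N => [|n IHn].
    by rewrite addn0 big_geq// add0r.
  rewrite addnS big_nat_recr/= ?leq_addr// -IHn -addrA; congr (_ + _).
  rewrite /e exprS invfM; lra.
have [l gl] : exists l : V, x @ \oo --> l.
  have /cvg_ex[/= l gl] : cvgn (series g).
    apply: (@complete_series _ (4 / 3 * e 0%N)) => N.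
    by under eq_bigr do rewrite gE; exact: esum.
  exists l; move: gl; apply: cvg_trans; apply: near_eq_cvg; apply: nearW => N.
  by rewrite /series/= telescope_sumr// /x/= subr0.
have xl k : `|l - x k| <= 4 / 3 * e k.
  have cl : (fun n => `|x n - x k|) @ \oo --> `|l - x k|.
    by apply: cvg_norm; apply: cvgB => //; exact: cvg_cst.
  rewrite -(cvg_lim _ cl)//; apply: limr_le; first by apply/cvg_ex; exists `|l - x k|.
  exists k => // n /= kn; rewrite -telescope_sumr// (le_trans (ler_norm_sum _ _ _))//.
  by under eq_bigr do rewrite -/(g _) gE; exact: esum.
have /cvgn_normr_bounded[C lC] : D l by exact: DT.
have low k : 4 / 3 * 2 ^+ k <= C.
  apply: le_trans (lC (m k)); rewrite -[l](subrK (x k.+1)) (badditiveD (bG _)).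
  rewrite addrC -[X in _ + X]opprK (le_trans _ (lerB_dist _ _))// normrN.
  have := hump_large v m k; rewrite (vP k).2 => h1.
  have := badditive_norm (bG (m k)) (l - x k.+1); rewrite KE => h2.
  have h3 : 2 * (m k)%:R * `|l - x k.+1| <= 2 * (m k)%:R * (4 / 3 * e k.+1).
    by rewrite ler_wpM2l// xl.
  have -> : 2 ^+ k = (m k)%:R * e k :> R.
    by rewrite /m /e natrX -exprVn -exprMn; congr (_ ^+ _); lra.
  have eS : e k.+1 = e k / 4 by rewrite /e exprS invfM mulrC.
  rewrite -/(x k.+1) in h1; move: h1 h2 h3; rewrite eS.
  set y := `|_ (x _)|; set z := `|_ (l - _)|; set M := (m k)%:R; nra.
have [k Ck] : exists k : nat, C < 2 ^+ k.
  exists (Num.truncn `|C|).+1; rewrite (le_lt_trans (ler_norm _))//.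
  rewrite (lt_le_trans (truncnS_gt _))// -natrX ler_nat ltnW// ltn_expl//.
have k0 : 0 < 2 ^+ k :> R by rewrite exprn_gt0.
by have := low k; move: k0 Ck; set y := 2 ^+ k; lra.
Qed.

End uniform_boundedness.

(** * Gauges generated by a family of vectors *)
Section hull.
Context {R : realType} (X : normedModType R) (T : Type) (val : T -> X).

(** The ball of radius r of a gauge generated by the vectors [val p].  There are
    no coefficients in the sums: scaling a vector is part of the choice of p. *)
Definition hull (cost : T -> R) (r : R) : set X := [set f |
  forall e, 0 < e -> exists2 s : seq T, \sum_(p <- s) cost p <= r &
    `|f - \sum_(p <- s) val p| <= e].

Lemma hull_val cost p : hull cost (cost p) (val p).
Proof. by move=> e e0; exists [:: p]; rewrite big_seq1// subrr normr0 ltW. Qed.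

Lemma hull0 cost r : 0 <= r -> hull cost r 0.
Proof. by move=> r0 e e0; exists [::]; rewrite big_nil// subrr normr0 ltW. Qed.

Lemma hull_le cost r r' : r <= r' -> hull cost r `<=` hull cost r'.
Proof. by move=> rr f fr e /fr[s sr]; exists s => //; exact: le_trans rr. Qed.

Lemma hull_val_le cost p r : cost p <= r -> hull cost r (val p).
Proof. by move=> pr; apply: hull_le pr _ _; exact: hull_val. Qed.

Lemma hullD cost r r' f f' : hull cost r f -> hull cost r' f' -> hull cost (r + r') (f + f').
Proof.
move=> fr fr' e e0; have e20 : 0 < e / 2 by rewrite divr_gt0.
have [s sr se] := fr _ e20; have [s' sr' se'] := fr' _ e20.
exists (s ++ s'); rewrite big_cat/=; first exact: lerD.
by rewrite opprD addrACA [e]splitr (le_trans (ler_normD _ _))// lerD.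
Qed.

Lemma hull_sum cost (I : Type) (s : seq I) (f : I -> X) (r : I -> R) :
  (forall k, hull cost (r k) (f k)) ->
  hull cost (\sum_(k <- s) r k) (\sum_(k <- s) f k).
Proof.
move=> fr; elim: s => [|k s IHs]; first by rewrite !big_nil; exact: hull0.
by rewrite !big_cons; exact: hullD.
Qed.

Lemma hull_close cost r f :
  (forall e, 0 < e -> exists2 g, hull cost r g & `|f - g| <= e) -> hull cost r f.
Proof.
move=> fg e e0; have e20 : 0 < e / 2 by rewrite divr_gt0.
have [g gr ge] := fg _ e20; have [s sr se] := gr _ e20.
exists s => //; rewrite -(subrK g f) -addrA [e]splitr.
by rewrite (le_trans (ler_normD _ _))// lerD.
Qed.

Lemma hull_lim cost r (u : nat -> X) f : u @ \oo --> f ->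
  (forall n, hull cost r (u n)) -> hull cost r f.
Proof.
move=> /cvgrPdist_le uf ur; apply: hull_close => e e0.
by have [N _ /(_ N (leqnn N)) uN] := uf _ e0; exists (u N).
Qed.

Lemma hull_norm cost r f : (forall p, `|val p| <= cost p) -> hull cost r f -> `|f| <= r.
Proof.
move=> vc fr; apply/ler_addgt0Pl => e e0; have [s sr se] := fr _ e0.
rewrite -(subrK (\sum_(p <- s) val p) f) (le_trans (ler_normD _ _))// lerD//.
rewrite (le_trans (ler_norm_sum _ _ _))// (le_trans _ sr)//.
by apply: ler_sum => p _.
Qed.

(** A bound on the images of the generators is a bound on all images: this is
    how every estimate below is reduced to single atoms. *)
Lemma hull_map (K : R) (S : X -> X) cost cost' r f : bounded_additive K S ->
  (forall p, hull cost (cost' p) (S (val p))) ->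
  hull cost' r f -> hull cost r (S f).
Proof.
move=> bS Sp fr; apply: hull_close => e e0.
have K0 : 0 < `|K| + 1 by rewrite ltr_wpDl.
have [s sr se] := fr _ (divr_gt0 e0 K0).
exists (S (\sum_(p <- s) val p)).
  rewrite (badditive_sum bS); apply: hull_le sr _ _; exact: hull_sum.
rewrite -(badditiveB bS) (le_trans (badditive_norm bS _))//.
move: se; rewrite ler_pdivlMr// => se; apply: le_trans se.
by rewrite mulrC ler_wpM2l// (le_trans (ler_norm _))// lerDl.
Qed.

Lemma hull_cost cost cost' r f : (forall p, hull cost (cost' p) (val p)) ->
  hull cost' r f -> hull cost r f.
Proof.
move=> cc; apply: (@hull_map 1 id) => //.
by split => // g; rewrite mul1r.
Qed.

End hull.

(** * Functions carried by a single branch *)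
Section single_branch.
Context {R : realType}.
Local Notation mu := (@lebesgue_measure R).
Implicit Types (c w : R[i]) (a b s : R) (rho : R -> R).

Lemma branch_op_bump0 (i j : interval R) (E : set R) (phi psi : R -> R) d c a b rho s :
  is_branch j E phi psi -> cmod d = 1 -> density a b rho s ->
  (forall x, a < x < b -> x \in i) ->
  (forall x, x \in j -> ~~ (a < phi x < b)) ->
  branch_op d phi psi (bump i c a b rho) = 0 :> L1 j.
Proof.
move=> B d1 dr abi abj; rewrite /bump (branch_op_class B)//; last first.
  exact: bump_supported dr abi.
have ci := branch_fun_cintegrable B d1 (bump_supported c dr abi).
rewrite -(L1_class0 j); apply: (L1_class_eqin ci _).2 => x xj.
by rewrite /branch_fun /bump_fun (negbTE (abj x xj)) mulr0.
Qed.

Lemma cvg_one_term (V : normedModType R) (u : nat -> V) (l : V) n :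
  (forall m, m != n -> u m = 0) -> (fun N => \sum_(0 <= m < N) u m) @ \oo --> l ->
  l = u n.
Proof.
move=> u0 ul; apply: (cvg_unique _ ul) => //.
apply: cvg_near_cst; exists n.+1 => // N /= nN.
by rewrite (bigD1_seq n) ?mem_index_iota ?iota_uniq//= big1 ?addr0.
Qed.

Variables (q : R) (q1 : 1 < q).
Let q0 : 0 < q. Proof. exact: lt_trans q1. Qed.

Lemma gphi_itv n x : (0 < n)%N -> 0 < x < 1 -> q / n.+1%:R < gphi q n x < q / n%:R.
Proof.
move=> n0 /andP[x0 x1]; rewrite /gphi !ltr_pM2l//.
have n0' : 0 < n%:R :> R by rewrite ltr0n.
rewrite !ltf_pV2 ?posrE ?ltr0n ?addr_gt0//.
by rewrite -natr1 ltrD2l x1 ltrDl x0.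
Qed.

Lemma itv_sub01 a b : 0 <= a -> b <= 1 -> forall x, a < x < b -> x \in `]0, 1[.
Proof.
move=> a0 b1 x /andP[ax xb]; rewrite in_itv/= (le_lt_trans a0 ax).
exact: lt_le_trans b1.
Qed.

Section one_branch.
Variables (w : R[i]) (n : nat) (c : R[i]) (a b s : R) (rho : R -> R).
Hypotheses (w1 : cmod w = 1) (n0 : (0 < n)%N) (dr : density a b rho s).
Hypotheses (b1 : b <= 1) (na : q / n.+1%:R <= a) (bn : b <= q / n%:R).
Local Notation f := (bump `]0, 1[ c a b rho).

Lemma L_branch_bump0 m : m != n.-1 -> L_branch q w m.+1 f = 0.
Proof.
move=> mn; have n0' : 0 < n%:R :> R by rewrite ltr0n.
have a0 : 0 < a by apply: lt_le_trans na; rewrite divr_gt0.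
have sub := itv_sub01 (ltW a0) b1.
apply: (@branch_op_bump0 `]0, 1[ `]0, 1[ _ _ _ _ c a b rho s
  (gphi_branch q1 (ltn0Sn m)) (cmodX_1 _ w1) dr sub).
move=> x; rewrite in_itv/= => /(gphi_itv (ltn0Sn m)) /andP[h1 h2].
apply/negP => /andP[h3 h4].
suff mn' : m.+1 = n by move: mn; rewrite -mn' eqxx.
apply: (@gphi_disjoint R q m.+1 n q0 (ltn0Sn m) n0).
exists (gphi q m.+1 x); split; rewrite /= in_itv/=.
  by rewrite h1 ltW.
by rewrite (le_lt_trans na h3) (ltW (lt_le_trans h4 bn)).
Qed.

Lemma L_op_single : L_op w q f = L_branch q w n f.
Proof.
have ls := @L_op_series R q w q1 w1 f.
rewrite (@cvg_one_term _ (fun m => L_branch q w m.+1 f) _ n.-1 L_branch_bump0 ls).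
by rewrite prednK.
Qed.

Lemma L_op_single_norm : `|L_op w q f| = `|f|.
Proof.
rewrite L_op_single; have ls := @L_norm_series R q w q1 w1 f.
rewrite [RHS](@cvg_one_term R^o (fun m => `|L_branch q w m.+1 f|) _ n.-1 _ ls).
  by rewrite prednK.
by move=> m /L_branch_bump0 ->; rewrite normr0.
Qed.

End one_branch.

Lemma L_op_bump_single w n c a b rho s : cmod w = 1 -> (0 < n)%N ->
  density a b rho s -> b <= 1 -> a < b -> q / n.+1%:R <= a -> b <= q / n%:R ->
  L_op w q (bump `]0, 1[ c a b rho) =
  bump `]0, 1[ (w ^+ n * c) (q / b - n%:R) (q / a - n%:R)
    (fun x => gpsi q n x * rho (gphi q n x)).
Proof.
move=> w1 n0 dr b1 ab na bn; rewrite (L_op_single c w1 n0 dr)//.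
have n0' : 0 < n%:R :> R by rewrite ltr0n.
have a0 : 0 < a by apply: lt_le_trans na; rewrite divr_gt0.
have b0 := lt_trans a0 ab.
apply: (branch_op_bump _ (gphi_branch q1 n0) (cmodX_1 n w1) dr
  (itv_sub01 (ltW a0) b1)) => x.
rewrite in_itv/= => /andP[x0 x1]; rewrite /gphi.
have nx : 0 < n%:R + x by rewrite addr_gt0.
have -> : (q / (n%:R + x) < b) = (q / b - n%:R < x).
  by rewrite ltr_pdivrMr// mulrC -ltr_pdivrMr// ltrBlDl.
by rewrite andbC; congr (_ && _); rewrite ltr_pdivlMr// mulrC -ltr_pdivlMr// ltrBrDl.
Qed.

End single_branch.

(** * Atoms *)
Section atoms.
Context {R : realType}.
Variables (q : R) (q1 : 1 < q) (rl : bool).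
Local Notation mu := (@lebesgue_measure R).
Local Notation X := (L1 (`]0, 1[ : interval R)).
Let q0 : 0 < q. Proof. exact: lt_trans q1. Qed.

Definition loglip (L a b : R) (rho : R -> R) :=
  forall x y, a < x < b -> a < y < b -> rho x <= expR (L * `|x - y|) * rho y.

(** One application of a branch maps the Lipschitz constant L of a logarithmic
    density to 2 + L/q.  [Lam] is chosen so that this is Lam - 2: after one
    step there is a margin of 2, from which a constant can be subtracted. *)
Definition Lam : R := 4 * q / (q - 1).

Let qB0 : 0 < q - 1. Proof. by rewrite subr_gt0. Qed.

Lemma Lam_gt2 : 2 < Lam.
Proof. by rewrite /Lam ltr_pdivlMr//; have := q1; lra. Qed.

Lemma Lam_step : 2 + Lam / q = Lam - 2.
Proof. by rewrite /Lam; field; rewrite !gt_eqF. Qed.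

(** The flag [rl] restricts to real phases; it is used when zeta = eta = 1. *)
Record atom := Atom {
  ac : R[i] ; aa : R ; ab : R ; arho : R -> R ; asup : R ;
  ac1 : cmod ac = 1 ;
  acr : rl -> complex.Im ac = 0 ;
  aa0 : 0 <= aa ;
  aab : aa < ab ;
  ab1 : ab <= 1 ;
  adens : density aa ab arho asup ;
  alip : loglip Lam aa ab arho }.

Definition aval (p : atom) : X := bump `]0, 1[ (ac p) (aa p) (ab p) (arho p).

Lemma aitv p x : aa p < x < ab p -> x \in `]0, 1[.
Proof. exact: itv_sub01 (aa0 p) (ab1 p) x. Qed.

Lemma aval_norm p : `|aval p| = \int[mu]_(x in `]aa p, ab p[) arho p x.
Proof. exact: bump_norm (adens p) (@aitv p) (ac1 p). Qed.

Lemma asup_ge0 p : 0 <= asup p.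
Proof.
have [_ r0 rs] := adens p; have xab := midf_lt (aab p).
by apply: le_trans (r0 _) (rs ((aa p + ab p) / 2) _); rewrite !xab.
Qed.

Lemma Rintegral_itv_cst (a b s : R) : a < b -> \int[mu]_(x in `]a, b[) s = s * (b - a).
Proof.
move=> lt_ab; rewrite Rintegral_cst//; congr (_ * _).
by have /= := @lebesgue_measure_itv R `]a, b[; rewrite lte_fin lt_ab => ->.
Qed.

Lemma integrable_itv_cst (a b s : R) : 0 <= s ->
  mu.-integrable `]a, b[ (EFin \o (fun=> s)).
Proof. by move=> s0; apply: (@integrable_density _ _ _ _ s); split. Qed.

Lemma aval_le p s : 0 <= s -> (forall x, aa p < x < ab p -> arho p x <= s) ->
  `|aval p| <= s * (ab p - aa p).
Proof.
move=> s0 rs; rewrite aval_norm -Rintegral_itv_cst ?aab//.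
apply: le_Rintegral => //.
- exact: integrable_density (adens p).
- exact: integrable_itv_cst.
Qed.

Lemma aval_ge p r : 0 <= r -> (forall x, aa p < x < ab p -> r <= arho p x) ->
  r * (ab p - aa p) <= `|aval p|.
Proof.
move=> r0 rs; rewrite aval_norm -Rintegral_itv_cst ?aab//.
apply: le_Rintegral => //.
- exact: integrable_itv_cst.
- exact: integrable_density (adens p).
Qed.

Lemma itv_dist_le1 p x y : aa p < x < ab p -> aa p < y < ab p -> `|x - y| <= 1.
Proof.
move=> /andP[ax xb] /andP[ay yb]; rewrite ler_norml.
have := aa0 p; have := ab1 p; move: ax xb ay yb; lra.
Qed.

Lemma arho_comparable p x y : aa p < x < ab p -> aa p < y < ab p ->
  arho p x <= expR Lam * arho p y.
Proof.
move=> xp yp; apply: le_trans (alip xp yp) _.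
have [_ r0 _] := adens p; rewrite ler_wpM2r// ler_expR ler_piMr//.
  by apply: ltW; apply: lt_trans Lam_gt2.
exact: itv_dist_le1 xp yp.
Qed.

Lemma arho_le_mass p x : aa p < x < ab p ->
  arho p x * (ab p - aa p) <= expR Lam * `|aval p|.
Proof.
move=> xp; rewrite mulrC -ler_pdivrMl ?expR_gt0// mulrCA mulrC.
have [_ r0 _] := adens p.
apply: aval_ge => [|y yp]; first by rewrite mulr_ge0// invr_ge0 expR_ge0.
rewrite ler_pdivrMl ?expR_gt0//.
exact: arho_comparable.
Qed.

(** The logarithmic derivative of [gpsi] is 2/(n+x) in absolute value. *)
Lemma gpsi_lip n x y : 1 <= n%:R + x -> 0 < n%:R + y ->
  gpsi q n x <= expR (2 * `|x - y|) * gpsi q n y.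
Proof.
move=> nx ny0; have nx0 := lt_le_trans ltr01 nx.
rewrite /gpsi mulrCA ler_pM2l// -[_ ^- 2]mul1r ler_pdivrMr ?exprn_gt0//.
rewrite mulrAC ler_pdivlMr ?exprn_gt0// mul1r mulr2n mulrDl mul1r expRD -expr2 -exprMn.
rewrite ler_pXn2r ?nnegrE ?mulr_ge0 ?expR_ge0 ?(ltW nx0) ?(ltW ny0)//.
apply: (@le_trans _ _ ((1 + `|x - y|) * (n%:R + x))); last first.
  by rewrite ler_pM2r// expR_ge1Dx.
have : y - x <= `|x - y| by rewrite distrC ler_norm.
move: nx; have := normr_ge0 (x - y); set t := `|_|; nra.
Qed.

(** The n-th branch sends an atom on (a, b) to an atom on the part of
    (q/b - n, q/a - n) inside (0, 1), or to zero.  When a = 0, the right end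
    q/a is infinite, whereas division by zero would give 0: hence the case
    distinction on [aa p]. *)
Lemma child w n p : cmod w = 1 -> (rl -> w = 1) -> (0 < n)%N ->
  let a' := Num.max 0 (q / ab p - n%:R) in
  let b' := if aa p == 0 then 1 else Num.min 1 (q / aa p - n%:R) in
  (b' <= a' /\ L_branch q w n (aval p) = 0) \/
  exists p', [/\ aval p' = L_branch q w n (aval p),
    [/\ ac p' = w ^+ n * ac p, aa p' = a' & ab p' = b'],
    asup p' = asup p / q,
    arho p' = (fun x => gpsi q n x * arho p (gphi q n x)) &
    loglip (Lam - 2) (aa p') (ab p') (arho p')].
Proof.
move=> w1 wr n0 a' b'.
have n0' : 0 < n%:R :> R by rewrite ltr0n.
have b0 : 0 < ab p by exact: le_lt_trans (aa0 p) (aab p).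
have iff x : 0 < x < 1 -> (aa p < gphi q n x < ab p) = (a' < x < b').
  move=> /andP[x0 x1]; rewrite /gphi /a' /b' gt_max x0/=.
  have nx : 0 < n%:R + x by rewrite addr_gt0.
  have -> : (q / (n%:R + x) < ab p) = (q / ab p - n%:R < x).
    by rewrite ltr_pdivrMr// mulrC -ltr_pdivrMr// ltrBlDl.
  rewrite andbC; congr (_ && _).
  have [->|a0] := eqVneq (aa p) 0; first by rewrite x1 divr_gt0.
  have a0' : 0 < aa p by rewrite lt_neqAle eq_sym a0 aa0.
  by rewrite lt_min x1/= ltr_pdivlMr// mulrC -ltr_pdivlMr// ltrBrDl.
have brE : L_branch q w n (aval p) = bump `]0, 1[ (w ^+ n * ac p) a' b'
    (fun x => gpsi q n x * arho p (gphi q n x)).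
  apply: (branch_op_bump _ (gphi_branch q1 n0) (cmodX_1 n w1) (adens p) (@aitv p)) => x.
  by rewrite in_itv/=; exact: iff.
have [ab'|ba'] := ltP a' b'; last first.
  left; split=> //; apply: (branch_op_bump0 _ (gphi_branch q1 n0) (cmodX_1 n w1) (adens p) (@aitv p)).
  move=> x; rewrite in_itv/= => x01; rewrite iff//; apply/negP => /andP[h1 h2].
  by have := lt_trans h1 h2; rewrite ltNge ba'.
right.
have a'0 : 0 <= a' by rewrite le_max lexx.
have b'1 : b' <= 1 by rewrite /b'; case: ifP => // _; rewrite ge_min lexx.
have x01 x : a' < x < b' -> 0 < x < 1.
  by move=> /andP[h1 h2]; rewrite (le_lt_trans a'0 h1) (lt_le_trans h2).
have nxq x : a' < x < b' -> q < n%:R + x.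
  move=> xab; have h := x01 _ xab; have /andP[h0 _] := h.
  move: xab; rewrite -iff// => /andP[_ +].
  have nx : 0 < n%:R + x by rewrite addr_gt0.
  rewrite /gphi ltr_pdivrMr// => h2; apply: lt_le_trans h2 _.
  by rewrite ler_piMl ?ab1// ltW.
have [mr r0 rs] := adens p.
have dens' : density a' b' (fun x => gpsi q n x * arho p (gphi q n x)) (asup p / q).
  split.
  - apply: measurable_funM; first exact: branch_psi (gphi_branch q1 n0).
    by apply: (measurableT_comp mr); exact: branch_phi (gphi_branch q1 n0).
  - by move=> x; rewrite mulr_ge0// (branch_ge0 (gphi_branch q1 n0)).
  move=> x xab; have nx := nxq _ xab; rewrite [leRHS]mulrC.
  apply: ler_pM => //.
  - exact: (branch_ge0 (gphi_branch q1 n0)).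
  - have nx0 := lt_trans q0 nx.
    rewrite /gpsi ler_pdivrMr ?exprn_gt0// ler_pdivlMl// -expr2.
    by rewrite ler_pXn2r ?nnegrE ?ltW.
  - by apply: rs; rewrite iff// x01.
have lip' : loglip (Lam - 2) a' b' (fun x => gpsi q n x * arho p (gphi q n x)).
  move=> x y xab yab; have nx := nxq _ xab; have ny := nxq _ yab.
  have nx0 := lt_trans q0 nx; have ny0 := lt_trans q0 ny.
  have h1 : gpsi q n x <= expR (2 * `|x - y|) * gpsi q n y.
    by apply: gpsi_lip => //; exact: ltW (lt_trans q1 nx).
  have h2 : arho p (gphi q n x) <= expR (Lam / q * `|x - y|) * arho p (gphi q n y).
    have h3 : arho p (gphi q n x) <=
        expR (Lam * `|gphi q n x - gphi q n y|) * arho p (gphi q n y).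
      by apply: alip; rewrite iff// x01.
    apply: le_trans h3 _; rewrite ler_wpM2r// ler_expR -mulrA ler_wpM2l//.
      by apply: ltW; apply: lt_trans Lam_gt2.
    have -> : gphi q n x - gphi q n y = q * (y - x) / ((n%:R + x) * (n%:R + y)).
      by rewrite /gphi; field; rewrite !gt_eqF.
    rewrite !normrM distrC (gtr0_norm q0) gtr0_norm ?invr_gt0 ?mulr_gt0//.
    rewrite mulrAC [leLHS]mulrC [leRHS]mulrC ler_wpM2l//.
    rewrite ler_pdivrMr ?mulr_gt0// ler_pdivlMl//.
    by apply: ler_pM; rewrite ?ltW.
  rewrite -Lam_step mulrDl expRD mulrACA.
  apply: ler_pM => //; exact: (branch_ge0 (gphi_branch q1 n0)).
have c1' : cmod (w ^+ n * ac p) = 1 by rewrite RcnormM (cmodX_1 n w1) ac1 mulr1.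
have cr' : rl -> complex.Im (w ^+ n * ac p) = 0.
  by move=> r; rewrite (wr r) expr1n mul1r acr.
have lipL : loglip Lam a' b' (fun x => gpsi q n x * arho p (gphi q n x)).
  move=> x y xab yab; apply: le_trans (lip' _ _ xab yab) _.
  rewrite ler_wpM2r ?(density_ge0 dens')// ler_expR ler_wpM2r//; lra.
by exists (Atom c1' cr' a'0 ab' b'1 dens' lipL).
Qed.

End atoms.

(** * A Lasota-Yorke inequality for the cost of atoms *)
Section growth.
Context {R : realType}.
Variables (q : R) (q1 : 1 < q) (rl : bool).
Local Notation X := (L1 (`]0, 1[ : interval R)).
Local Notation atom := (atom q rl).
Let q0 : 0 < q. Proof. exact: lt_trans q1. Qed.
Let qV0 : 0 < q^-1. Proof. by rewrite invr_gt0. Qed.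

Definition admissible (w : R[i]) := cmod w = 1 /\ (rl -> w = 1).

Lemma L_op_badditive w : cmod w = 1 -> bounded_additive 1 (L_op w q).
Proof.
by move=> w1; split => [f g|f]; rewrite ?mul1r; [exact: L_opD|exact: L_op_norm].
Qed.

Definition gauss (x : R) : R := q / x - (Num.truncn (q / x))%:R.

(** The points that can be ends of the images of an atom without coming from
    its own ends: the iterates of 0 and 1 under the Gauss map. *)
Fixpoint ends k : seq R :=
  if k is k'.+1 then ends k' ++ map gauss (ends k') else [:: 0; 1].

(** An end of an interval is fresh after k steps if it is not in [ends k], so
    that it descends from an end of the interval one started with. *)
Definition fresh k x : R := (x \notin ends k)%:R.

Lemma fresh_ge0 k x : 0 <= fresh k x. Proof. exact: ler0n. Qed.

Lemma fresh_le1 k x : fresh k x <= 1. Proof. by rewrite /fresh lern1 leq_b1. Qed.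

Lemma ends01 k : 0 \in ends k /\ 1 \in ends k.
Proof.
elim: k => [|k [e0 e1]]; first by rewrite !inE !eqxx orbT.
by rewrite /= !mem_cat e0 e1.
Qed.

Lemma fresh_gauss k x : fresh k.+1 (gauss x) <= fresh k x.
Proof.
rewrite /fresh /= mem_cat negb_or; have [xk|_] := boolP (x \in ends k).
  by rewrite (map_f gauss xk) andbF.
by rewrite lern1 leq_b1.
Qed.

Lemma fresh01 k : fresh k 0 = 0 /\ fresh k 1 = 0.
Proof. by rewrite /fresh; have [-> ->] := ends01 k. Qed.

Definition cost (alpha beta : R) (p : atom) := alpha * `|aval p| + beta * asup p.

(** The bound of the density, divided by q at each step, is only charged to
    the fresh ends.  An atom without fresh ends is long, because its ends are
    in a finite set, and the bound of its density is controlled by its mass: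
    this is the role of C. *)
Definition cost_ends (alpha beta C : R) j k (p : atom) :=
  (alpha + beta * C) * `|aval p| +
  beta * (q ^- k * asup p * (fresh j (aa p) + fresh j (ab p))).

(** Masses add up over the branches.  Among all the children of an atom on
    (a, b), at most one has its left end coming from b, and at most one its
    right end coming from a; the other ends are 0 or 1. *)
Lemma cost_ends_step alpha beta C j k w p :
  0 <= alpha -> 0 <= beta -> 0 <= C -> admissible w ->
  hull (@aval R q rl) (cost_ends alpha beta C j.+1 k) (cost_ends alpha beta C j k.+1 p)
    (L_op w q (aval p)).
Proof.
move=> al0 be0 C0 [w1 wr]; have ls := @L_op_series R q w q1 w1 (aval p).
apply: (hull_lim ls) => N.
pose r n := (alpha + beta * C) * `|L_branch q w n.+1 (aval p)| +
  beta * (q ^- k.+1 * asup p *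
  ((n.+1 == Num.truncn (q / ab p))%:R * fresh j (ab p) +
   (n.+1 == Num.truncn (q / aa p))%:R * fresh j (aa p))).
have s0 := asup_ge0 p.
have qk0 : 0 <= q ^- k.+1 * asup p by rewrite mulr_ge0// invr_ge0 exprn_ge0// ltW.
have aC0 : 0 <= alpha + beta * C by rewrite addr_ge0 ?mulr_ge0.
apply: hull_le (hull_sum (r := r) _ _); last first.
  move=> n; have := child q1 p w1 wr (ltn0Sn n).
  set a' := Num.max _ _; set b' := if _ then _ else _.
  case=> [[_ L0]|].
    rewrite L0; apply: hull0; rewrite /r L0 normr0 mulr0 add0r mulr_ge0// mulr_ge0//.
    by rewrite addr_ge0// mulr_ge0 ?ler0n// fresh_ge0.
  move=> [p' [pE [cE aE bE] sE _ _]]; rewrite -pE.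
  apply: hull_val_le; rewrite /cost_ends /r pE lerD2l ler_wpM2l//.
  rewrite sE exprS invfM [q^-1 * _]mulrC -!mulrA ler_wpM2l//.
    by rewrite invr_ge0 exprn_ge0// ltW.
  rewrite mulrCA ler_wpM2l ?(ltW qV0)// ler_wpM2l//.
  have ab' : a' < b' by rewrite -aE -bE; exact: aab.
  have b'1 : b' <= 1 by rewrite -bE; exact: ab1.
  have a'0 : 0 <= a' by rewrite -aE; exact: aa0.
  have b0 : 0 < ab p by exact: le_lt_trans (aa0 p) (aab p).
  rewrite aE bE; apply: lerD.
    have [h|h] := leP (q / ab p - n.+1%:R) 0.
      have -> : a' = 0 by apply/eqP; rewrite /a' eq_le ge_max h lexx le_max lexx.
      by rewrite (fresh01 _).1 mulr_ge0 ?ler0n ?fresh_ge0.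
    have a'E : a' = q / ab p - n.+1%:R by rewrite /a'; apply/max_idPr/ltW.
    have tE : Num.truncn (q / ab p) = n.+1.
      apply: truncn_def; rewrite -[n.+2%:R]natr1 -subr_ge0 (ltW h)/=.
      by rewrite -ltrBlDl -a'E (lt_le_trans ab').
    rewrite tE eqxx mul1r a'E; have := fresh_gauss j (ab p).
    by rewrite /gauss tE.
  rewrite /b'; have [az|a0] := eqVneq (aa p) 0.
    by rewrite (fresh01 _).2 mulr_ge0 ?ler0n ?fresh_ge0.
  have [h|h] := leP 1 (q / aa p - n.+1%:R).
    by rewrite (fresh01 _).2 mulr_ge0 ?ler0n ?fresh_ge0.
  have b'E : b' = q / aa p - n.+1%:R by rewrite /b' (negbTE a0); apply/min_idPr/ltW.
  have tE : Num.truncn (q / aa p) = n.+1.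
    apply: truncn_def; rewrite -[n.+2%:R]natr1 -ltrBlDl h andbT.
    by rewrite -subr_ge0 -b'E ltW// (le_lt_trans a'0).
  by rewrite tE eqxx mul1r; have := fresh_gauss j (aa p); rewrite /gauss tE.
rewrite /r big_split/= -mulr_sumr /cost_ends lerD//.
  by rewrite ler_wpM2l// (L_norm_partial q1 w1).
rewrite -mulr_sumr ler_wpM2l// -mulr_sumr ler_wpM2l// big_split/= addrC.
have pick (m : nat) (x : R) : 0 <= x -> \sum_(0 <= n < N) (n.+1 == m)%:R * x <= x.
  move=> x0; rewrite -mulr_suml -[leRHS]mul1r ler_wpM2r// big_mkord.
  have [/existsP[i /eqP iE]|/existsPn ni] := boolP [exists i : 'I_N, i.+1 == m].
    rewrite (bigD1 i)//= iE eqxx big1 ?addr0// => l li.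
    have -> : (l.+1 == m) = false by rewrite -iE; exact: negbTE li.
    by [].
  by rewrite big1// => i _; rewrite (negbTE (ni i)).
by apply: lerD; apply: pick; exact: fresh_ge0.
Qed.

Fixpoint L_word (ws : seq R[i]) (f : X) : X :=
  if ws is w :: ws' then L_word ws' (L_op w q f) else f.

Lemma L_word_badditive ws : (forall w, w \in ws -> admissible w) ->
  bounded_additive 1 (L_word ws).
Proof.
elim: ws => [|w ws IH] wsP /=; first by split => // f; rewrite mul1r.
have wP : admissible w by apply: wsP; rewrite inE eqxx.
rewrite -[X in bounded_additive X]mulr1.
apply: (bounded_additive_comp ler01 (L_op_badditive wP.1)).
by apply: IH => v vs; apply: wsP; rewrite inE vs orbT.
Qed.

Lemma cost_ends_word alpha beta C ws j k p :
  0 <= alpha -> 0 <= beta -> 0 <= C -> (forall w, w \in ws -> admissible w) ->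
  hull (@aval R q rl) (cost_ends alpha beta C (j + size ws) k)
    (cost_ends alpha beta C j (k + size ws) p) (L_word ws (aval p)).
Proof.
move=> al0 be0 C0; elim: ws j p => [|w ws IH] j p wsP /=.
  by rewrite !addn0; exact: hull_val.
have wP : admissible w by apply: wsP; rewrite inE eqxx.
have {}wsP v : v \in ws -> admissible v by move=> vs; apply: wsP; rewrite inE vs orbT.
rewrite !addnS -addSn.
apply: (hull_map (L_word_badditive wsP)); last exact: cost_ends_step.
by move=> p'; exact: IH.
Qed.

Lemma seq_gap (s : seq R) : exists2 d, 0 < d & forall x, x \in s -> 0 < x -> d <= x.
Proof.
elim: s => [|y s [d d0 ds]]; first by exists 1.
have [y0|y0] := ltP 0 y; last first.
  by exists d => // x; rewrite inE => /predU1P[->|/ds//]; rewrite ltNge y0.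
exists (Num.min y d); first by rewrite lt_min y0.
move=> x; rewrite inE => /predU1P[->|/ds xs /xs dx]; rewrite ge_min ?lexx//.
by rewrite dx orbT.
Qed.

(** After K steps, the atoms both of whose ends are in [ends K] have length at
    least the smallest distance d between two points of this set, so that their
    densities are at most exp Lam / d times their masses; the others have a
    fresh end, which pays for the bound of their density. *)
Lemma growth K : exists2 C, 0 <= C & forall alpha beta ws p,
  0 <= alpha -> 0 <= beta -> (forall w, w \in ws -> admissible w) -> size ws = K ->
  hull (@aval R q rl) (cost alpha beta)
    (cost (alpha + beta * C) (beta * (2 * q ^- K)) p) (L_word ws (aval p)).
Proof.
have [d d0 dP] := seq_gap [seq y - x | x <- ends K, y <- ends K].
have C0 : 0 <= expR (Lam q) / d by rewrite divr_ge0 ?expR_ge0 ?ltW.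
exists (expR (Lam q) / d) => // alpha beta ws p al0 be0 wsP wsK.
have := @cost_ends_word alpha beta _ ws 0 0 p al0 be0 C0 wsP.
rewrite !add0n wsK => h.
apply: (@hull_le _ _ _ _ _ (cost_ends alpha beta (expR (Lam q) / d) 0 K p)).
  rewrite /cost_ends /cost lerD2l -[leRHS]mulrA ler_wpM2l// mulrAC ler_wpM2r ?asup_ge0//.
  by rewrite mulrC ler_wpM2r ?invr_ge0 ?exprn_ge0 ?(ltW q0)// lerD ?fresh_le1.
apply: hull_cost h => {}p.
have [aK|aK] := boolP ((aa p \in ends K) && (ab p \in ends K)); last first.
  apply: hull_val_le; rewrite /cost /cost_ends expr0 invr1 mul1r.
  rewrite lerD//; first by rewrite ler_wpM2r// lerDl mulr_ge0.
  rewrite ler_wpM2l// ler_peMr ?asup_ge0// /fresh -natrD ler1n.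
  by move: aK; rewrite negb_and; case: (_ \in _) => /=; case: (_ \in _).
have [aE bE] := andP aK; have dab : d <= ab p - aa p.
  by apply: dP; [apply/allpairsP; exists (aa p, ab p)|rewrite subr_gt0 aab].
have [mr r0 rs] := adens p.
have dens : density (aa p) (ab p) (arho p) (expR (Lam q) / d * `|aval p|).
  split => // x xab; rewrite mulrAC ler_pdivlMr//.
  by apply: le_trans (arho_le_mass q1 xab); rewrite ler_wpM2l.
pose p' := @Atom R q rl (ac p) (aa p) (ab p) (arho p) _ (ac1 p) (@acr _ _ _ p)
  (aa0 p) (aab p) (ab1 p) dens (@alip _ _ _ p).
have -> : aval p = aval p' by [].
apply: hull_val_le; rewrite /cost /cost_ends /= /fresh aE bE/= addr0 !mulr0 addr0.
by rewrite mulrDl mulrA.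
Qed.

(** The errors form a geometric series with ratio theta <= 1/2. *)
Lemma growth_iter K (C : R) (S : X -> X) (theta : R) :
  0 <= C -> 0 <= theta -> theta <= 2^-1 -> bounded_additive K S ->
  (forall alpha beta p, 0 <= alpha -> 0 <= beta -> hull (@aval R q rl) (cost alpha beta)
    (cost (alpha + beta * C) (beta * theta) p) (S (aval p))) ->
  forall j alpha beta p, 0 <= alpha -> 0 <= beta -> hull (@aval R q rl) (cost alpha beta)
    (cost (alpha + beta * (2 * C)) (beta * theta ^+ j) p) (iter j S (aval p)).
Proof.
move=> C0 th0 th2 bS Sp j alpha beta p al0 be0.
suff h : hull (@aval R q rl) (cost alpha beta)
    (cost (alpha + beta * (2 * (1 - theta ^+ j) * C)) (beta * theta ^+ j) p)
    (iter j S (aval p)).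
  apply: hull_le h; rewrite lerD2r ler_wpM2r// lerD2l ler_wpM2l// ler_wpM2r//.
  have : 0 <= theta ^+ j by exact: exprn_ge0.
  lra.
elim: j alpha beta p al0 be0 => [|j IH] alpha beta p al0 be0.
  rewrite expr0 subrr mulr0 mul0r mulr0 addr0 mulr1; exact: hull_val.
have t0 : 0 <= theta ^+ j by exact: exprn_ge0.
have bC0 : 0 <= beta * C by rewrite mulr_ge0.
have bt0 : 0 <= beta * theta by rewrite mulr_ge0.
rewrite iterS; have := IH _ _ p (addr_ge0 al0 bC0) bt0.
move=> /(hull_map bS (fun p' => Sp _ _ p' al0 be0)).
apply: hull_le; rewrite /cost exprS [beta * (theta * _)]mulrA lerD2r ler_wpM2r// -addrA lerD2l.
rewrite -mulrA -mulrDr ler_wpM2l// mulrA -[X in X + _]mul1r -mulrDl ler_wpM2r//.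
move: th2; rewrite mulrBr mulrBr mulr1; lra.
Qed.

End growth.

(** * Cylinders *)
Section cylinders.
Context {R : realType}.
Variables (q : R) (q1 : 1 < q).
Let q0 : 0 < q. Proof. exact: lt_trans q1. Qed.

(** The interval (u, v) is sent onto (x, y) by the branches with the digits ns,
    and the condition q <= n + u says that it stays below 1. *)
Inductive cylinder (x y : R) : seq nat -> R -> R -> Prop :=
| cylinder_nil : cylinder x y [::] x y
| cylinder_cons n ns u v : cylinder x y ns u v -> (0 < n)%N -> q <= n%:R + u ->
    cylinder x y (n :: ns) (q / (n%:R + v)) (q / (n%:R + u)).

Lemma cylinder_bounds x y ns u v : 0 <= x -> x < y -> y <= 1 ->
  cylinder x y ns u v -> [/\ 0 <= u, u < v & v <= 1].
Proof.
move=> x0 xy y1; elim=> // n {}ns {}u {}v _ [u0 uv v1] n0 qn.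
have nu : 0 < n%:R + u by exact: lt_le_trans qn.
have nv : 0 < n%:R + v by rewrite (lt_trans nu)// ltrD2l.
split; first by rewrite divr_ge0 ?ltW.
  by rewrite ltr_pM2l// ltf_pV2 ?posrE// ltrD2l.
by rewrite ler_pdivrMr// mul1r.
Qed.

Lemma cylinder_cat x y ns u v ms u' v' :
  cylinder x y ns u v -> cylinder u v ms u' v' -> cylinder x y (ms ++ ns) u' v'.
Proof. by move=> h; elim=> //= n ms' u2 v2 _ h2 n0 qn; exact: cylinder_cons. Qed.

(** The composition of the branches is a monotone bijection of (u, v) onto
    (x, y). *)
Lemma cylinder_sub2 x y ns u v x1 y1 x2 y2 : 0 <= x -> y <= 1 ->
  x <= x1 -> x1 < y1 -> y1 <= y -> x <= x2 -> x2 < y2 -> y2 <= y ->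
  cylinder x y ns u v -> exists u1 v1 u2 v2,
    [/\ cylinder x1 y1 ns u1 v1, cylinder x2 y2 ns u2 v2,
        [/\ u <= u1, v1 <= v, u <= u2 & v2 <= v] &
        (y1 <= x2 \/ y2 <= x1 -> v1 <= u2 \/ v2 <= u1)].
Proof.
move=> x0 yl1 xx1 xy1 y1y xx2 xy2 y2y; have xy := lt_le_trans (le_lt_trans xx1 xy1) y1y.
elim=> [|n {}ns {}u {}v cyl [u1 [v1 [u2 [v2 [c1 c2 [uu1 v1v uu2 v2v] dis]]]]] n0 qn].
  by exists x1, y1, x2, y2; split => //; exact: cylinder_nil.
have [u0 uv vl1] := cylinder_bounds x0 xy yl1 cyl.
have [_ uv1 _] := cylinder_bounds (le_trans x0 xx1) xy1 (le_trans y1y yl1) c1.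
have [_ uv2 _] := cylinder_bounds (le_trans x0 xx2) xy2 (le_trans y2y yl1) c2.
have pos z : u <= z -> 0 < n%:R + z.
  by move=> uz; apply: lt_le_trans q0 (le_trans qn _); rewrite lerD2l.
have inv z z' : u <= z -> z <= z' -> q / (n%:R + z') <= q / (n%:R + z).
  move=> uz zz; rewrite ler_pM2l// lef_pV2 ?posrE ?pos ?(le_trans uz)//.
  by rewrite lerD2l.
have qn' z : u <= z -> q <= n%:R + z by move=> uz; apply: le_trans qn _; rewrite lerD2l.
exists (q / (n%:R + v1)), (q / (n%:R + u1)), (q / (n%:R + v2)), (q / (n%:R + u2)).
split.
- exact: cylinder_cons c1 n0 (qn' _ uu1).
- exact: cylinder_cons c2 n0 (qn' _ uu2).
- by split; apply: inv => //; [exact: ltW (le_lt_trans uu1 _)|exact: ltW (le_lt_trans uu2 _)].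
move=> /dis[h|h]; [right|left]; apply: inv => //.
  exact: ltW (le_lt_trans uu1 _).
exact: ltW (le_lt_trans uu2 _).
Qed.

Lemma cylinder_full ns : (forall n, n \in ns -> q <= n%:R) ->
  exists u v, cylinder 0 1 ns u v.
Proof.
elim: ns => [|n ns IH] nsP; first by exists 0, 1; exact: cylinder_nil.
have [|u [v c]] := IH; first by move=> m mn; apply: nsP; rewrite inE mn orbT.
have qn : q <= n%:R by apply: nsP; rewrite inE eqxx.
have n0 : (0 < n)%N by rewrite -(ltr0n R) (lt_le_trans q0).
exists (q / (n%:R + v)), (q / (n%:R + u)); apply: cylinder_cons => //.
have [//|//|//|u0 _ _] := cylinder_bounds _ _ _ c.
by rewrite (le_trans qn)// lerDl.
Qed.

Lemma expr_small (z e : R) : 0 <= z -> z < 1 -> 0 < e ->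
  exists N, forall n, (N <= n)%N -> z ^+ n <= e.
Proof.
move=> z0 z1 e0; have z1' : `|z| < 1 by rewrite ger0_norm.
have /cvgrPdist_le/(_ _ e0)[N _ NP] := cvg_expr z1'.
exists N => n /NP /=; rewrite sub0r normrN; apply: le_trans; exact: ler_norm.
Qed.

(** If a branch point q/n is inside (a, b), the points to its left are sent to
    the right of 0, where there are complete branches of large digit. *)
Lemma cylinder_at_cut a b : 0 <= a -> a < b -> b <= 1 ->
  a < q / (Num.truncn (q / b)).+1%:R ->
  exists ns u v, [/\ cylinder 0 1 ns u v, a <= u & v <= b].
Proof.
move=> a0 ab b1; set n := (_).+1 => an.
have b0 : 0 < b by exact: le_lt_trans ab.
have n0 : 0 < n%:R :> R by rewrite ltr0n.
have qb : q / b < n%:R by exact: truncnS_gt.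
have qn : q <= n%:R.
  by apply: le_trans (ltW qb); rewrite ler_pdivlMr// ler_piMr// ltW.
have [w [w0 w1 wa]] : exists w, [/\ 0 < w, w <= 1 & a * (n%:R + w) <= q].
  have [->|az] := eqVneq a 0; first by exists 1; rewrite mul0r ltr01 lexx (ltW q0).
  have a0' : 0 < a by rewrite lt_neqAle eq_sym az.
  exists (Num.min 1 (q / a - n%:R)); split.
  - by rewrite lt_min ltr01 subr_gt0 ltr_pdivlMr// mulrC -ltr_pdivlMr.
  - by rewrite ge_min lexx.
  rewrite mulrC -ler_pdivlMr// -lerBrDl ge_min lexx orbT//.
pose m := (Num.truncn (q / w)).+1.
have m0 : 0 < m%:R :> R by rewrite ltr0n.
have mw : q / m%:R <= w.
  by rewrite ler_pdivrMr// mulrC -ler_pdivrMr// ltW// truncnS_gt.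
have qm : q <= m%:R by move: (le_trans mw w1); rewrite ler_pdivrMr// mul1r.
exists [:: n; m], (q / (n%:R + q / (m%:R + 0))), (q / (n%:R + q / (m%:R + 1))); split.
- apply: cylinder_cons => //.
    by apply: cylinder_cons => //; [exact: cylinder_nil|rewrite addr0].
  by rewrite (le_trans qn)// lerDl divr_ge0 ?addr_ge0 ?ltW.
- rewrite addr0 ler_pdivlMr ?addr_gt0 ?divr_gt0//; apply: le_trans wa.
  by rewrite ler_wpM2l// lerD2l.
- rewrite ler_pdivrMr ?addr_gt0 ?divr_gt0 ?addr_gt0//.
  rewrite mulrC -ler_pdivrMr// (le_trans (ltW qb))// lerDl divr_ge0 ?addr_ge0 ?ltW//.
Qed.

(** An interval without branch points is expanded by a factor at least q by the
    Gauss map, which can happen only finitely many times within (0, 1). *)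
Lemma cylinder_in a b : 0 <= a -> a < b -> b <= 1 ->
  exists ns u v, [/\ cylinder 0 1 ns u v, a <= u & v <= b].
Proof.
move=> a0 ab b1.
have [j] : exists j, q^-1 ^+ j <= b - a.
  have qV1 : q^-1 < 1 by rewrite invf_lt1.
  have qV0 : 0 <= q^-1 by rewrite invr_ge0 ltW.
  have ba : 0 < b - a by rewrite subr_gt0.
  by have [N NP] := expr_small qV0 qV1 ba; exists N; exact: NP.
elim: j a b a0 ab b1 => [|j IH] a b a0 ab b1 jab;
  have [an|na] := ltP a (q / (Num.truncn (q / b)).+1%:R);
  try exact: cylinder_at_cut.
  have a0' : 0 < a by apply: lt_le_trans na; rewrite divr_gt0.
  by move: jab; rewrite expr0; lra.
have a0' : 0 < a by apply: lt_le_trans na; rewrite divr_gt0.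
have b0 := lt_trans a0' ab.
set n := Num.truncn (q / b) in na.
have /andP[nb bn] : n%:R <= q / b < n.+1%:R by apply: truncn_itv; rewrite divr_ge0 ?ltW.
have qb : q <= q / b by rewrite ler_pdivlMr// ler_piMr// ltW.
have n0 : (0 < n)%N.
  by rewrite truncn_gt0; apply: le_trans qb; exact: ltW.
have n0' : 0 < n%:R :> R by rewrite ltr0n.
have na' : q / a <= n.+1%:R by rewrite ler_pdivrMr// mulrC -ler_pdivrMr ?ltr0n.
have [||||ns [u [v [c au vb]]]] := IH (q / b - n%:R) (q / a - n%:R).
- by rewrite subr_ge0.
- by rewrite ltrD2r ltr_pM2l// ltf_pV2.
- by rewrite lerBlDl natr1.
- have -> : q / a - n%:R - (q / b - n%:R) = q * ((b - a) / (a * b)).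
    by field; rewrite !gt_eqF.
  rewrite -ler_pdivrMl// -exprS (le_trans jab)// ler_pdivlMr ?mulr_gt0//.
  rewrite ler_piMr ?subr_ge0 ?(ltW ab)// -[leRHS]mulr1.
  by apply: ler_pM => //; rewrite ?(ltW a0') ?(ltW b0) ?(ltW (lt_le_trans ab b1)).
have u0 : 0 <= u by apply: le_trans au; rewrite subr_ge0.
have [_ /ltW uv _] := cylinder_bounds (lexx 0) ltr01 (lexx 1) c.
have v0 : 0 <= v by exact: le_trans uv.
exists (n :: ns), (q / (n%:R + v)), (q / (n%:R + u)); split.
- apply: cylinder_cons => //; apply: le_trans qb _; by rewrite -lerBlDl.
- by rewrite ler_pdivlMr ?ltr_wpDr// mulrC -ler_pdivlMr// -lerBrDl.
- by rewrite ler_pdivrMr ?ltr_wpDr// mulrC -ler_pdivrMr// -lerBlDl.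
Qed.

(** The product of the powers w^n; the iterate of the weighted operators along
    a cylinder multiplies a function by this phase. *)
Fixpoint phase (ws : seq R[i]) (ns : seq nat) : R[i] :=
  match ws, ns with w :: ws', n :: ns' => w ^+ n * phase ws' ns' | _, _ => 1 end.

Lemma cmod_phase ws ns : (forall w : R[i], w \in ws -> cmod w = 1) -> cmod (phase ws ns) = 1.
Proof.
elim: ws ns => [|w ws IH] [|n ns] //= wsP; rewrite ?cmod1//.
rewrite RcnormM cmodX_1 ?mul1r ?IH// => [v vs|]; apply: wsP; rewrite inE ?eqxx//.
by rewrite vs orbT.
Qed.

Lemma phase_1 ws ns : (forall w : R[i], w \in ws -> w = 1) -> phase ws ns = 1.
Proof.
elim: ws ns => [|w ws IH] [|n ns] //= wsP.
rewrite (wsP w) ?inE ?eqxx// expr1n mul1r IH// => v vs; apply: wsP.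
by rewrite inE vs orbT.
Qed.

(** Changing a single digit by one multiplies the phase by the weight at that
    position; this is the only source of cancellation. *)
Lemma phase_succ ws ns n t :
  phase ws (ns ++ n.+1 :: t) = nth 1 ws (size ns) * phase ws (ns ++ n :: t).
Proof.
elim: ws ns => [|w ws IH] [|m ns] /=; rewrite ?mulr1// ?exprS ?mulrA//.
by rewrite IH mulrCA mulrA.
Qed.

Definition derivative_bound (ns : seq nat) : R := \prod_(n <- ns) (q / (n%:R + 1) ^+ 2).

Lemma derivative_bound_gt0 ns : 0 < derivative_bound ns.
Proof.
by apply: prodr_gt0 => n _; rewrite divr_gt0// exprn_gt0// ltr_wpDl.
Qed.

Variable rl : bool.
Local Notation atom := (atom q rl).
Local Notation admissible := (@admissible R rl).

(** The branches met along a cylinder are full on it, so that the image is a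
    single atom on (0, 1); its density is bounded below by that of p, times the
    derivative of the branches. *)
Lemma atom_word ns u v ws (p : atom) : cylinder 0 1 ns u v -> aa p = u -> ab p = v ->
  size ws = size ns -> (forall w, w \in ws -> admissible w) ->
  ns <> [::] \/ loglip (Lam q - 2) (aa p) (ab p) (arho p) ->
  exists p' : atom, [/\ aval p' = L_word q ws (aval p), ac p' = phase ws ns * ac p,
    [/\ aa p' = 0, ab p' = 1 & asup p' = asup p * q ^- size ns],
    (forall r, 0 <= r -> (forall x, aa p < x < ab p -> r <= arho p x) ->
       forall x, 0 < x < 1 -> derivative_bound ns * r <= arho p' x) &
    loglip (Lam q - 2) 0 1 (arho p')].
Proof.
move=> c; elim: c ws p => [|n {}ns {}u {}v c IH n0 qn] [|w ws]// p pa pb szE wsP lipP.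
  case: lipP => // lip; exists p; split => //; first by rewrite mul1r.
  - by rewrite expr0 invr1 mulr1.
  - move=> r r0 rP x x01; rewrite /derivative_bound big_nil mul1r; apply: rP.
    by rewrite pa pb.
  - by rewrite -[X in loglip _ X]pa -[X in loglip _ _ X]pb.
have [w1 wr] : admissible w by apply: wsP; rewrite inE eqxx.
have [u0 uv v1] := cylinder_bounds (lexx 0) ltr01 (lexx 1) c.
have n0' : 0 < n%:R :> R by rewrite ltr0n.
have pos z : u <= z -> 0 < n%:R + z.
  by move=> uz; rewrite ltr_wpDr// (le_trans u0).
have LE : L_op w q (aval p) = L_branch q w n (aval p).
  apply: (L_op_single q1 (ac p) w1 n0 (adens p) (ab1 p)).
    by rewrite pa ler_pM2l// lef_pV2 ?posrE ?pos ?(ltW uv)// -natr1 lerD2l.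
  by rewrite pb ler_pM2l// lef_pV2 ?posrE ?pos// lerDl.
have a'E : Num.max 0 (q / ab p - n%:R) = u.
  rewrite pb invf_div mulrCA divff ?gt_eqF// mulr1 addrAC subrr add0r.
  exact/max_idPr.
have b'E : (if aa p == 0 then 1 else Num.min 1 (q / aa p - n%:R)) = v.
  rewrite pa gt_eqF ?divr_gt0 ?pos ?(ltW uv)//.
  rewrite invf_div mulrCA divff ?gt_eqF// mulr1 addrAC subrr add0r.
  exact/min_idPr.
have := child q1 p w1 wr n0; rewrite /= a'E b'E.
case=> [[]|[p' [pE [cE aE bE] sE rE lip]]]; first by rewrite leNgt uv.
have [|||p2 [p2E c2 [a2 b2 s2] r2 l2]] := IH ws p' aE bE.
- by case: szE.
- by move=> z zs; apply: wsP; rewrite inE zs orbT.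
- by right.
exists p2; split => //.
- by rewrite p2E pE /= LE.
- by rewrite c2 cE /= mulrA [_ ^+ n * _]mulrC.
- by split => //; rewrite s2 sE /= exprS invfM mulrA.
move=> r r0 rP x x01; rewrite /derivative_bound big_cons -/(derivative_bound ns).
rewrite [_ / _ * _]mulrC -mulrA; apply: r2 => // [|z zuv].
  by rewrite mulr_ge0// divr_ge0 ?(ltW q0)// exprn_ge0// addr_ge0 ?ler0n.
rewrite rE; have /andP[uz zv] : u < z < v by rewrite -aE -bE.
have nz := pos _ (ltW uz); have z0 := le_lt_trans u0 uz.
have z1 : z < 1 by exact: lt_le_trans v1.
apply: ler_pM => //.
- by rewrite divr_ge0 ?ltW// exprn_gt0// ltr_wpDl.
- rewrite /gpsi ler_pM2l// lef_pV2 ?posrE ?exprn_gt0 ?ltr_wpDl//.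
  have h : n%:R + z <= n%:R + 1 by rewrite lerD2l ltW.
  by rewrite ler_pXn2r// nnegrE ?(ltW nz)// (le_trans (ltW nz) h).
- apply: rP; rewrite pa pb /gphi !ltr_pM2l// !ltf_pV2 ?posrE ?pos ?(ltW uv) ?(ltW uz)//.
  by rewrite !ltrD2l uz zv.
Qed.

Section two_words.
Variables zeta eta : R[i].

Definition alternate M : seq R[i] := flatten (nseq M [:: eta; zeta]).

Lemma size_alternate M : size (alternate M) = M.*2.
Proof. by elim: M => //= M ->. Qed.

Lemma mem_alternate M w : w \in alternate M -> w = eta \/ w = zeta.
Proof. by elim: M => //= M IH; rewrite !inE => /or3P[/eqP|/eqP|/IH]; auto. Qed.

Lemma nth_alternate M i : (i < M.*2)%N ->
  nth 1 (alternate M) i = if odd i then zeta else eta.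
Proof.
by elim: M i => // M IH [|[|i]] //= iM; rewrite IH// negbK.
Qed.

(** A weight different from 1, unless both are. *)
Definition twist : R[i] := if eta == 1 then zeta else eta.

(** The configuration that makes images cancel: Q^M maps both cylinders onto
    (0, 1), with phases whose ratio is [twist], one way or the other. *)
Definition two_words M (d a b : R) := exists ns1 ns2 u1 v1 u2 v2,
  [/\ cylinder 0 1 ns1 u1 v1 /\ size ns1 = M.*2,
      cylinder 0 1 ns2 u2 v2 /\ size ns2 = M.*2,
      [/\ a <= u1, v1 <= u2 & v2 <= b],
      d <= derivative_bound ns1 /\ d <= derivative_bound ns2 &
      cmod (phase (alternate M) ns1 + phase (alternate M) ns2) = cmod (1 + twist)].

Hypotheses (zeta1 : cmod zeta = 1) (eta1 : cmod eta = 1).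

(** Take a cylinder inside (a, b), lengthened by one digit if necessary so that
    the next weight is [twist].  There, two words differ by one digit: N + 1
    instead of N.  The rest of both words consists of digits N, where N > q
    ensures that the branches are full. *)
Lemma two_words_in a b : 0 <= a -> a < b -> b <= 1 ->
  exists L, forall M, (L <= M)%N -> exists2 d, 0 < d & two_words M d a b.
Proof.
move=> a0 ab b1; have [ns0 [u [v [c au vb]]]] := cylinder_in a0 ab b1.
exists (size ns0).+2 => M LM.
pose N := (Num.truncn q).+1.
have qN : q <= N%:R by rewrite ltW// truncnS_gt.
have qN1 : q <= N.+1%:R by rewrite (le_trans qN)// ler_nat.
have [ns [u' [v' [c' au' vb' [ns_size ns_odd]]]]] : exists ns u' v',
    [/\ cylinder 0 1 ns u' v', a <= u', v' <= b &
        (size ns <= (size ns0).+1)%N /\ odd (size ns) = (eta == 1)].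
  have [odd0|odd0] := eqVneq (odd (size ns0)) (eta == 1).
    by exists ns0, u, v.
  have [p0 [p1 cp]] : exists p0 p1, cylinder 0 1 [:: N] p0 p1.
    by apply: cylinder_full => n; rewrite inE => /eqP ->.
  have [p00 p01 p11] := cylinder_bounds (lexx 0) ltr01 (lexx 1) cp.
  have [u1 [v1 [u2 [v2 [c1 _ [uu v1v _ _] _]]]]] :=
    cylinder_sub2 (lexx 0) (lexx 1) p00 p01 p11 p00 p01 p11 c.
  exists (ns0 ++ [:: N]), u1, v1; split.
  - exact: cylinder_cat cp c1.
  - exact: le_trans uu.
  - exact: le_trans vb.
  rewrite size_cat addn1; split => //=; move: odd0.
  by case: (odd _); case: (eta == 1).
pose t := nseq (M.*2 - (size ns).+1) N.
have szt : (size ns + (size t).+1 = M.*2)%N.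
  rewrite size_nseq addnS -addSn subnKC//.
  by rewrite (leq_ltn_trans ns_size)// (leq_trans LM)// -addnn leq_addr.
have [x [y ct]] : exists x y, cylinder 0 1 t x y.
  by apply: cylinder_full => n /nseqP[->].
have [x0 xy y1] := cylinder_bounds (lexx 0) ltr01 (lexx 1) ct.
have y0 := le_trans x0 (ltW xy).
have N0 : 0 < N%:R :> R by rewrite ltr0n.
have cN m : q <= m%:R -> cylinder 0 1 (m :: t) (q / (m%:R + y)) (q / (m%:R + x)).
  move=> qm; apply: cylinder_cons => //.
    by rewrite -(ltr0n R) (lt_le_trans q0).
  by rewrite (le_trans qm)// lerDl.
have [s00 s01 s11] := cylinder_bounds (lexx 0) ltr01 (lexx 1) (cN _ qN1).
have [r00 r01 r11] := cylinder_bounds (lexx 0) ltr01 (lexx 1) (cN _ qN).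
have [u1 [v1 [u2 [v2 [c1 c2 [uu1 v1v uu2 v2v] dis]]]]] :=
    cylinder_sub2 (lexx 0) (lexx 1) s00 s01 s11 r00 r01 r11 c'.
have c1' := cylinder_cat (cN _ qN1) c1.
have c2' := cylinder_cat (cN _ qN) c2.
have sz m : size (ns ++ m :: t) = M.*2 by rewrite size_cat.
have phE : phase (alternate M) (ns ++ N.+1 :: t) =
    twist * phase (alternate M) (ns ++ N :: t).
  rewrite phase_succ nth_alternate; last by rewrite -szt -addSnnS leq_addr.
  by rewrite /twist ns_odd.
have ph1 m : cmod (phase (alternate M) (ns ++ m :: t)) = 1.
  by apply: cmod_phase => w /mem_alternate[] ->.
exists (Num.min (derivative_bound (ns ++ N.+1 :: t)) (derivative_bound (ns ++ N :: t))).
  by rewrite lt_min !derivative_bound_gt0.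
case: dis => [|h|h].
- have h : N%:R + y <= N.+1%:R + x.
    by rewrite -[N.+1%:R]natr1 -addrA lerD2l (le_trans y1)// lerDl.
  have h0 : 0 < N%:R + y by rewrite ltr_wpDr.
  by left; rewrite ler_pM2l// lef_pV2// posrE (lt_le_trans h0).
- exists (ns ++ N.+1 :: t), (ns ++ N :: t), u1, v1, u2, v2; split => //.
  + by split => //; [exact: le_trans uu1|exact: le_trans vb'].
  + by rewrite !ge_min !lexx orbT.
  by rewrite phE -{2}[phase _ _]mul1r -mulrDl addrC RcnormM ph1 mulr1.
- exists (ns ++ N :: t), (ns ++ N.+1 :: t), u2, v2, u1, v1; split => //.
  + by split => //; [exact: le_trans uu2|exact: le_trans vb'].
  + by rewrite !ge_min !lexx orbT.
  by rewrite phE -{1}[phase _ _]mul1r -mulrDl RcnormM ph1 mulr1.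
Qed.

Lemma two_words_mono M d a b d' a' b' : d' <= d -> a' <= a -> b <= b' ->
  two_words M d a b -> two_words M d' a' b'.
Proof.
move=> dd aa bb [ns1 [ns2 [u1 [v1 [u2 [v2 [c1 c2 [au vu vb] [d1 d2] ph]]]]]]].
exists ns1, ns2, u1, v1, u2, v2; split => //.
  by split => //; [exact: le_trans au|exact: le_trans bb].
by split; [exact: le_trans d1|exact: le_trans d2].
Qed.

Lemma bounded_uniform (P : nat -> nat -> Prop) D :
  (forall k m n, (m <= n)%N -> P k m -> P k n) ->
  (forall k, (k < D)%N -> exists n, P k n) ->
  exists n, forall k, (k < D)%N -> P k n.
Proof.
move=> Pm; elim: D => [|D IH] PD; first by exists 0%N.
have [k kD|n nP] := IH; first by apply: PD; rewrite ltnS ltnW.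
have [m mP] := PD D (ltnSn D).
exists (maxn n m) => k; rewrite ltnS leq_eqVlt => /predU1P[->|/nP].
  exact: Pm (leq_maxr _ _) mP.
exact/Pm/leq_maxl.
Qed.

(** An interval longer than 1/s contains a cell of the grid of step 1/D, as
    2/D < 1/s, and there are finitely many cells. *)
Lemma two_words_uniform s : 0 < s -> exists L, forall M, (L <= M)%N ->
  exists2 d, 0 < d & forall a b, 0 <= a -> b <= 1 -> s^-1 < b - a -> two_words M d a b.
Proof.
move=> s0; pose D := (Num.truncn (2 * s)).+1.
have D0 : 0 < D%:R :> R by rewrite ltr0n.
have DV : 0 < D%:R^-1 :> R by rewrite invr_gt0.
have Ds : 2 / D%:R < s^-1.
  by rewrite ltr_pdivrMr// ltr_pdivlMl// mulrC truncnS_gt.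
pose a_ k : R := k%:R / D%:R.
have [||L LP] := @bounded_uniform (fun k L => forall M, (L <= M)%N ->
    exists2 d, 0 < d & two_words M d (a_ k) (a_ k.+1)) D.
- by move=> k m n mn h M nM; apply: h; exact: leq_trans nM.
- move=> k kD; apply: two_words_in; first by rewrite divr_ge0.
    by rewrite ltr_pM2r// ltr_nat.
  by rewrite ler_pdivrMr// mul1r ler_nat.
exists L => M LM.
have [||n nP] := @bounded_uniform (fun k n =>
    two_words M n.+1%:R^-1 (a_ k) (a_ k.+1)) D.
- move=> k m n mn; apply: two_words_mono => //.
  by rewrite lef_pV2 ?posrE ?ltr0n// ler_nat ltnS.
- move=> k kD; have [d d0 dP] := LP k kD M LM; exists (Num.truncn d^-1).
  apply: two_words_mono dP => //; rewrite invf_ple ?posrE ?ltr0n//.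
  exact/ltW/truncnS_gt.
exists n.+1%:R^-1; first by rewrite invr_gt0 ltr0n.
move=> a b a0 b1 sab; pose k := (Num.truncn (a * D%:R)).+1.
have /andP[ka ak] : (Num.truncn (a * D%:R))%:R <= a * D%:R < k%:R.
  by apply: truncn_itv; rewrite mulr_ge0// ltW.
have kE : k.+1%:R = (Num.truncn (a * D%:R))%:R + 2 :> R.
  by rewrite /k -natr1 -natr1 -addrA.
have kb : a_ k.+1 < b.
  rewrite /a_ ltr_pdivrMr// kE.
  have : 2 / D%:R < b - a by exact: lt_trans sab.
  rewrite ltr_pdivrMr// mulrBl; move: ka; lra.
apply: two_words_mono (nP k _) => //.
- by rewrite /a_ ler_pdivlMr// ltW.
- exact: ltW.
have : a_ k.+1 < 1 by exact: lt_le_trans kb b1.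
by rewrite /a_ ltr_pdivrMr// mul1r ltr_nat; apply: leq_trans; rewrite ltnS.
Qed.

End two_words.

End cylinders.

(** * Disjoint supports, and the total integral *)
Section disjoint_sums.
Context {R : realType}.
Local Notation mu := (@lebesgue_measure R).
Implicit Types (i : interval R) (f g : R -> Rcomplex R).

Lemma L1_class_normR i f : f \in cintegrable i ->
  `|L1_class i f| = \int[mu]_(x in [set` i]) `|f x|.
Proof. by move=> fi; apply: EFin_inj; rewrite (L1_class_norm fi) /Rintegral fineK// -(L1_class_norm fi). Qed.

Lemma integrable_norm i f : f \in cintegrable i ->
  mu.-integrable [set` i] (EFin \o (fun x => `|f x| : R)).
Proof.
move=> fi; have [mr mi] := cintegrable_measurable fi.
apply/integrableP; split; first by apply/measurable_EFinP; exact: measurable_norm.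
under eq_integral do rewrite /= normr_id.
by rewrite -(L1_class_norm fi) ltry.
Qed.

Lemma L1_normD_disjoint i f g : f \in cintegrable i -> g \in cintegrable i ->
  (forall x, f x = 0 \/ g x = 0) ->
  `|L1_class i (f + g)| = `|L1_class i f| + `|L1_class i g|.
Proof.
move=> fi gi fg; rewrite !L1_class_normR ?rpredD// -RintegralD//.
- apply: eq_Rintegral => x _; rewrite (_ : (f + g) x = f x + g x)//.
  by case: (fg x) => ->; rewrite ?(addr0, add0r) normr0 ?(addr0, add0r).
- exact: integrable_norm.
- exact: integrable_norm.
Qed.

Lemma L1_norm_sum_disjoint i (I : eqType) (s : seq I) (F : I -> R -> Rcomplex R) :
  uniq s -> (forall k, k \in s -> F k \in cintegrable i) ->
  (forall k l x, k \in s -> l \in s -> k != l -> F k x = 0 \/ F l x = 0) ->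
  `|\sum_(k <- s) L1_class i (F k)| = \sum_(k <- s) `|L1_class i (F k)|.
Proof.
move=> us Fi Fd; suff [] : [/\ \sum_(k <- s) F k \in cintegrable i,
    L1_class i (\sum_(k <- s) F k) = \sum_(k <- s) L1_class i (F k) &
    `|L1_class i (\sum_(k <- s) F k)| = \sum_(k <- s) `|L1_class i (F k)|].
  by move=> _ <-.
elim: s us Fi Fd => [|k s IH] /=.
  by move=> _ _ _; rewrite !big_nil L1_class0 normr0 rpred0.
move=> /andP[ks us] Fi Fd; rewrite !big_cons.
have [l ls|l m x ls ms|si sE sN] := IH us.
- by apply: Fi; rewrite inE ls orbT.
- by apply: Fd; rewrite inE ?ls ?ms orbT.
have ki : F k \in cintegrable i by apply: Fi; rewrite inE eqxx.
split; first exact: rpredD.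
  by rewrite L1_classD// sE.
rewrite L1_normD_disjoint// ?sN// => x.
have [?|/eqP Fk] := eqVneq (F k x) 0; [by left|right].
rewrite fct_sumE big_seq big1// => l ls.
have kl : k != l by apply: contraNneq ks => ->.
have lks : l \in k :: s by rewrite inE ls orbT.
by case: (Fd k l x (mem_head _ _) lks kl).
Qed.

End disjoint_sums.

Section integral_functional.
Context {R : realType}.
Local Notation mu := (@lebesgue_measure R).
Local Notation X := (L1 (`]0, 1[ : interval R)).

(** The functional that Q preserves when zeta = eta = 1.  On the atoms with
    real phases it detects the sign lost by the norm. *)
Definition total (f : X) : R^o := \int[mu]_(x in `]0, 1[) complex.Re (extend0 f x).

Lemma total_class h : h \in cintegrable (`]0, 1[ : interval R) ->
  total (L1_class _ h) = \int[mu]_(x in `]0, 1[) complex.Re (h x).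
Proof.
move=> hi; rewrite /total /Rintegral; congr fine.
have ei := extend0_cintegrable (L1_class (`]0, 1[ : interval R) h).
apply: ae_eq_integral => //.
- by apply/measurable_EFinP; have [] := cintegrable_measurable ei.
- by apply/measurable_EFinP; have [] := cintegrable_measurable hi.
apply: (@filterS _ _ ae_lebesgue_filter _ _ _ (extend0_L1_class hi)) => x hx xi.
by rewrite hx.
Qed.

Lemma total_badditive : bounded_additive 1 total.
Proof.
split=> [f g|f].
  have fi := extend0_cintegrable f; have gi := extend0_cintegrable g.
  rewrite -{1}[f]L1_class_extend0 -{1}[g]L1_class_extend0 -L1_classD//.
  rewrite total_class ?rpredD// /total -RintegralD//.
  - by apply: eq_Rintegral => x _; rewrite [(_ + _) x]/(extend0 f x + extend0 g x);
      case: (extend0 f x) (extend0 g x) => [? ?] [].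
  - by case/andP: fi.
  - by case/andP: gi.
have fi := extend0_cintegrable f.
rewrite mul1r -[f in leRHS]L1_class_extend0 L1_class_normR//.
rewrite /total (le_trans (le_normr_Rintegral _ _))//.
  by case/andP: fi.
apply: le_Rintegral => //.
- have := integrable_norm fi => _.
  have /andP[ri _] := fi.
  by apply: (integrable_abse ri).
- exact: integrable_norm.
by move=> x _; exact: ler_Re_norm.
Qed.

Lemma total_bump c a b rho s : density a b rho s ->
  (forall x, a < x < b -> x \in (`]0, 1[ : interval R)) ->
  total (bump `]0, 1[ c a b rho) = complex.Re c * \int[mu]_(x in `]a, b[) rho x.
Proof.
move=> dr abi; rewrite /bump total_class; last exact: bump_cintegrable dr abi.
rewrite -RintegralZl//; last exact: integrable_density dr.
rewrite [LHS]Rintegral_mkcond [RHS]Rintegral_mkcond; apply: eq_Rintegral => x _.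
rewrite !patchE !mem_setE /bump_fun [x \in `]a, b[]in_itv/=.
case: ifPn => [xi|xi]; case: ifPn => // axb; first by case: (c) => u v /=; rewrite mulr0 subr0.
by rewrite abi in xi.
Qed.

End integral_functional.

(** * Cutting atoms, subtracting constants from their densities *)
Section pieces.
Context {R : realType}.
Variables (q : R) (q1 : 1 < q) (rl : bool).
Local Notation mu := (@lebesgue_measure R).
Local Notation X := (L1 (`]0, 1[ : interval R)).
Local Notation atom := (atom q rl).
Local Open Scope complex_scope.

Definition piece (p : atom) x y : X := bump `]0, 1[ (ac p) x y (arho p).

Lemma piece_whole p : piece p (aa p) (ab p) = aval p.
Proof. by []. Qed.

Lemma piece_density (p : atom) x y : aa p <= x -> y <= ab p ->
  density x y (arho p) (asup p).
Proof.
move=> ax yb; have [mr r0 rs] := adens p; split => // z /andP[xz zy].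
by apply: rs; rewrite (le_lt_trans ax xz) (lt_le_trans zy yb).
Qed.

Lemma piece_in (p : atom) x y : aa p <= x -> y <= ab p ->
  forall z, x < z < y -> z \in (`]0, 1[ : interval R).
Proof.
move=> ax yb; apply: itv_sub01; first exact: le_trans (aa0 p) ax.
exact: le_trans yb (ab1 p).
Qed.

Lemma piece_atom (p : atom) x y : aa p <= x -> x < y -> y <= ab p ->
  exists p' : atom, [/\ aval p' = piece p x y, [/\ ac p' = ac p, aa p' = x & ab p' = y],
    asup p' = asup p & arho p' = arho p].
Proof.
move=> ax xy yb; have lip : loglip (Lam q) x y (arho p).
  move=> z t /andP[xz zy] /andP[xt ty]; apply: (@alip _ _ _ p).
    by rewrite (le_lt_trans ax xz) (lt_le_trans zy yb).
  by rewrite (le_lt_trans ax xt) (lt_le_trans ty yb).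
by exists (@Atom R q rl (ac p) x y (arho p) _ (ac1 p) (@acr _ _ _ p)
  (le_trans (aa0 p) ax) xy (le_trans yb (ab1 p)) (piece_density ax yb) lip).
Qed.

Lemma piece_split (p : atom) x y z : aa p <= x -> x <= y -> y <= z -> z <= ab p ->
  piece p x z = piece p x y + piece p y z /\
  `|piece p x z| = `|piece p x y| + `|piece p y z|.
Proof.
move=> ax xy yz zb; have ay := le_trans ax xy; have yb := le_trans yz zb.
have cxy := bump_cintegrable (ac p) (piece_density ax yb) (piece_in ax yb).
have cyz := bump_cintegrable (ac p) (piece_density ay zb) (piece_in ay zb).
have cxz := bump_cintegrable (ac p) (piece_density ax zb) (piece_in ax zb).
have E : piece p x z = L1_class _ (bump_fun (ac p) x y (arho p) + bump_fun (ac p) y z (arho p)).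
  apply: L1_class_eq; [exact: cxz|exact: rpredD|].
  exists [set y]; split; [exact: measurable_set1|exact: lebesgue_measure_set1|].
  move=> t /=; apply: contra_notP => ty _.
  rewrite [(_ + _) _](_ : _ = bump_fun (ac p) x y (arho p) t +
    bump_fun (ac p) y z (arho p) t)// /bump_fun.
  have [ty'|yt|tE] := ltgtP t y; last by case: ty.
  - by rewrite addr0 andbT (lt_le_trans ty' yz) andbT.
  - by rewrite andbF add0r (le_lt_trans xy yt).
split; first by rewrite E L1_classD.
rewrite E L1_normD_disjoint// => t; rewrite /bump_fun.
have [ty|ty] := ltP t y; first by right; rewrite (ltNge y) (ltW ty).
by left; rewrite andbF.
Qed.

(** A degenerate piece is zero, and is not an atom; the bound holds all the
    same. *)
Lemma piece_hull (p : atom) x y (T : X -> X) c (K t : R) :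
  (forall p' : atom, hull (@aval R q rl) c (K * `|aval p'| + t * asup p') (T (aval p'))) ->
  0 <= t -> T 0 = 0 -> aa p <= x -> x <= y -> y <= ab p ->
  hull (@aval R q rl) c (K * `|piece p x y| + t * asup p) (T (piece p x y)).
Proof.
move=> Tp t0 T0 ax; rewrite le_eqVlt => /predU1P[<- xb|xy yb].
  have -> : piece p x x = 0.
    rewrite -(L1_class0 `]0, 1[) /piece /bump; congr L1_class; apply/funext => z.
    rewrite /bump_fun; case: ifPn => // /andP[h1 h2].
    by have := lt_trans h1 h2; rewrite ltxx.
  by rewrite normr0 mulr0 add0r T0; apply: hull0; rewrite mulr_ge0// asup_ge0.
have [p' [pE _ sE _]] := piece_atom ax xy yb.
by rewrite -pE -sE; exact: Tp.
Qed.

Definition flat (c : R[i]) : X := bump `]0, 1[ c 0 1 (fun=> 1).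

Let dens1 : density (0 : R) 1 (fun=> 1) 1. Proof. by split. Qed.
Let in01 x : 0 < x < 1 -> x \in (`]0, 1[ : interval R). Proof. by []. Qed.

Lemma flatD c d : flat (c + d) = flat c + flat d.
Proof.
rewrite /flat /bump -L1_classD; try exact: bump_cintegrable dens1 in01.
congr L1_class; apply/funext => x.
rewrite [RHS](_ : _ = bump_fun c 0 1 (fun=> 1) x + bump_fun d 0 1 (fun=> 1) x)//.
by rewrite /bump_fun; case: ifP => _; rewrite ?addr0// !mulr1.
Qed.

Lemma flat0 : flat 0 = 0.
Proof. by apply: (addrI (flat 0)); rewrite -flatD !addr0. Qed.

Lemma flatN (c : R[i]) : flat (- c) = - flat c.
Proof. by apply: (addrI (flat c)); rewrite -flatD subrr flat0 subrr. Qed.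

Lemma Rintegral01_cst (s : R) : \int[mu]_(x in `]0, 1[) s = s.
Proof. by rewrite Rintegral_itv_cst// subr0 mulr1. Qed.

Lemma flat_hull c t : (rl -> complex.Im c = 0) -> 0 <= t ->
  hull (@aval R q rl) (cost 1 t) (cmod c * (1 + t)) (flat c).
Proof.
move=> cr t0; have [->|c0] := eqVneq c 0.
  by rewrite flat0; apply: hull0; rewrite mulr_ge0// addr_ge0.
have n0 : 0 < cmod c by rewrite normr_gt0.
have nV : cmod ((cmod c)^-1%:C) = (cmod c)^-1 by rewrite Rcnorm_real gtr0_norm// invr_gt0.
have u1 : cmod ((cmod c)^-1%:C * c) = 1 by rewrite RcnormM nV mulVf// gt_eqF.
have ur : rl -> complex.Im ((cmod c)^-1%:C * c) = 0.
  by move=> /cr; case: (c) => x y /= ->; rewrite mul0r mulr0 addr0.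
have dc : density (0 : R) 1 (fun=> cmod c) (cmod c) by split.
have lc : loglip (Lam q) 0 1 (fun=> cmod c).
  move=> x y _ _; rewrite ler_peMl ?(ltW n0)// -expR0 ler_expR mulr_ge0//.
  by apply: ltW; apply: lt_trans (Lam_gt2 q1).
pose p := @Atom R q rl _ 0 1 _ _ u1 ur (lexx 0) ltr01 (lexx 1) dc lc.
have -> : flat c = aval p.
  rewrite /flat /aval /bump; congr L1_class; apply/funext => x; rewrite /bump_fun /=.
  case: ifP => // _; rewrite mulr1 mulrAC -[_ * (cmod c)%:C]rmorphM mulVf ?mul1r// ?gt_eqF//.
apply: hull_val_le; rewrite /cost mul1r mulrDr mulr1 aval_norm /= mulrC.
by rewrite Rintegral01_cst mulrC.
Qed.

(** Subtracting a constant d from a density rho >= r makes its logarithm less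
    regular; the condition on d is that the margin 2 in the Lipschitz constant
    absorbs the loss, by the estimates e^t - 1 <= t e^t and e^(2t) - 1 >= 2t. *)
Lemma subtract_flat (p : atom) d r : aa p = 0 -> ab p = 1 ->
  loglip (Lam q - 2) 0 1 (arho p) -> 0 <= d ->
  (forall x, 0 < x < 1 -> r <= arho p x) -> Lam q * expR (Lam q) * d <= 2 * r ->
  exists p' : atom, [/\ aval p = aval p' + flat (d%:C * ac p),
    `|aval p'| = `|aval p| - d & asup p' = asup p].
Proof.
move=> a0 b1 lip d0 rP dr; have [mr r0 rs] := adens p.
have L2 := Lam_gt2 q1; have e1 : 1 <= expR (Lam q).
  by rewrite -expR0 ler_expR ltW// (lt_trans _ L2).
have L0 : 0 <= Lam q by rewrite ltW// (lt_trans _ L2).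
have dler : d <= r.
  rewrite -(ler_pM2l (ltr0n R 2)) (le_trans _ dr)// ler_wpM2r//.
  by rewrite -[leLHS]mulr1 ler_pM ?(ltW L2).
pose rho x := Num.max 0 (arho p x - d).
have rhoE x : 0 < x < 1 -> rho x = arho p x - d.
  by move=> /rP rx; apply/max_idPr; rewrite subr_ge0 (le_trans dler).
have mrho : measurable_fun [set: R] rho.
  by apply: measurable_maxr => //; exact: measurable_funB.
have drho : density 0 1 rho (asup p).
  split => // [x|x x01]; first by rewrite le_max lexx.
  by rewrite rhoE// (le_trans _ (rs x _)) ?a0 ?b1// gerBl.
have lrho : loglip (Lam q) 0 1 rho.
  move=> x y x01 y01; rewrite !rhoE//.
  have t1 : `|x - y| <= 1 by apply: (@itv_dist_le1 _ _ _ p); rewrite a0 b1.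
  have t0 := normr_ge0 (x - y); set t := `|x - y| in t0 t1 *.
  have h := lip _ _ x01 y01; rewrite -/t in h.
  have ry := rP _ y01.
  have EE : expR (Lam q * t) = expR ((Lam q - 2) * t) * expR (2 * t).
    by rewrite -expRD -mulrDl subrK.
  have E2 : 1 + 2 * t <= expR (2 * t) by exact: expR_ge1Dx.
  have E3 : 1 <= expR ((Lam q - 2) * t).
    have L20 : 0 <= Lam q - 2 by move: L2; lra.
    by rewrite -[leLHS]expR0 ler_expR mulr_ge0.
  have E4 : expR (Lam q * t) * (1 - Lam q * t) <= 1.
    have := expR_ge1Dx (- (Lam q * t)); rewrite expRN => h4.
    by rewrite mulrC -ler_pdivlMr ?expR_gt0// mul1r.
  have E5 : expR (Lam q * t) <= expR (Lam q) by rewrite ler_expR ler_piMr.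
  have A0 : 0 <= arho p y by exact: r0.
  have h5 : expR (Lam q * t) - 1 <= expR (Lam q) * (Lam q * t).
    have : expR (Lam q * t) * (Lam q * t) <= expR (Lam q) * (Lam q * t).
      by rewrite ler_wpM2r// mulr_ge0.
    move: E4; rewrite mulrBr mulr1; lra.
  have h6 : (expR (Lam q * t) - 1) * d <= 2 * t * r.
    apply: (@le_trans _ _ (expR (Lam q) * (Lam q * t) * d)).
      by rewrite ler_wpM2r.
    have -> : expR (Lam q) * (Lam q * t) * d = t * (Lam q * expR (Lam q) * d) by ring.
    by rewrite (_ : 2 * t * r = t * (2 * r)) ?ler_wpM2l//; ring.
  have h7 : 2 * t * r <= (expR (Lam q * t) - expR ((Lam q - 2) * t)) * arho p y.
    apply: ler_pM => //; first by rewrite mulr_ge0.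
      exact: le_trans d0 dler.
    rewrite EE; set u := expR ((Lam q - 2) * t) in E3 *; set v := expR (2 * t) in E2 *.
    have : 2 * t <= u * (2 * t) by rewrite ler_peMl// mulr_ge0.
    have : u * (1 + 2 * t) <= u * v by rewrite ler_wpM2l// (le_trans ler01).
    rewrite mulrDr mulr1; lra.
  rewrite mulrBr; move: h h6 h7; rewrite !mulrBl mul1r; lra.
pose p' := @Atom R q rl _ 0 1 _ _ (ac1 p) (@acr _ _ _ p) (lexx 0) ltr01 (lexx 1) drho lrho.
have cp' := bump_cintegrable (ac p) drho in01.
exists p'; split => //.
- rewrite /flat /aval /bump -L1_classD//; last exact: bump_cintegrable dens1 in01.
  congr L1_class; apply/funext => x; rewrite a0 b1.
  rewrite [RHS](_ : _ = bump_fun (ac p) 0 1 rho x +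
    bump_fun (d%:C * ac p) 0 1 (fun=> 1) x)// /bump_fun; case: ifP => [x01|_]; last by rewrite addr0.
  by rewrite rhoE// mulr1 [d%:C * _]mulrC -mulrDr -rmorphD/= subrK.
rewrite !aval_norm /= a0 b1.
transitivity (\int[mu]_(x in `]0, 1[) (arho p x - d)).
  by apply: eq_Rintegral => x; rewrite mem_setE in_itv/= => x01; rewrite rhoE.
rewrite RintegralB ?Rintegral01_cst//; last exact: integrable_itv_cst.
by have := integrable_density (adens p); rewrite a0 b1.
Qed.

End pieces.

(** * An iterate of Q contracts the cost *)
Section contraction.
Context {R : realType}.
Variables (q : R) (zeta eta : R[i]).
Hypotheses (q1 : 1 < q) (zeta1 : cmod zeta = 1) (eta1 : cmod eta = 1).
Local Notation X := (L1 (`]0, 1[ : interval R)).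
Local Open Scope complex_scope.
Let q0 : 0 < q. Proof. exact: lt_trans q1. Qed.

Let rl := (zeta == 1) && (eta == 1).
Local Notation atom := (atom q rl).
Local Notation val := (@aval R q rl).
Local Notation Q := (Q_op q zeta eta).

Lemma Q_badditive : bounded_additive 1 Q.
Proof.
rewrite -[X in bounded_additive X](mulr1 1).
by apply: bounded_additive_comp; [exact: ler01|exact: L_op_badditive|exact: L_op_badditive].
Qed.

Lemma iter_Q_badditive M : bounded_additive 1 (iter M Q).
Proof. exact/bounded_additive_iter/Q_badditive. Qed.

Lemma iter_Q_word M f : iter M Q f = L_word q (alternate zeta eta M) f.
Proof. by elim: M f => // M IH f; rewrite iterSr IH. Qed.

Lemma alternate_admissible M w : w \in alternate zeta eta M -> @admissible R rl w.
Proof. by move=> /mem_alternate[] ->; split => // /andP[/eqP ? /eqP ?]. Qed.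

(** Two unimodular numbers of ratio w add up to a number of modulus |1 + w|,
    which is less than 2 if w is not 1.  For zeta = eta = 1 nothing cancels, but
    the subtracted parts are compensated entirely by the total integral: this
    amounts to the value g = 2. *)
Lemma twist_gap : exists g : R, [/\ 0 < g, g <= 2 &
  if rl then g = 2 else cmod (1 + twist zeta eta) <= 2 - g].
Proof.
have [r|nr] := boolP rl; first by exists 2.
have t1 : cmod (twist zeta eta) = 1 by rewrite /twist; case: ifP.
have tn1 : twist zeta eta != 1.
  rewrite /twist; case: ifPn => // e1; move: nr; rewrite /rl e1 andbT//.
exists (2 - cmod (1 + twist zeta eta)); split; last 2 first.
- by rewrite gerBl.
- by rewrite subKr.
rewrite subr_gt0; move: t1 tn1; case: (twist zeta eta) => x y.
rewrite !RcnormE /= => t1 tn1; have {}t1 : x ^+ 2 + y ^+ 2 = 1.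
  by rewrite -[RHS](expr1n _ 2) -t1 sqr_sqrtr// addr_ge0 ?sqr_ge0.
have x1 : x < 1.
  rewrite ltNge; apply/negP => x1; move: tn1; apply/negP/negPn/eqP.
  have y0 : y = 0 by apply/eqP; rewrite -sqrf_eq0 eq_le sqr_ge0 andbT; nra.
  by rewrite y0; congr (_ +i* _); move: t1; rewrite y0; nra.
rewrite add0r -[ltRHS]ger0_norm// -sqrtr_sqr ltr_sqrt//; nra.
Qed.

Lemma mass_le_arho (p : atom) y : aa p < y < ab p -> `|aval p| <= expR (Lam q) * arho p y.
Proof.
move=> yp; have [mr r0 rs] := adens p.
have e0 : 0 <= expR (Lam q) * arho p y by rewrite mulr_ge0// expR_ge0.
apply: le_trans (aval_le e0 _) _ => [x xp|]; first exact: arho_comparable.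
by rewrite ler_piMr//; have := aa0 p; have := ab1 p; lra.
Qed.

Lemma aval_le_sup (p : atom) : `|aval p| <= asup p * (ab p - aa p).
Proof. by apply: aval_le; [exact: asup_ge0|have [] := adens p]. Qed.

Lemma total_atom (p : atom) : total (aval p) = complex.Re (ac p) * `|aval p|.
Proof.
by rewrite aval_norm; apply: total_bump (adens p) _; exact: itv_sub01 (aa0 p) (ab1 p).
Qed.

(** Cut p along the two cylinders.  Their images are atoms on (0, 1), both with
    density at least [kap] times the mass m of p, up to a constant that the
    assumption on [kap] takes into account.  Removing the constant density
    kap m from both lowers the cost by 2 kap m, and adding the removed parts up
    costs at most (2 - g) kap m (1 + tau).  The three remaining pieces are
    estimated by the growth bound. *)
Lemma long_atom M (d g kap C tau th : R) (p : atom) : 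
  0 < d -> 0 < kap -> 0 <= tau -> 0 <= C -> 0 <= th -> q^-1 ^+ M.*2 <= th ->
  (if rl then g = 2 else cmod (1 + twist zeta eta) <= 2 - g) ->
  kap * (Lam q * expR (Lam q)) * expR (Lam q) <= 2 * d ->
  (forall p' : atom, hull val (cost 1 tau) (cost (1 + tau * (2 * C)) (tau * th) p')
    (iter M Q (aval p'))) ->
  (0 < M)%N -> two_words q zeta eta M d (aa p) (ab p) ->
  hull val (cost 1 tau)
    ((1 + tau * (2 * C)) * `|aval p| + 5 * (tau * th * asup p) - 2 * kap * `|aval p|
      + (2 - g) * (kap * `|aval p|) * (1 + tau))
    (iter M Q (aval p) - flat (((if rl then 2 * kap else 0) * total (aval p))%:C)).
Proof.
move=> d0 k0 t0 C0 th0 qth gP kd grow M0.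
move=> [ns1 [ns2 [u1 [v1 [u2 [v2 [[c1 sz1] [c2 sz2] [au vu vb] [d1 d2] ph]]]]]]].
have bT := iter_Q_badditive M.
have [_ uv1 _] := cylinder_bounds q1 (lexx 0) ltr01 (lexx 1) c1.
have [_ uv2 _] := cylinder_bounds q1 (lexx 0) ltr01 (lexx 1) c2.
have av1 := le_trans au (ltW uv1); have au2 := le_trans av1 vu.
have av2 := le_trans au2 (ltW uv2).
have u2b := le_trans (ltW uv2) vb; have v1b := le_trans vu u2b.
have u1b := le_trans (ltW uv1) v1b.
set m := `|aval p|; set s := asup p.
have m0 : 0 <= m by exact: normr_ge0.
have [E1 N1] := piece_split (lexx (aa p)) au u1b (lexx (ab p)).
have [E2 N2] := piece_split au (ltW uv1) v1b (lexx (ab p)).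
have [E3 N3] := piece_split av1 vu u2b (lexx (ab p)).
have [E4 N4] := piece_split au2 (ltW uv2) vb (lexx (ab p)).
have full ns u v : cylinder q 0 1 ns u v -> size ns = M.*2 -> u < v ->
    aa p <= u -> v <= ab p -> d <= derivative_bound q ns ->
    exists p' : atom, iter M Q (piece p u v) =
      aval p' + flat ((kap * m)%:C * (phase (alternate zeta eta M) ns * ac p)) /\
      cost 1 tau p' <= `|piece p u v| - kap * m + tau * th * s.
  move=> c sz uv au' vb' dns.
  have [p1 [p1E [p1c p1a p1b] p1s p1r]] := piece_atom au' uv vb'.
  have [|||p2 [p2E p2c [p2a p2b p2s] p2r p2l]] :=
      @atom_word R q q1 rl ns u v (alternate zeta eta M) p1 c p1a p1b.
  - by rewrite size_alternate sz.
  - exact: alternate_admissible.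
  - by left => nsE; move: M0; rewrite -double_gt0 -sz nsE.
  have low x : aa p1 < x < ab p1 -> expR (- Lam q) * m <= arho p1 x.
    rewrite p1a p1b p1r => /andP[ux xv].
    rewrite expRN ler_pdivrMl ?expR_gt0// mass_le_arho//.
    by rewrite (le_lt_trans au' ux) (lt_le_trans xv vb').
  have low0 : 0 <= expR (- Lam q) * m by rewrite mulr_ge0// expR_ge0.
  have p2low x : 0 < x < 1 -> d * (expR (- Lam q) * m) <= arho p2 x.
    by move=> /(p2r _ low0 low); apply: le_trans; rewrite ler_wpM2r.
  have [||p3 [p3E p3m p3s]] := subtract_flat q1 p2a p2b p2l (d := kap * m) _ p2low.
  - by rewrite mulr_ge0// ltW.
  - have h : kap * (Lam q * expR (Lam q)) * expR (Lam q) * (expR (- Lam q) * m)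
        <= 2 * d * (expR (- Lam q) * m) by rewrite ler_wpM2r.
    rewrite [leRHS]mulrA (le_trans _ h)//.
    rewrite [leRHS]mulrA -[_ * expR (Lam q) * expR (- _)]mulrA -expRD subrr expR0 mulr1.
    by rewrite le_eqVlt; apply/orP; left; apply/eqP; ring.
  have p2N : `|aval p2| <= `|piece p u v|.
    by rewrite p2E -iter_Q_word p1E (le_trans (badditive_norm bT _))// mul1r.
  exists p3; split.
    by rewrite iter_Q_word -p1E -p2E p3E p2c p1c.
  rewrite /cost mul1r p3m p3s p2s p1s sz -[tau * th * s]mulrA lerD//; first by rewrite lerD2r.
  by rewrite ler_wpM2l// mulrC ler_wpM2r ?asup_ge0// -exprVn.
have [p1 [P1 K1]] := full _ _ _ c1 sz1 uv1 au v1b d1.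
have [p2 [P2 K2]] := full _ _ _ c2 sz2 uv2 au2 vb d2.
set f1 := (kap * m)%:C * _ in P1; set f2 := (kap * m)%:C * _ in P2.
set f3 := (_ * total _)%:C.
have rest x y : aa p <= x -> x <= y -> y <= ab p ->
  hull val (cost 1 tau) ((1 + tau * (2 * C)) * `|piece p x y| + tau * th * s)
    (iter M Q (piece p x y)).
  apply: piece_hull => //; first by rewrite mulr_ge0.
  exact: badditive0 bT.
have TE : iter M Q (aval p) - flat f3 =
    (iter M Q (piece p (aa p) u1) + iter M Q (piece p v1 u2) + iter M Q (piece p v2 (ab p))) +
    (aval p1 + aval p2 + flat (f1 + f2 - f3)).
  rewrite -piece_whole E1 E2 E3 E4 !(badditiveD bT) P1 P2.
  rewrite !flatD flatN.
  set x1 := iter M Q _; set x2 := iter M Q _; set x3 := iter M Q _.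
  set y1 := aval p1; set y2 := aval p2; set z1 := flat f1; set z2 := flat f2; set z3 := flat f3.
  rewrite -!addrA; congr (_ + _).
  rewrite [z1 + (x2 + _)]addrCA [y1 + (x2 + _)]addrCA; congr (_ + _).
  rewrite [z2 + (x3 + _)]addrCA [y2 + (x3 + _)]addrCA [z1 + (x3 + _)]addrCA.
  by rewrite [y1 + (x3 + _)]addrCA; congr (_ + (_ + _)); rewrite addrCA.
have mE : m = `|piece p (aa p) u1| + `|piece p u1 v1| + `|piece p v1 u2| +
    `|piece p u2 v2| + `|piece p v2 (ab p)|.
  by rewrite /m -piece_whole N1 N2 N3 N4 !addrA.
have n1 := normr_ge0 (piece p u1 v1); have n2 := normr_ge0 (piece p u2 v2).
have acE : rl -> ac p = (complex.Re (ac p))%:C.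
  by move=> r; have := acr p r; case: (ac p) => x y /= ->.
have fP : (rl -> complex.Im (f1 + f2 - f3) = 0) /\ cmod (f1 + f2 - f3) <= (2 - g) * (kap * m).
  have fE : f1 + f2 = (kap * m)%:C * ((phase (alternate zeta eta M) ns1 +
      phase (alternate zeta eta M) ns2) * ac p).
    by rewrite /f1 /f2 -mulrDr -mulrDl.
  have [r|nr] := boolP rl; last first.
    have -> : f3 = 0 by rewrite /f3 ifN// mul0r.
    split => //; rewrite subr0 fE !RcnormM Rcnorm_real ac1 mulr1 ph.
    rewrite ger0_norm ?mulr_ge0 ?(ltW k0)// mulrC ler_wpM2r ?mulr_ge0 ?(ltW k0)//.
    by move: gP; rewrite (negbTE nr).
  suff -> : f1 + f2 - f3 = 0.
    by split => //; move: gP; rewrite r => ->; rewrite subrr mul0r normr0.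
  have f3E : f3 = (2 * kap * (complex.Re (ac p) * m))%:C by rewrite /f3 ifT// total_atom.
  have ph1 ns : phase (alternate zeta eta M) ns = 1.
    by apply: phase_1 => w /alternate_admissible[_ ->].
  rewrite fE f3E !ph1 {1}(acE r) -[1 + 1]/(2 : R[i]).
  rewrite (_ : 2 = (2 : R)%:C); last by rewrite rmorphMn.
  by rewrite -!rmorphM/= -rmorphB/= (_ : _ - _ = 0)//; ring.
have H1 := hullD (hullD (rest _ _ (lexx _) au u1b) (rest _ _ av1 vu u2b))
  (rest _ _ av2 vb (lexx _)).
have H2 := hullD (hullD (@hull_val_le _ _ _ val _ _ _ K1) (@hull_val_le _ _ _ val _ _ _ K2))
  (flat_hull q1 fP.1 t0).
rewrite TE; apply: hull_le (hullD H1 H2).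
have h3 : cmod (f1 + f2 - f3) * (1 + tau) <= (2 - g) * (kap * m) * (1 + tau).
  by rewrite ler_wpM2r ?addr_ge0// fP.2.
have tC : 0 <= tau * (2 * C) by rewrite !mulr_ge0.
move: h3; rewrite -/m; set w := cmod _ * _; set w' := (2 - g) * _ * _.
move: mE n1 n2; set a1 := `|piece _ (aa p) _|; set a2 := `|piece _ u1 _|.
set a3 := `|piece _ v1 _|; set a4 := `|piece _ u2 _|; set a5 := `|piece _ v2 _|.
move=> -> n1 n2 h3.
have := mulr_ge0 tC n1; have := mulr_ge0 tC n2.
set B := tau * (2 * C) => Ba Bb.
rewrite -/s; clear -h3 n1 n2 Ba Bb; lra.
Qed.

Lemma growth_Q : exists C N (th : R), [/\ 0 <= C, (0 < N)%N, 0 <= th <= 2^-1,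
  q^-1 ^+ N.*2 <= th & forall j alpha beta (p : atom), 0 <= alpha -> 0 <= beta ->
  hull val (cost alpha beta) (cost (alpha + beta * (2 * C)) (beta * th ^+ j) p)
    (iter (j * N) Q (aval p))].
Proof.
have qV1 : q^-1 < 1 by rewrite invf_lt1.
have qV0 : 0 <= q^-1 by rewrite invr_ge0 ltW.
have [N0 NP] : exists N0, forall n, (N0 <= n)%N -> q^-1 ^+ n <= 4^-1.
  by apply: expr_small.
pose N := N0.+1; pose th := 2 * q ^- N.*2.
have qN : q ^- N.*2 <= 4^-1.
  by rewrite -exprVn NP// /N -addnn; apply: leq_trans (leq_addr _ _).
have qN0 : 0 <= q ^- N.*2 by rewrite invr_ge0 exprn_ge0// ltW.
have th0 : 0 <= th by rewrite mulr_ge0.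
have th2 : th <= 2^-1 by rewrite /th; lra.
have [C C0 grow] := @growth R q q1 rl N.*2.
(* N is such that th = 2 q^(-2N) <= 1/2. *)
exists C, N, th; split; rewrite ?th0 ?th2//; first by rewrite exprVn /th; lra.
move=> j alpha beta p al0 be0; rewrite iterM.
apply: (growth_iter C0 th0 th2 (iter_Q_badditive N)) => // {}alpha {}beta {}p {}al0 {}be0.
rewrite iter_Q_word; apply: grow => //; first exact: alternate_admissible.
exact: size_alternate.
Qed.

(** The cost is mass + tau * bound, and s separates two kinds of atoms.  If the
    bound is at least s times the mass, it makes up for most of the cost and is
    contracted by the growth inequality.  Otherwise, the atom is longer than
    1/s and [long_atom] applies.  Here s is so large that the errors in tau,
    where tau s = 8 kap, are small with respect to the gain kap g. *)
Lemma contraction : exists M (kap tau lam : R),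
  [/\ (0 < M)%N, 0 <= kap < 1, 0 <= tau, 0 <= lam /\ (~~ rl -> lam = 0) &
   forall p : atom, hull val (cost 1 tau) (kap * cost 1 tau p)
     (iter M Q (aval p) - flat ((lam * total (aval p))%:C))].
Proof.
have [g [g0 g2 gP]] := twist_gap.
have [C [N [th [C0 N0 /andP[th0 th2] qth grow]]]] := growth_Q.
have C1 : 0 < 2 * C + 1 by rewrite ltr_wpDl ?mulr_ge0.
(* With this s and tau = 8 kap / s one has tau (2 C + 1) = kap g / 8: the
   relative error of the growth inequality is an eighth of the gain. *)
pose s := 64 * (2 * C + 1) / g.
have s0 : 0 < s by rewrite divr_gt0 ?mulr_gt0.
have [L LP] := two_words_uniform q1 zeta1 eta1 s0.
have [j0 j0P] : exists j0, forall n, (j0 <= n)%N -> th ^+ n <= g / 160.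
  by apply: expr_small => //; [rewrite (le_lt_trans th2)// invf_lt1 ?ltr1n|rewrite divr_gt0].
pose j := (maxn L j0).+1; pose M := (j * N)%N.
have thj : th ^+ j <= g / 160 by apply: j0P; rewrite /j leqW// leq_maxr.
have thj0 : 0 <= th ^+ j by exact: exprn_ge0.
have qthj : q^-1 ^+ M.*2 <= th ^+ j.
  rewrite /M -muln2 -mulnA muln2 mulnC exprM ler_pXn2r// nnegrE//.
  by rewrite exprn_ge0// invr_ge0 ltW.
have LM : (L <= M)%N.
  by rewrite (leq_trans _ (leq_pmulr j N0))// /j leqW// leq_maxl.
have M0 : (0 < M)%N by rewrite muln_gt0 N0.
have [d d0 dP] := LP M LM.
have L2 := Lam_gt2 q1; have L0 : 0 < Lam q by exact: lt_trans L2.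
pose D := Lam q * expR (Lam q) * expR (Lam q).
have D0 : 0 < D by exact: mulr_gt0 (mulr_gt0 L0 (expR_gt0 _)) (expR_gt0 _).
(* The second term is what [subtract_flat] allows for densities bounded below
   by d exp (- Lam) times the mass. *)
pose kap := Num.min 4^-1 (2 * d / D).
have k0 : 0 < kap by rewrite lt_min invr_gt0 ltr0n (divr_gt0 (mulr_gt0 (ltr0Sn R 1) d0) D0).
have k4 : kap <= 4^-1 by rewrite ge_min lexx.
have kd : kap * (Lam q * expR (Lam q)) * expR (Lam q) <= 2 * d.
  by rewrite -mulrA -ler_pdivlMr// ge_min lexx orbT.
clearbody kap; pose tau := 8 * kap / s.
have tau0 : 0 <= tau by exact: divr_ge0 (mulr_ge0 (ler0n R 8) (ltW k0)) (ltW s0).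
have tauE : tau * (2 * C + 1) = kap * g / 8.
  by rewrite /tau /s; field; rewrite !gt_eqF.
have taus : tau * s = 8 * kap by rewrite /tau divfK ?gt_eqF.
clearbody tau s.
have tauC : 0 <= tau * (2 * C) by rewrite !mulr_ge0.
have tau1 : tau <= kap * g / 8 by rewrite -tauE; lra.
have tauC1 : tau * (2 * C) <= kap * g / 8 by rewrite -tauE; lra.
have kg : kap * g <= 2^-1 by have := ler_pM (ltW k0) (ltW g0) k4 g2; lra.
exists M, (1 - kap * g / 2), tau, (if rl then 2 * kap else 0); split => //.
- by have := mulr_gt0 k0 g0; lra.
- by case: ifP => // _; rewrite mulr_ge0// ltW.
move=> p; set m := `|aval p|; set S := asup p.
have m0 : 0 <= m by exact: normr_ge0.
have S0 : 0 <= S by exact: asup_ge0.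
have T0 : 0 <= tau * S by rewrite mulr_ge0.
have km0 : 0 <= kap * m by rewrite mulr_ge0// ltW.
have h1 : tau * (2 * C) * m <= g * (kap * m) / 8.
  by have := ler_wpM2r m0 tauC1; lra.
have h2 : tau * S * th ^+ j <= tau * S * (g / 160) by rewrite ler_wpM2l.
have h3 : g * (kap * m) <= 2 * (kap * m) by rewrite ler_wpM2r.
have h4 : kap * m * tau <= kap * m * (g / 32).
  by rewrite ler_wpM2l//; have := ler_wpM2r (ltW g0) k4; lra.
have [short|long] := leP (s * m) S.
  have h5 : 8 * (kap * m) <= tau * S.
    by rewrite mulrA -taus -mulrA ler_wpM2l.
  have T1 := grow j 1 tau p ler01 tau0.
  have tot : (rl -> complex.Im (- ((if rl then 2 * kap else 0) * total (aval p))%:C) = 0)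
      /\ cmod (- ((if rl then 2 * kap else 0) * total (aval p))%:C) <= 2 * kap * m.
    split; first by move=> _; rewrite /= oppr0.
    rewrite normrN Rcnorm_real normrM ler_pM ?normr_ge0//.
      by case: ifP => _; rewrite ger0_norm ?mulr_ge0// ?ltW// mulr_gt0.
    by have := badditive_norm (@total_badditive R) (aval p); rewrite mul1r.
  have -> : iter M Q (aval p) - flat ((if rl then 2 * kap else 0) * total (aval p))%:C =
      iter M Q (aval p) + flat (- ((if rl then 2 * kap else 0) * total (aval p))%:C).
    by rewrite flatN.
  apply: hull_le (hullD T1 (flat_hull q1 tot.1 tau0)).
  have h6 : cmod (- ((if rl then 2 * kap else 0) * total (aval p))%:C) * (1 + tau)
      <= 2 * kap * m * (1 + tau) by rewrite ler_wpM2r ?addr_ge0// tot.2.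
  have h7 : tau * S * (kap * g) <= tau * S * 2^-1 by rewrite ler_wpM2l.
  have h8 : tau * S * g <= tau * S * 2 by rewrite ler_wpM2l.
  rewrite /cost -/m -/S; move: h6; set w := cmod _ * _ => h6.
  clear -h1 h2 h3 h4 h5 h6 h7 h8 km0 m0 S0 T0 g0 g2; nra.
have mpos : 0 < m.
  by rewrite -(ltr_pM2l s0) mulr0; apply: le_lt_trans long.
have h5 : tau * S <= 8 * (kap * m) by rewrite mulrA -taus -mulrA ler_wpM2l// ltW.
have wid : s^-1 < ab p - aa p.
  have h6 := aval_le_sup p; rewrite -/m -/S in h6.
  have w0 : 0 < ab p - aa p by rewrite subr_gt0 aab.
  rewrite -[s^-1]mul1r ltr_pdivrMr// -(ltr_pM2l mpos) mulr1.
  apply: le_lt_trans h6 _; rewrite [_ * s]mulrC mulrA [m * s]mulrC.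
  by rewrite ltr_pM2r.
have := long_atom d0 k0 tau0 C0 thj0 qthj gP kd (fun p' => grow j 1 tau p' ler01 tau0) M0
  (dP _ _ (aa0 p) (ab1 p) wid).
apply: hull_le; rewrite /cost -/m -/S.
have h6 : (2 - g) * (kap * m) * tau <= 2 * (kap * m * tau).
  rewrite -mulrA -/m; have : 0 <= g * (kap * m * tau) by rewrite !mulr_ge0// ltW.
  lra.
have h7 : tau * S * (g / 160) <= 8 * (kap * m) * (g / 160).
  by rewrite ler_wpM2r// divr_ge0// ltW.
have h8 : 0 <= (1 - kap * g / 2) * (tau * S) by rewrite mulr_ge0//; lra.
rewrite [leRHS]mulrDr [(1 - _) * (1 * m)]mulrBl.
move: h1 h2 h3 h4 h5 h6 h7 h8.
have -> : kap * g / 2 * (1 * m) = (g * (kap * m)) / 2 by ring.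
have -> : tau * th ^+ j * S = tau * S * th ^+ j by ring.
have -> : kap * m * (g / 32) = g * (kap * m) / 32 by ring.
have -> : 8 * (kap * m) * (g / 160) = g * (kap * m) / 20 by field.
have -> : (2 - g) * (kap * m) * (1 + tau) = 2 * (kap * m) - g * (kap * m) +
  (2 - g) * (kap * m) * tau by ring.
have : 0 <= g * (kap * m) by rewrite mulr_ge0// ltW.
set G := g * (kap * m); clear; lra.
Qed.

End contraction.

(** * Geometric decay along the orbits of Q *)
Section decay.
Context {R : realType}.
Variables (q : R) (zeta eta : R[i]).
Hypotheses (q1 : 1 < q) (zeta1 : cmod zeta = 1) (eta1 : cmod eta = 1).
Local Notation X := (L1 (`]0, 1[ : interval R)).
Local Open Scope complex_scope.

Let rl := (zeta == 1) && (eta == 1).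
Local Notation atom := (atom q rl).
Local Notation val := (@aval R q rl).
Local Notation Q := (Q_op q zeta eta).

Lemma hull_scale cost k r f : 0 <= k -> hull val cost r f ->
  hull val (fun p => k * cost p) (k * r) f.
Proof.
move=> k0 fr e /fr[s sr se]; exists s => //.
by rewrite -mulr_sumr ler_wpM2l.
Qed.

Lemma hull_eq0 (W : normedModType R) (K : R) (T : X -> W) cost r f :
  bounded_additive K T -> (forall p, T (val p) = 0) -> hull val cost r f -> T f = 0.
Proof.
move=> bT Tp fr; apply/eqP; rewrite -normr_le0; apply/ler_addgt0Pl => e e0.
have K0 : 0 < `|K| + 1 by rewrite ltr_wpDl.
have [s _ se] := fr _ (divr_gt0 e0 K0).
rewrite addr0 -(subrK (\sum_(p <- s) val p) f) (badditiveD bT) (badditive_sum bT).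
rewrite [X in _ + X]big1 ?addr0// (le_trans (badditive_norm bT _))//.
move: se; rewrite ler_pdivlMr// => se; apply: le_trans se.
by rewrite mulrC ler_wpM2l// (le_trans (ler_norm _))// lerDl.
Qed.

(** With weight 1, all the images of p have the phase of p, and their masses
    add up to that of p. *)
Lemma total_L_atom (p : atom) : total (L_op 1 q (aval p)) = total (aval p).
Proof.
have bt := @total_badditive R.
have c1 := @cmod1 R.
have ls := @L_op_series R q 1 q1 c1 (aval p).
have c := badditive_cvg bt ls.
have c' : (total \o (fun N => \sum_(0 <= n < N) L_branch q 1 n.+1 (aval p))) @ \oo -->
    (complex.Re (ac p) * `|aval p| : R^o).
  have ln := @L_norm_series R q 1 q1 c1 (aval p).
  have := @cvgMl_tmp R nat (nbhs \oo) eventually_filter _ (complex.Re (ac p) : R) _ ln.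
  apply: cvg_trans; apply: near_eq_cvg; apply: nearW => N /=.
  rewrite (badditive_sum bt) mulr_sumr; apply: eq_bigr => n _.
  have [[_ ->]|[p' [<- [cE _ _] _ _ _]]] := child q1 p c1 (fun=> erefl) (ltn0Sn n).
    by rewrite normr0 mulr0 (badditive0 bt).
  by rewrite total_atom cE expr1n mul1r.
by rewrite total_atom; exact: (cvg_unique _ c c').
Qed.

Lemma hull_mass_L w r f : @admissible R rl w ->
  hull val (cost 1 0) r f -> hull val (cost 1 0) r (L_op w q f).
Proof.
move=> wP; apply: (hull_map (L_op_badditive q1 wP.1)) => p.
have [C C0 /(_ 1 0 [:: w] p ler01 (lexx 0))] := @growth R q q1 rl 1.
by rewrite !mul0r addr0; apply=> // v; rewrite inE => /eqP ->.
Qed.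

Lemma total_L r f : hull val (cost 1 0) r f -> total (L_op 1 q f) = total f.
Proof.
move=> fr; apply/eqP; rewrite -subr_eq0; apply/eqP.
have bT : bounded_additive (1 + 1) (fun f => total (L_op 1 q f) + total (- f)).
  apply: bounded_additiveD.
    rewrite -[1 in X in bounded_additive X](mulr1 1).
    exact: bounded_additive_comp ler01 (L_op_badditive q1 (@cmod1 R)) (@total_badditive R).
  have bt := @total_badditive R; split=> [g h|g]; first by rewrite opprD (badditiveD bt).
  by rewrite (le_trans (badditive_norm bt _))// normrN.
rewrite -(badditiveN (@total_badditive R)).
apply: (hull_eq0 bT _ fr) => p.
by rewrite total_L_atom (badditiveN (@total_badditive R)) subrr.
Qed.

(** Along the orbit of f the correction by the total integral vanishes, so that
    the contraction concerns the iterates of Q themselves. *)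
Lemma geometric_decay f :
  (forall a b, 0 <= a -> 0 <= b -> exists r, hull val (cost a b) r f) ->
  (rl -> total f = 0) ->
  exists M (k r : R), [/\ (0 < M)%N, 0 <= k < 1 & forall K, `|iter (K * M) Q f| <= k ^+ K * r].
Proof.
move=> fhull tf; have [M [k [tau [lam [M0 k01 tau0 [lam0 lamE] con]]]]] := contraction q1 zeta1 eta1.
have /andP[k0 k1] := k01.
have [r fr] := fhull 1 tau ler01 tau0; have [r0 fr0] := fhull 1 0 ler01 (lexx 0).
exists M, k, r; split => // K.
have bT := @total_badditive R.
pose T g := iter M Q g + flat (- (lam * total g)%:C).
have bTT : bounded_additive (1 + lam) T.
  apply: bounded_additiveD; first exact: iter_Q_badditive.
  split=> [g h|g].
    by rewrite -flatD -opprD -rmorphD/= -mulrDr (badditiveD bT).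
  have rn : rl -> complex.Im (- (lam * total g)%:C) = 0 by move=> _ /=; rewrite oppr0.
  have := hull_norm _ (flat_hull q1 rn (lexx 0)).
  move=> /(_ _)/le_trans; apply.
    by move=> p; rewrite /cost mul1r mul0r addr0.
  rewrite addr0 mulr1 normrN Rcnorm_real normrM ger0_norm// ler_wpM2l//.
  by rewrite (le_trans (badditive_norm bT _))// mul1r.
have inv n : rl -> hull val (cost 1 0) r0 (iter n Q f) /\
    total (iter n Q f) = 0.
  move=> rt; elim: n => [|n [IH1 IH2]]; first by split; [|exact: tf].
  have [/eqP z1 /eqP e1] := andP rt.
  have ad : @admissible R rl 1 by split=> //; exact: cmod1.
  have h1 := hull_mass_L ad IH1.
  have -> : iter n.+1 Q f = L_op 1 q (L_op 1 q (iter n Q f)).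
    by rewrite iterS {1}/Q_op /= {1}z1 {1}e1.
  split; first exact: hull_mass_L.
  by apply: etrans (total_L h1) _; apply: etrans (total_L IH1) _.
apply: (@hull_norm _ _ _ val (cost 1 tau)).
  by move=> p; rewrite /cost mul1r lerDl mulr_ge0// asup_ge0.
elim: K => [|K IH]; first by rewrite expr0 mul1r mul0n.
have TE : iter (K.+1 * M) Q f = T (iter (K * M) Q f).
  rewrite mulSn iterD /T; suff -> : lam * total (iter (K * M) Q f) = 0.
    by rewrite oppr0 flat0 addr0.
  by have [/(inv (K * M)%N)[_ ->]|/lamE ->] := boolP rl; rewrite ?mulr0 ?mul0r.
rewrite TE exprS -mulrA.
apply: (hull_map bTT) (hull_scale k0 IH) => p.
by rewrite /T flatN; exact: con.
Qed.

Lemma cvg_orbit_sum f :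
  (forall a b, 0 <= a -> 0 <= b -> exists r, hull val (cost a b) r f) ->
  (rl -> total f = 0) -> cvgn (fun N => \sum_(j < N) iter j Q f).
Proof.
move=> fhull tf; have [M [k [r [M0 /andP[k0 k1] kP]]]] := geometric_decay fhull tf.
rewrite (_ : (fun N => _) = series (fun j => iter j Q f)); last first.
  by apply/funext => N; rewrite /series /= big_mkord.
have r0 : 0 <= r by have := le_trans (normr_ge0 _) (kP 0%N); rewrite expr0 mul1r.
have kn1 : 0 < 1 - k by rewrite subr_gt0.
have M1 : 0 <= M%:R * r by rewrite mulr_ge0.
have block K : \sum_(0 <= i < K * M) `|iter i Q f| <= M%:R * r * (1 - k ^+ K) / (1 - k).
  elim: K => [|K IH]; first by rewrite mul0n big_geq// expr0 subrr mulr0 mul0r.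
  rewrite (@big_cat_nat _ _ _ (K * M))//=; last by rewrite leq_mul2r leqnSn orbT.
  have -> : M%:R * r * (1 - k ^+ K.+1) / (1 - k) =
      M%:R * r * (1 - k ^+ K) / (1 - k) + k ^+ K * r * M%:R.
    by rewrite exprS; field; rewrite gt_eqF.
  apply: lerD => //.
  apply: (@le_trans _ _ (\sum_(K * M <= i < K.+1 * M) k ^+ K * r)).
    rewrite !big_seq; apply: ler_sum => i; rewrite mem_index_iota => /andP[Ki _].
    rewrite -(subnK Ki) iterD; apply: le_trans (kP K).
    have := badditive_norm (iter_Q_badditive q1 zeta1 eta1 (i - K * M)) (iter (K * M) Q f).
    by rewrite mul1r.
  by rewrite sumr_const_nat mulSn addnK mulr_natr.
apply: (@L1_complete_series _ _ _ (M%:R * r / (1 - k))) => N.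
apply: (@le_trans _ _ (\sum_(0 <= i < N * M) `|iter i Q f|)).
  rewrite [leRHS](@big_cat_nat _ _ _ N)//= ?leq_pmulr// lerDl.
  by apply: sumr_ge0.
apply: le_trans (block N) _; rewrite ler_wpM2r ?invr_ge0 ?(ltW kn1)//.
by rewrite ler_piMr// gerBl exprn_ge0.
Qed.

End decay.

(** * A number algebraically independent from q *)
Section transcendence.
Context {R : realType}.
Local Notation mu := (@lebesgue_measure R).

Lemma finite_roots (p : {poly R}) : p != 0 -> finite_set [set x | root p x].
Proof.
move=> p0; apply: contrapT => inf.
have [A Ap szA] := infinite_set_fset (size p) inf.
have rA : all (root p) (finmap.enum_fset A) by apply/allP => x xA; exact: Ap.
by have := max_poly_roots p0 rA (finmap.fset_uniq A); rewrite ltnNge szA.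
Qed.

Lemma countable_roots (T : countType) (f : T -> {poly R}) :
  countable [set x | exists2 t, f t != 0 & root (f t) x].
Proof.
rewrite (_ : [set _ | _] = \bigcup_(t in [set t | f t != 0]) [set x | root (f t) x]).
  apply: bigcup_countable => [|t /= ft0]; first exact: countableP.
  exact/finite_set_countable/finite_roots.
by apply/seteqP; split => [x [t t0 tx]|x [t t0 tx]]; exists t.
Qed.

Definition at_q (q : R) : {poly rat} -> R := horner_eval q \o map_poly ratr.

HB.instance Definition _ q := GRing.RMorphism.on (at_q q).

(** Evaluation of polynomials in two variables: the inner one at q, the outer
    one at y. *)
Definition at_qy (q y : R) : {poly {poly rat}} -> R := horner_eval y \o map_poly (at_q q).

HB.instance Definition _ q y := GRing.RMorphism.on (at_qy q y).

(** The numbers to be avoided are the roots of countably many nonzero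
    polynomials over the field generated by q. *)
Lemma exists_independent (q : R) : 1 < q -> ~ algebraicOver (ratr : rat -> R) q ->
  exists y, 1 < y < q /\ forall P, P != 0 -> at_qy q y P != 0.
Proof.
move=> q1 trq; pose B := [set x | exists2 P, map_poly (at_q q) P != 0 & root (map_poly (at_q q) P) x].
have cB : countable B by exact: countable_roots.
have [y [yi yB]] : exists y, (y \in `]1, q[) /\ ~ B y.
  apply: contrapT => noy.
  have sub : `]1, q[ `<=` B.
    by move=> y yi; apply: contrapT => nyB; apply: noy; exists y.
  have m0 := @countable_lebesgue_measure0 R _ (sub_countable (subset_card_le sub) cB).
  have abE := @lebesgue_measure_itv R `]1, q[.
  move: m0; rewrite [X in X = _ -> _]abE /= lte_fin q1 -EFinB => -[].
  by apply/eqP; rewrite gt_eqF// subr_gt0.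
exists y; split; first by move: yi; rewrite in_itv.
have at_q0 (p : {poly rat}) : p != 0 -> at_q q p != 0.
  by move=> p0; apply: contra_not_neq trq => pq0; exists p => //; apply/rootP.
move=> P P0; apply: contra_not_neq yB => Py; exists P; last exact/rootP.
rewrite -size_poly_gt0 size_map_poly_id0 ?size_poly_gt0//.
by rewrite at_q0// lead_coef_eq0.
Qed.

End transcendence.

(** * Orbits of the Gauss map as formal fractions *)
Section convergents.
Variables (A B : idomainType) (phi : {rmorphism A -> B}) (X : A).
Hypotheses (X0 : X != 0) (phiX : phi X = 0).
Hypothesis char0 : forall n, (0 < n)%N -> n%:R != 0 :> B.

(** The fraction r/s is sent by the branch with digit n to
    X/(r/s) - n = (X s - n r)/r.  The last digit comes first in w. *)
Fixpoint convergent (e : A) (w : seq nat) : A * A :=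
  if w is n :: w' then
    let p := convergent e w' in (X * p.2 - n%:R * p.1, p.1)
  else (e, 1).

(** For m = 0 this says that the initial point is not sent to 0. *)
Definition generic (e : A) := forall m, phi (e + m%:R) != 0.

(** Modulo X, a step only multiplies the numerator by -n. *)
Lemma phi_convergent1 e w : generic e -> all (leq 1) w -> phi (convergent e w).1 != 0.
Proof.
move=> ge; elim: w => [|n w IH] /=; first by have := ge 0%N; rewrite addr0.
move=> /andP[n0 w0]; rewrite rmorphB !rmorphM/= phiX mul0r sub0r oppr_eq0 rmorph_nat.
by rewrite mulf_neq0// ?char0// IH.
Qed.

(** If the last digits coincide, the determinant is -X times the one of the
    previous step, and one descends.  If they are n and m, distinct, it is
    congruent to (m - n) r r' modulo X, which does not vanish.  The descent ends
    with two distinct starting points, or with a starting point e against a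
    word of positive length, where the determinant is (e + m) r modulo X. *)
Lemma convergent_det e e' w w' : generic e -> generic e' ->
  all (leq 1) w -> all (leq 1) w' -> e != e' \/ size w != size w' ->
  (convergent e w).1 * (convergent e' w').2 -
  (convergent e' w').1 * (convergent e w).2 != 0.
Proof.
have phi_neq0 a : phi a != 0 -> a != 0 by apply: contra_neq => ->; rewrite rmorph0.
have base f r s m : generic f -> phi r != 0 -> f * r - (X * s - m%:R * r) * 1 != 0.
  move=> gf r0; apply: phi_neq0.
  rewrite mulr1 opprB addrC -addrA [- _ + _]addrC addrA -mulrDl rmorphB !rmorphM/=.
  by rewrite phiX mul0r subr0 mulf_neq0// addrC.
have nat_neq m n : (m < n)%N -> n%:R - m%:R != 0 :> B.
  move=> mn; have := @char0 (n - m)%N; rewrite subn_gt0 => /(_ mn).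
  by rewrite natrB// ltnW.
move=> ge ge'; elim: w w' => [|n w IH] [|m w'] /=.
- by move=> _ _ []; rewrite ?eqxx// !mulr1 subr_eq0.
- by move=> _ /andP[_ w'P] _; apply: base => //; exact: phi_convergent1.
- move=> /andP[_ wP] _ _; rewrite -oppr_eq0 opprB; apply: base => //.
  exact: phi_convergent1.
move=> /andP[n0 wP] /andP[m0 w'P] diff.
set r := (convergent e w).1; set r' := (convergent e' w').1.
set s := (convergent e w).2; set s' := (convergent e' w').2.
have r0 : phi r != 0 by exact: phi_convergent1.
have r'0 : phi r' != 0 by exact: phi_convergent1.
have [nm|nm] := eqVneq n m.
  rewrite nm (_ : _ - _ = - X * (r * s' - r' * s)); last by ring.
  by rewrite mulf_neq0 ?oppr_eq0//; apply: IH => //; move: diff; rewrite eqSS.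
apply: phi_neq0.
have -> : phi ((X * s - n%:R * r) * r' - (X * s' - m%:R * r') * r) =
    (m%:R - n%:R) * (phi r * phi r').
  by rewrite !(rmorphB, rmorphM)/= phiX !rmorph_nat; ring.
rewrite !mulf_neq0//; move: nm; rewrite neq_ltn => /orP[/nat_neq//|/nat_neq].
by rewrite -oppr_eq0 opprB.
Qed.

End convergents.

Section orbits.
Context {R : realType}.
Variables (q y : R).
Hypotheses (q1 : 1 < q) (y1 : 1 < y) (yq : y < q).
Hypothesis indep : forall P, P != 0 -> at_qy q y P != 0.
Let q0 : 0 < q. Proof. exact: lt_trans q1. Qed.

Local Notation A := {poly {poly rat}}.
Local Notation psi := (at_qy q y).

(** Specialisation of the inner variable, which stands for q, at 0. *)
Definition at_0 : A -> {poly rat} := map_poly (horner_eval (0 : rat)).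

HB.instance Definition _ := GRing.RMorphism.on at_0.

Let XA : A := ('X)%:P.

Let XA0 : XA != 0. Proof. by rewrite polyC_eq0 polyX_eq0. Qed.

Let at_0X : at_0 XA = 0.
Proof. by rewrite /at_0 map_polyC/= /horner_eval hornerX. Qed.

Let char0 n : (0 < n)%N -> n%:R != 0 :> {poly rat}.
Proof. by move=> n0; rewrite -polyC_natr polyC_eq0 pnatr_eq0 -lt0n. Qed.

Let psiX : psi XA = q.
Proof. by rewrite /at_qy /at_q /= map_polyC/= /horner_eval hornerC map_polyX hornerX. Qed.

Let psiY : psi 'X = y.
Proof. by rewrite /at_qy /= map_polyX /horner_eval hornerX. Qed.

(** The orbits of interest start at y and at its fractional part y - floor y. *)
Definition start (n : nat) : A := 'X - n%:R.

Lemma psi_start n : psi (start n) = y - n%:R.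
Proof. by rewrite /start rmorphB/= psiY rmorph_nat. Qed.

Lemma start_generic n : generic [the {rmorphism A -> {poly rat}} of at_0] (start n).
Proof.
move=> m; rewrite /start /= !(rmorphD, rmorphN)/= !rmorph_nat /at_0 map_polyX.
rewrite -addrA -!polyC_natr -polyCN -polyCD; apply/eqP => /(congr1 (fun p : {poly rat} => p`_1)).
by rewrite coefD coefX coefC coef0 addr0 => /eqP; rewrite oner_eq0.
Qed.

(** As the numerator is not the zero polynomial, independence ensures that the
    orbit never meets 0; its points are interior to the branch domains. *)
Lemma orbit_convergent n : 0 < psi (start n) < q -> forall k, exists w,
  [/\ size w = k, all (leq 1) w, psi (convergent XA (start n) w).2 != 0,
    iter k (gauss q) (psi (start n)) =
      psi (convergent XA (start n) w).1 / psi (convergent XA (start n) w).2 &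
    0 < iter k (gauss q) (psi (start n)) < (if k is 0 then q else 1)].
Proof.
move=> /andP[x0 xq]; elim=> [|k [w [wk wP s0 xE x01]]].
  by exists [::]; split; rewrite //= ?rmorph1 ?oner_eq0 ?divr1 ?x0.
set x := iter k _ _ in xE x01 *.
have xlq : x < q by case/andP: x01 => _ h; apply: lt_le_trans h _; case: (k) => // _; exact: ltW.
have x0' : 0 < x by case/andP: x01.
pose m := Num.truncn (q / x).
have /andP[mx xm] : m%:R <= q / x < m.+1%:R by apply: truncn_itv; rewrite divr_ge0 ?ltW.
have m0 : (0 < m)%N by rewrite truncn_gt0 ler_pdivlMr// mul1r ltW.
have r0 : psi (convergent XA (start n) w).1 != 0.
  apply: indep; have := phi_convergent1 at_0X char0 (@start_generic n) wP.
  by apply: contra_neq => ->; rewrite rmorph0.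
have wP' : all (leq 1) (m :: w) by rewrite /= m0.
have gE : gauss q x = psi (convergent XA (start n) (m :: w)).1 /
    psi (convergent XA (start n) (m :: w)).2.
  rewrite /gauss -/m xE /= !(rmorphB, rmorphM)/= psiX rmorph_nat.
  by field; rewrite s0 r0.
have g0 : gauss q x != 0.
  rewrite gE mulf_neq0// ?invr_eq0//; apply: indep.
  have := phi_convergent1 at_0X char0 (@start_generic n) wP'.
  by apply: contra_neq => ->; rewrite rmorph0.
exists (m :: w); split => //=; first by rewrite wk.
by rewrite lt_neqAle eq_sym g0 /gauss -/m subr_ge0 mx ltrBlDl natr1.
Qed.

Lemma orbit_distinct n m k l : 0 < psi (start n) < q -> 0 < psi (start m) < q ->
  n != m \/ k != l ->
  iter k (gauss q) (psi (start n)) != iter l (gauss q) (psi (start m)).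
Proof.
move=> nP mP nmkl.
have [w [wk wP s0 -> _]] := orbit_convergent nP k.
have [w' [wk' wP' s0' -> _]] := orbit_convergent mP l.
have diff : start n != start m \/ size w != size w'.
  case: nmkl => [nm|kl]; [left|by right; rewrite wk wk'].
  apply: contra_neq nm => /(congr1 psi); rewrite !psi_start => /addrI/oppr_inj/eqP.
  by rewrite eqr_nat => /eqP.
have det0 := convergent_det XA0 at_0X char0 (start_generic n) (start_generic m) wP wP' diff.
move: (indep det0); apply: contra_neq => /eqP; rewrite eqr_div// => /eqP E.
by rewrite rmorphB !rmorphM/= E subrr.
Qed.

End orbits.

(** * Concentration of a family of functions at a point *)
Section concentration.
Context {R : realType}.
Variables (q : R) (q1 : 1 < q).
Local Notation mu := (@lebesgue_measure R).
Local Notation X := (L1 (`]0, 1[ : interval R)).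
Local Notation Y := (L1 (`]1, q[ : interval R)).
Let q0 : 0 < q. Proof. exact: lt_trans q1. Qed.
Implicit Types (w c : R[i]) (a b s : R) (rho : R -> R).

Lemma itv_sub1q a b : 1 <= a -> b <= q -> forall x, a < x < b -> x \in `]1, q[.
Proof.
move=> a1 bq x /andP[ax xb]; rewrite in_itv/= (le_lt_trans a1 ax).
exact: lt_le_trans bq.
Qed.

Section shift.
Variables (w : R[i]) (n : nat) (c : R[i]) (a b s : R) (rho : R -> R).
Hypotheses (w1 : cmod w = 1) (n0 : (0 < n)%N) (dr : density a b rho s).
Hypotheses (a1 : 1 <= a) (bq : b <= q) (na : n%:R <= a) (bn : b <= n.+1%:R).
Local Notation f := (bump `]1, q[ c a b rho).

Lemma S_branch_bump0 m : m != n.-1 -> S_branch w m.+1 f = 0.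
Proof.
move=> mn; have sub := itv_sub1q a1 bq.
apply: (@branch_op_bump0 _ `]1, q[ `]0, 1[ _ _ _ _ c a b rho s
  (shift_branch m.+1) (cmodX_1 _ w1) dr sub).
move=> x; rewrite in_itv/= => /andP[x0 x1]; apply/negP => /andP[h3 h4].
suff mn' : m.+1 = n by move: mn; rewrite -mn' eqxx.
apply: (@shift_disjoint R m.+1 n); exists (x + m.+1%:R); split; rewrite /= in_itv/=.
  by rewrite lerDr ltW//= -[m.+2%:R]natr1 addrC ltrD2l.
by rewrite (le_trans na (ltW h3)) (lt_le_trans h4 bn).
Qed.

Lemma S_op_single : S_op w f = S_branch w n f.
Proof.
have ls := @S_op_series R q w w1 f.
rewrite (@cvg_one_term _ _ (fun m => S_branch w m.+1 f) _ n.-1 S_branch_bump0 ls).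
by rewrite prednK.
Qed.

Lemma S_op_single_norm : `|S_op w f| = `|f|.
Proof.
rewrite S_op_single.
have ls : (fun N => \sum_(0 <= m < N) `|S_branch w m.+1 f|) @ \oo --> `|f|.
  apply: (transfer_norm_series (fun m _ => @shift_branch R m) (fun m => cmodX_1 m w1)).
    by move=> m k _ _; exact: shift_disjoint.
  by move=> x; exact: shift_cover.
rewrite [RHS](@cvg_one_term _ R^o (fun m => `|S_branch w m.+1 f|) _ n.-1 _ ls).
  by rewrite prednK.
by move=> m /S_branch_bump0 ->; rewrite normr0.
Qed.

Lemma S_op_bump_single : S_op w f = bump `]0, 1[ (w ^+ n * c) (a - n%:R) (b - n%:R)
  (fun x => 1 * rho (x + n%:R)).
Proof.
rewrite S_op_single.
apply: (branch_op_bump _ (shift_branch n) (cmodX_1 n w1) dr (itv_sub1q a1 bq)) => x _.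
by rewrite ltrBlDr ltrBrDr.
Qed.

Lemma S_density : density (a - n%:R) (b - n%:R) (fun x => 1 * rho (x + n%:R)) s.
Proof.
have [mr r0 rs] := dr; split.
- apply: measurable_funM => //; apply: (measurableT_comp mr).
  exact: measurable_funD.
- by move=> x; rewrite mul1r.
- by move=> x; rewrite ltrBlDr ltrBrDr mul1r; exact: rs.
Qed.

End shift.

Section inversion.
Variables (c : R[i]) (a b s : R) (rho : R -> R).
Hypotheses (dr : density a b rho s) (a1 : 1 <= a) (bq : b <= q) (ab : a < b).
Local Notation f := (bump `]1, q[ c a b rho).

Lemma J_op_bump : J_op f = bump `]1, q[ (1 * c) (q / b) (q / a)
  (fun x => q / x ^+ 2 * rho (q / x)).
Proof.
have a0 : 0 < a by exact: lt_le_trans a1.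
have b0 : 0 < b by exact: lt_trans ab.
rewrite J_opE.
apply: (branch_op_bump _ (inversion_branch q1) (@cmod1 R) dr (itv_sub1q a1 bq)) => x.
rewrite in_itv/= => /andP[x1 xq]; have x0 := lt_trans ltr01 x1.
have -> : (q / x < b) = (q / b < x) by rewrite ltr_pdivrMr// mulrC -ltr_pdivrMr.
by rewrite andbC; congr (_ && _); rewrite ltr_pdivlMr// mulrC -ltr_pdivlMr.
Qed.

Lemma J_density : density (q / b) (q / a) (fun x => q / x ^+ 2 * rho (q / x)) (q * s).
Proof.
have a0 : 0 < a by exact: lt_le_trans a1.
have b0 : 0 < b by exact: lt_trans ab.
have [mr r0 rs] := dr; split.
- apply: measurable_funM; first by apply: measurable_divl; exact: exprn_measurable.
  by apply: (measurableT_comp mr); exact: measurable_divl.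
- by move=> x; rewrite mulr_ge0// divr_ge0 ?sqr_ge0// ltW.
- move=> x /andP[bx xa]; have x0 : 0 < x by apply: lt_trans bx; rewrite divr_gt0.
  apply: ler_pM => //; first by rewrite divr_ge0 ?sqr_ge0// ltW.
    rewrite ler_pdivrMr ?exprn_gt0// ler_peMr ?(ltW q0)// exprn_ege1//.
    by apply: le_trans (ltW bx); rewrite ler_pdivlMr// mul1r.
  apply: rs; rewrite ltr_pdivlMr// mulrC -ltr_pdivlMr// xa/=.
  by rewrite ltr_pdivrMr// mulrC -ltr_pdivrMr.
Qed.

End inversion.

(** The inversion maps (1, q) onto itself, so that no part of f is lost. *)
Lemma J_op_isometry (f : Y) : `|J_op f| = `|f|.
Proof.
apply: EFin_inj; rewrite J_opE (branch_op_norm (inversion_branch q1) (@cmod1 R)).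
by rewrite L1_norm_extend0.
Qed.

Definition concentrates i (m : R) (f : R -> L1 i) (x : R) :=
  forall l r, l < x < r -> exists2 e0, 0 < e0 & forall e, 0 < e < e0 ->
    `|f e| = m /\ exists c a b rho s,
    [/\ density a b rho s, l <= a, a < b, b <= r & f e = bump i c a b rho].

Lemma bumpN i c a b rho s : density a b rho s -> (forall x, a < x < b -> x \in i) ->
  bump i (- c) a b rho = - bump i c a b rho.
Proof.
move=> dr abi; apply: (addrI (bump i c a b rho)); rewrite subrr /bump.
rewrite -L1_classD; [|exact: bump_cintegrable dr abi|exact: bump_cintegrable dr abi].
rewrite -(L1_class0 i); congr L1_class; apply/funext => x.
rewrite [LHS](_ : _ = bump_fun c a b rho x + bump_fun (- c) a b rho x)// /bump_fun.
by case: ifP => _; rewrite ?addr0// mulNr subrr.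
Qed.

Lemma concentrates_N m (f : R -> X) x : 0 < x < 1 -> concentrates m f x ->
  concentrates m (fun e => - f e) x.
Proof.
move=> /andP[x0 x1] fx l r /andP[lx xr].
have [|e0 e00 fe] := fx (Num.max 0 l) (Num.min 1 r); first by rewrite gt_max lt_min x0 x1 lx.
exists e0 => // e /fe[fm [c [a [b [rho [s [dr]]]]]]].
rewrite ge_max le_min => /andP[a0 la] ab /andP[b1 br] fE.
rewrite normrN fm; split=> //; exists (- c), a, b, rho, s; split => //.
by rewrite fE (bumpN c dr (itv_sub01 a0 b1)).
Qed.

(** If T x is not 0, a neighbourhood of x lies within one branch domain, and the
    branch is monotone and continuous there. *)
Lemma concentrates_L w m (f : R -> X) x : cmod w = 1 -> 0 < x < 1 -> 0 < gauss q x ->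
  concentrates m f x -> concentrates m (L_op w q \o f) (gauss q x).
Proof.
move=> w1 /andP[x0 x1] g0 fx l' r' /andP[lx xr].
pose n := Num.truncn (q / x).
have /andP[nx xn] : n%:R <= q / x < n.+1%:R by apply: truncn_itv; rewrite divr_ge0 ?ltW.
have qx : 1 <= q / x by rewrite ler_pdivlMr// mul1r ltW// (lt_trans x1).
have n0 : (0 < n)%N by rewrite truncn_gt0.
have n0' : 0 < n%:R :> R by rewrite ltr0n.
have xE : q / x = n%:R + gauss q x by rewrite /gauss -/n addrC subrK.
pose l := Num.max 0 l'; pose r := Num.min 1 r'.
have l0 : 0 <= l by rewrite le_max lexx.
have r1 : r <= 1 by rewrite ge_min lexx.
have lg : l < gauss q x by rewrite gt_max g0 lx.
have gr : gauss q x < r by rewrite lt_min xr andbT /gauss -/n ltrBlDl natr1.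
have nl0 : 0 < n%:R + l by rewrite ltr_wpDr.
have nr0 : 0 < n%:R + r by rewrite addr_gt0// (lt_trans g0).
have [|e0 e00 fe] := fx (q / (n%:R + r)) (Num.min 1 (q / (n%:R + l))).
  rewrite lt_min x1/= ltr_pdivrMr// mulrC -ltr_pdivrMr// xE ltrD2l gr/=.
  by rewrite ltr_pdivlMr// mulrC -ltr_pdivlMr// xE ltrD2l.
exists e0 => // e /fe[fm [c [a [b [rho [s [dr la ab]]]]]]].
rewrite le_min => /andP[b1 bl] fE.
have na : q / n.+1%:R <= a.
  by apply: le_trans la; rewrite ler_pM2l// lef_pV2 ?posrE ?ltr0n// -natr1 lerD2l.
have bn : b <= q / n%:R.
  by apply: (le_trans bl); rewrite ler_pM2l// lef_pV2 ?posrE// lerDl.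
have a0 : 0 < a by apply: lt_le_trans la; rewrite divr_gt0.
have b0 := lt_trans a0 ab.
rewrite /= fE (L_op_single_norm q1 c w1 n0 dr b1 na bn) -fE; split => //.
exists (w ^+ n * c), (q / b - n%:R), (q / a - n%:R),
  (fun x => gpsi q n x * rho (gphi q n x)), (q * s); split.
- have [mr rho0 rs] := dr; split.
  + apply: measurable_funM; first exact: branch_psi (gphi_branch q1 n0).
    by apply: (measurableT_comp mr); exact: branch_phi (gphi_branch q1 n0).
  + by move=> z; rewrite mulr_ge0// (branch_ge0 (gphi_branch q1 n0)).
  + move=> z /andP[bz za]; rewrite ltrBlDl in bz; rewrite ltrBrDl in za.
    have nz1 : 1 <= n%:R + z.
      apply: le_trans (ltW bz); rewrite ler_pdivlMr// mul1r.
      by rewrite (le_trans b1) ?ltW.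
    have nz0 := lt_le_trans ltr01 nz1.
    apply: ler_pM => //; first exact: (branch_ge0 (gphi_branch q1 n0)).
      by rewrite /gpsi ler_pdivrMr ?exprn_gt0// ler_peMr ?(ltW q0)// exprn_ege1.
    apply: rs; rewrite /gphi ltr_pdivlMr// mulrC -ltr_pdivlMr// za/=.
    by rewrite ltr_pdivrMr// mulrC -ltr_pdivrMr.
- apply: (@le_trans _ _ l); first by rewrite le_max lexx orbT.
  by rewrite lerBrDl ler_pdivlMr// mulrC -ler_pdivlMr.
- by rewrite ltrD2r ltr_pM2l// ltf_pV2.
- apply: (@le_trans _ _ r); last by rewrite ge_min lexx orbT.
  by rewrite lerBlDl ler_pdivrMr// mulrC -ler_pdivrMr.
- by rewrite fE (L_op_bump_single q1 c w1 n0 dr b1 ab na bn).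
Qed.

Definition frac (x : R) : R := x - (Num.truncn x)%:R.

Lemma concentrates_S w (m : R) (f : R -> Y) (x : R) : cmod w = 1 -> 1 < x < q -> 0 < frac x ->
  concentrates m f x -> concentrates m (fun e => S_op w (f e)) (frac x).
Proof.
move=> w1 /andP[x1 xq] g0 fx l' r' /andP[lx xr].
have x0 := lt_trans ltr01 x1; pose n := Num.truncn x.
have /andP[nx xn] : n%:R <= x < n.+1%:R by apply: truncn_itv; exact: ltW.
have n0 : (0 < n)%N by rewrite truncn_gt0 ltW.
have xE : x = n%:R + frac x by rewrite /frac -/n addrC subrK.
pose l := Num.max 0 l'; pose r := Num.min 1 r'.
have l0 : 0 <= l by rewrite le_max lexx.
have r1 : r <= 1 by rewrite ge_min lexx.
have lg : l < frac x by rewrite gt_max g0 lx.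
have gr : frac x < r by rewrite lt_min xr andbT /frac -/n ltrBlDl natr1.
have [|e0 e00 fe] := fx (n%:R + l) (Num.min q (n%:R + r)).
  by rewrite lt_min xq/= {1}xE ltrD2l lg/= [X in X < _]xE ltrD2l.
exists e0 => // e /fe[fm [c [a [b [rho [s [dr la ab]]]]]]].
rewrite le_min => /andP[bq br] fE.
have na : n%:R <= a by apply: le_trans la; rewrite lerDl.
have a1 : 1 <= a by apply: le_trans na; rewrite ler1n.
have bn : b <= n.+1%:R by apply: (le_trans br); rewrite -natr1 lerD2l.
rewrite /= fE (S_op_single_norm c w1 n0 dr a1 bq na bn) -fE; split => //.
exists (w ^+ n * c), (a - n%:R), (b - n%:R), (fun x => 1 * rho (x + n%:R)), s; split.
- exact: S_density.
- by rewrite lerBrDl; apply: le_trans la; rewrite lerD2l le_max lexx orbT.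
- by rewrite ltrD2r.
- by rewrite lerBlDl; apply: le_trans br _; rewrite lerD2l ge_min lexx orbT.
- by rewrite fE (S_op_bump_single c w1 n0 dr a1 bq na bn).
Qed.

Lemma concentrates_J m (f : R -> Y) x : 1 < x < q ->
  concentrates m f x -> concentrates m (@J_op R q \o f) (q / x).
Proof.
move=> /andP[x1 xq] fx l r /andP[lx xr].
have x0 := lt_trans ltr01 x1; have qx0 : 0 < q / x by rewrite divr_gt0.
have r0 := lt_trans qx0 xr.
pose l' := Num.max 1 (q / r); pose r' := if 0 < l then Num.min q (q / l) else q.
have [|e0 e00 fe] := fx l' r'.
  rewrite gt_max x1/= ltr_pdivrMr// mulrC -ltr_pdivrMr// xr/= /r'; case: ifPn => // l0.
  by rewrite lt_min xq/= ltr_pdivlMr// mulrC -ltr_pdivlMr.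
exists e0 => // e /fe[fm [c [a [b [rho [s [dr]]]]]]].
rewrite ge_max => /andP[a1 qra] ab br fE.
have bq : b <= q by apply: (le_trans br); rewrite /r'; case: ifP => //; rewrite ge_min lexx.
have a0 : 0 < a by exact: lt_le_trans a1.
have b0 := lt_trans a0 ab.
rewrite /= J_op_isometry; split => //.
exists (1 * c), (q / b), (q / a), (fun x => q / x ^+ 2 * rho (q / x)), (q * s); split.
- exact: J_density.
- have [l0|l0] := ltP 0 l; last by apply: (le_trans l0); rewrite divr_ge0 ?ltW.
  rewrite ler_pdivlMr// mulrC -ler_pdivlMr//; apply: le_trans br _.
  by rewrite /r' l0 ge_min lexx orbT.
- by rewrite ltr_pM2l// ltf_pV2.
- by rewrite ler_pdivrMr// mulrC -ler_pdivrMr.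
- by rewrite fE (J_op_bump c dr).
Qed.

(** The height is normalised so that the norm is m for all e. *)
Definition spike (y m e : R) : Y := bump `]1, q[ 1 (y - e) (y + e) (fun=> m / (2 * e)).

Lemma spike_density (y m e : R) : 0 <= m -> 0 < e ->
  density (y - e) (y + e) (fun=> m / (2 * e)) (m / (2 * e)).
Proof.
by move=> m0 e0; split => // x; rewrite divr_ge0// mulr_ge0// ltW.
Qed.

Lemma concentrates_spike y m : 0 <= m -> 1 < y < q -> concentrates m (spike y m) y.
Proof.
move=> m0 /andP[y1 yq] l r /andP[ly yr].
pose e0 := Num.min (Num.min (y - 1) (q - y)) (Num.min (y - l) (r - y)).
exists e0; first by rewrite !lt_min !subr_gt0 y1 yq ly.
move=> e /andP[e00]; rewrite !lt_min => /andP[/andP[ey1 eqy] /andP[eyl ery]].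
have dr := spike_density y m0 e00.
split.
  have abi : forall x, y - e < x < y + e -> x \in `]1, q[.
    by apply: itv_sub1q; lra.
  rewrite /spike (bump_norm dr abi (@cmod1 R)) Rintegral_itv_cst; last by lra.
  by field; rewrite gt_eqF.
exists 1, (y - e), (y + e), (fun=> m / (2 * e)), (m / (2 * e)); split => //; lra.
Qed.

Lemma concentrates_uniform m (I : eqType) (s : seq I) (F : I -> R -> X) (x : I -> R)
    (l r : I -> R) :
  (forall k, k \in s -> concentrates m (F k) (x k)) ->
  (forall k, k \in s -> l k < x k < r k) ->
  exists2 e0, 0 < e0 & forall e, 0 < e < e0 -> forall k, k \in s ->
    `|F k e| = m /\ exists c a b rho t,
    [/\ density a b rho t, l k <= a, a < b, b <= r k & F k e = bump `]0, 1[ c a b rho].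
Proof.
elim: s => [|k s IH] cs ls; first by exists 1.
have [j js|j js|e0 e00 e0P] := IH.
- by apply: cs; rewrite inE js orbT.
- by apply: ls; rewrite inE js orbT.
have [e1 e10 e1P] := cs k (mem_head _ _) _ _ (ls k (mem_head _ _)).
exists (Num.min e0 e1); first by rewrite lt_min e00.
move=> e /andP[e_gt0]; rewrite lt_min => /andP[ee0 ee1] j.
rewrite inE => /predU1P[->|js]; first by apply: e1P; rewrite e_gt0.
by apply: e0P => //; rewrite e_gt0.
Qed.

(** For small e, the bumps sit in disjoint neighbourhoods of the points x k. *)
Lemma concentrates_sum m (I : eqType) (s : seq I) (F : I -> R -> X) (x : I -> R) :
  uniq s -> (forall k, k \in s -> concentrates m (F k) (x k)) ->
  (forall k, k \in s -> 0 < x k < 1) ->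
  (forall k j, k \in s -> j \in s -> k != j -> x k != x j) ->
  exists2 e0, 0 < e0 & forall e, 0 < e < e0 ->
    `|\sum_(k <- s) F k e| = m * (size s)%:R.
Proof.
move=> us cs x01 xinj.
have [d d0 dP] := seq_gap [seq x k - x j | k <- s, j <- s].
have d30 : 0 < d / 3 by rewrite divr_gt0.
pose l k := Num.max 0 (x k - d / 3); pose r k := Num.min 1 (x k + d / 3).
have [k ks|e0 e00 e0P] := concentrates_uniform (l := l) (r := r) cs.
  have /andP[h0 h1] := x01 k ks.
  by rewrite gt_max lt_min h0 h1 ltrBlDr !ltrDl d30.
exists e0 => // e /e0P {}e0P.
have /choice[h hP] k : exists h : R -> Rcomplex R, k \in s ->
    [/\ h \in cintegrable (`]0, 1[ : interval R), F k e = L1_class _ h &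
        forall t, h t != 0 -> x k - d / 3 < t < x k + d / 3].
  have [ks|nks] := boolP (k \in s); last by exists 0.
  have [_ [c [a [b [rho [t [dr]]]]]]] := e0P k ks.
  rewrite ge_max le_min => /andP[a0 la] ab /andP[b1 br] FE.
  exists (bump_fun c a b rho) => _; split => //.
    exact: bump_cintegrable dr (itv_sub01 a0 b1).
  move=> z; rewrite /bump_fun; case: ifP => [/andP[az zb] _|_]; last by rewrite eqxx.
  by rewrite (le_lt_trans la az) (lt_le_trans zb br).
rewrite big_seq (eq_bigr (fun k => L1_class `]0, 1[ (h k))); last by move=> k /hP[].
rewrite -big_seq L1_norm_sum_disjoint//; first last.
- move=> k j t ks js kj; have [_ _ hk] := hP k ks; have [_ _ hj] := hP j js.
  have [->|/hk /andP[k1 k2]] := eqVneq (h k t) 0; first by left.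
  have [->|/hj /andP[j1 j2]] := eqVneq (h j t) 0; first by right.
  have := xinj k j ks js kj; rewrite neq_lt => /orP[xkj|xkj]; exfalso.
    have := dP (x j - x k); rewrite subr_gt0 xkj => /(_ _ isT).
    by rewrite leNgt => /(_ _)/negP; apply; [apply/allpairsP; exists (j, k)|lra].
  have := dP (x k - x j); rewrite subr_gt0 xkj => /(_ _ isT).
  by rewrite leNgt => /(_ _)/negP; apply; [apply/allpairsP; exists (k, j)|lra].
- by move=> k /hP[].
rewrite big_seq (eq_bigr (fun=> m)); last first.
  by move=> k ks; have [_ <- _] := hP k ks; have [] := e0P k ks.
by rewrite -big_seq big_const_seq count_predT iter_addr_0 mulr_natr.
Qed.

End concentration.

(** * Spikes at a point independent from q *)
Section spikes.
Context {R : realType}.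
Variables (q y : R) (zeta eta : R[i]).
Hypotheses (q1 : 1 < q) (y1 : 1 < y) (yq : y < q).
Hypothesis indep : forall P, P != 0 -> at_qy q y P != 0.
Hypotheses (zeta1 : cmod zeta = 1) (eta1 : cmod eta = 1).
Local Notation X := (L1 (`]0, 1[ : interval R)).
Local Notation Y := (L1 (`]1, q[ : interval R)).
Local Notation Q := (Q_op q zeta eta).
Let q0 : 0 < q. Proof. exact: lt_trans q1. Qed.
Let y0 : 0 < y. Proof. exact: lt_trans y1. Qed.

Let yE : y = at_qy q y (start 0).
Proof. by rewrite psi_start subr0. Qed.

Let fracE : frac y = at_qy q y (start (Num.truncn y)).
Proof. by rewrite psi_start. Qed.

Lemma frac_bounds : 0 < frac y < 1.
Proof.
have /andP[ny yn] : (Num.truncn y)%:R <= y < (Num.truncn y).+1%:R.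
  by apply: truncn_itv; exact: ltW.
rewrite {2}/frac ltrBlDl natr1 yn andbT lt_neqAle eq_sym /frac subr_ge0 ny andbT.
rewrite -/(frac y) fracE; apply: indep.
by rewrite /start subr_eq0; apply/eqP => /(congr1 (fun p : {poly {poly rat}} => size p));
  rewrite size_polyX -polyC_natr size_polyC; case: (_ != 0).
Qed.

Lemma orbit_bounds k : 0 < iter k (gauss q) (frac y) < 1 /\ 0 < iter k.+1 (gauss q) y < 1.
Proof.
split; last first.
  rewrite yE; have [|w [_ _ _ _]] := orbit_convergent q1 indep (n := 0%N) _ k.+1.
    by rewrite -yE y0 yq.
  by [].
have fb := frac_bounds; case: k => [//|k].
rewrite fracE; have [|w [_ _ _ _]] := orbit_convergent q1 indep (n := Num.truncn y) _ k.+1.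
  by rewrite -fracE; case/andP: fb => -> /lt_trans; apply.
by [].
Qed.

(** The points where Q^j applied to the two terms of A v concentrates: those of
    S v for [false] and those of L S J v for [true]. *)
Definition orbit_point (k : nat * bool) : R :=
  iter k.1.*2 (gauss q) (if k.2 then gauss q (gauss q y) else frac y).

Lemma orbit_point_bounds k : 0 < orbit_point k < 1.
Proof.
case: k => j [] /=; rewrite /orbit_point /=; last exact: (orbit_bounds _).1.
by rewrite -!iterSr; exact: (orbit_bounds _).2.
Qed.

(** The second family starts two steps further on the orbit of y itself, and
    the first one is on the orbit of the fractional part of y: the starting
    points are formally distinct, or else the numbers of steps differ. *)
Lemma orbit_point_inj : injective orbit_point.
Proof.
have fb := frac_bounds.
have sP : 0 < at_qy q y (start 0) < q by rewrite -yE y0 yq.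
have fP : 0 < at_qy q y (start (Num.truncn y)) < q.
  by rewrite -fracE; case/andP: fb => -> /lt_trans; apply.
have n0 : (0 < Num.truncn y)%N by rewrite truncn_gt0 ltW.
have E j (b : bool) : orbit_point (j, b) = iter (j + b).*2 (gauss q)
    (at_qy q y (start (if b then 0%N else Num.truncn y))).
  rewrite /orbit_point /=; case: b => /=.
    by rewrite -yE -!iterSr addn1.
  by rewrite addn0 fracE.
case=> j b [l d] /eqP; rewrite !E => /eqP eq_pt; apply/eqP; apply: contraTT isT => jl.
suff : (if b then 0%N else Num.truncn y) != (if d then 0%N else Num.truncn y) \/
    (j + b).*2 != (l + d).*2.
  have bP (c : bool) : 0 < at_qy q y (start (if c then 0%N else Num.truncn y)) < q.
    by case: c.
  by move=> /(orbit_distinct q1 indep (bP b) (bP d)); rewrite eq_pt eqxx.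
have [bd|bd] := eqVneq b d; last first.
  have tn : Num.truncn y != 0%N by rewrite -lt0n.
  by left; clear -bd tn; case: b d bd => [] [] //= _; rewrite eq_sym.
right; move: jl; rewrite bd; apply: contra_neq => /double_inj/addIn ->.
by [].
Qed.

Lemma concentrates_iter m (f : R -> X) x j : (forall k, 0 < iter k (gauss q) x < 1) ->
  concentrates m f x -> concentrates m (fun e => iter j Q (f e)) (iter j.*2 (gauss q) x).
Proof.
move=> x01 fx; elim: j => [//|j IH].
have x1 := x01 j.*2; have /andP[x2 x2'] := x01 j.*2.+1; have /andP[x3 _] := x01 j.*2.+2.
apply: (concentrates_L q1 zeta1 _ x3); first by apply/andP; split.
exact: (concentrates_L q1 eta1 x1 x2).
Qed.

Lemma green_sum_spike N r : 0 <= r -> exists2 e0, 0 < e0 & forall e, 0 < e < e0 ->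
  `|spike q y r e| = r /\ `|green_sum q zeta eta N (spike q y r e)| = 2 * N%:R * r.
Proof.
move=> r0; have y1q : 1 < y < q by rewrite y1.
pose F (k : nat * bool) e : X := iter k.1 Q
  (if k.2 then L_op zeta q (S_op eta (J_op (spike q y r e))) else - S_op zeta (spike q y r e)).
have sc := concentrates_spike r0 y1q.
have [e1 e10 e1P] := sc 1 q y1q.
have FC k : concentrates r (F k) (orbit_point k).
  case: k => j [].
    have b2 := (orbit_bounds 1).2; have /andP[b1 b1'] := (orbit_bounds 0).2.
    apply: (@concentrates_iter r (fun e => L_op zeta q (S_op eta (J_op (spike q y r e))))).
      by move=> k; rewrite -!iterSr; exact: (orbit_bounds _).2.
    have /andP[b20 _] := b2.
    apply: (concentrates_L q1 zeta1 _ b20); first by apply/andP; split.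
    have qy : 1 < q / y < q.
      by rewrite ltr_pdivlMr// mul1r yq ltr_pdivrMr// ltr_pMr.
    exact: (concentrates_S eta1 qy b1 (concentrates_J q1 y1q sc)).
  apply: (@concentrates_iter r (fun e => - S_op zeta (spike q y r e))).
    by move=> k; exact: (orbit_bounds _).1.
  have /andP[fb _] := frac_bounds.
  exact: concentrates_N frac_bounds (concentrates_S zeta1 y1q fb sc).
pose s := [seq (j, b) | j <- iota 0 N, b <- [:: false; true]].
have us : uniq s by apply: allpairs_uniq => //; [exact: iota_uniq|move=> [? ?] [? ?]].
have [||//|e0 e00 e0P] := @concentrates_sum R r _ s F orbit_point us.
- by move=> k _; exact: FC.
- by move=> k _; exact: orbit_point_bounds.
- by move=> k j _ _; apply: contra_neq; exact: orbit_point_inj.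
exists (Num.min e0 e1); first by rewrite lt_min e00.
move=> e /andP[egt0]; rewrite lt_min => /andP[ee0 ee1].
have [->  _] := e1P e (introT andP (conj egt0 ee1)); split=> //.
have := e0P e (introT andP (conj egt0 ee0)).
rewrite size_allpairs size_iota /= natrM => sE.
rewrite -[RHS]mulrC -[2 * _]mulrC -sE; congr `|_|; rewrite /s big_allpairs_dep.
rewrite /green_sum -(big_mkord xpredT (fun j => iter j Q (A_op q zeta eta (spike q y r e)))).
rewrite /index_iota subn0; apply: eq_bigr => j _.
rewrite big_cons big_seq1 /F /=.
by rewrite -(badditiveD (iter_Q_badditive q1 zeta1 eta1 j)).
Qed.

(** For small e, S v and S J v are atoms.  When zeta = eta = 1, they have the
    same mass, so that the total integral of A v = - S v + L S J v is zero. *)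
Lemma spike_in_domain r : 0 <= r -> exists2 e0, 0 < e0 & forall e, 0 < e < e0 ->
  green_domain q zeta eta (spike q y r e).
Proof.
move=> r0; have /andP[f0 f1] := frac_bounds; have [_ /andP[g0 g1]] := orbit_bounds 0.
rewrite /= in g0 g1.
pose n := Num.truncn y; pose m := Num.truncn (q / y).
have n0 : (0 < n)%N by rewrite truncn_gt0 ltW.
have m0 : (0 < m)%N by rewrite truncn_gt0 ler_pdivlMr// mul1r ltW.
have m0' : 0 < m%:R :> R by rewrite ltr0n.
have m1' : 0 < m.+1%:R :> R by rewrite ltr0n.
have yn : n%:R < y by move: f0; rewrite /frac subr_gt0.
have yn1 : y < n.+1%:R by move: f1; rewrite /frac ltrBlDl natr1.
have ym : y < q / m%:R.
  by move: g0; rewrite /gauss subr_gt0 ltr_pdivlMr// mulrC -ltr_pdivlMr.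
have ym1 : q / m.+1%:R < y.
  by move: g1; rewrite /gauss ltrBlDl natr1 ltr_pdivrMr// mulrC -ltr_pdivrMr.
exists (Num.min (Num.min (Num.min (y - 1) (q - y)) (Num.min (y - n%:R) (n.+1%:R - y)))
  (Num.min (q / m%:R - y) (y - q / m.+1%:R))).
  by rewrite !lt_min !subr_gt0 y1 yq yn yn1 ym ym1.
move=> e /andP[e0]; rewrite !lt_min.
move=> /andP[/andP[/andP[ey1 eyq] /andP[eyn eyn1]] /andP[eym eym1]].
set v := spike q y r e; have dv := spike_density y r0 e0.
have a1 : 1 <= y - e by lra.
have bq : y + e <= q by lra.
have ab : y - e < y + e by lra.
have na : n%:R <= y - e by lra.
have bn : y + e <= n.+1%:R by lra.
have a0 : 0 < y - e by lra.
have b0 : 0 < y + e by lra.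
have Sv := S_op_bump_single 1 zeta1 n0 dv a1 bq na bn.
have Sd := S_density n dv.
have Jv := J_op_bump q1 1 dv a1 bq ab.
have Jd := J_density q1 dv a1 bq ab.
have Ja1 : 1 <= q / (y + e) by rewrite ler_pdivlMr// mul1r.
have Jbq : q / (y - e) <= q by rewrite ler_pdivrMr// ler_peMr// ltW.
have Jab : q / (y + e) < q / (y - e) by rewrite ltr_pM2l// ltf_pV2.
have mJ : m%:R <= q / (y + e) by rewrite ler_pdivlMr// mulrC -ler_pdivlMr//; lra.
have Jm : q / (y - e) <= m.+1%:R by rewrite ler_pdivrMr// mulrC -ler_pdivrMr// lerBrDr addrC -lerBrDr ltW.
have SJv := S_op_bump_single (1 * 1) eta1 m0 Jd Ja1 Jbq mJ Jm.
have SJd := S_density m Jd.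
have SJn := S_op_single_norm (1 * 1) eta1 m0 Jd Ja1 Jbq mJ Jm.
have Sn := S_op_single_norm 1 zeta1 n0 dv a1 bq na bn.
have L2 := Lam_gt2 q1.
pose rl := (zeta == 1) && (eta == 1).
have sa0 : 0 <= y - e - n%:R by rewrite subr_ge0.
have sb1 : y + e - n%:R <= 1 by rewrite lerBlDl natr1.
have ja0 : 0 <= q / (y + e) - m%:R by rewrite subr_ge0.
have jb1 : q / (y - e) - m%:R <= 1 by rewrite lerBlDl natr1.
have c1 : cmod (- (zeta ^+ n * 1)) = 1 by rewrite mulr1 normrN cmodX_1.
have c1' : cmod (eta ^+ m * (1 * 1)) = 1 by rewrite !mulr1 cmodX_1.
have cr : rl -> complex.Im (- (zeta ^+ n * 1)) = 0.
  by move=> /andP[/eqP -> _]; rewrite expr1n mulr1 /= oppr0.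
have cr' : rl -> complex.Im (eta ^+ m * (1 * 1)) = 0.
  by move=> /andP[_ /eqP ->]; rewrite expr1n !mulr1.
have lip : loglip (Lam q) (y - e - n%:R) (y + e - n%:R) (fun x => 1 * (r / (2 * e))).
  move=> u w _ _; rewrite ler_peMl ?mul1r ?divr_ge0 ?mulr_ge0 ?(ltW e0)//.
  by rewrite -expR0 ler_expR mulr_ge0// ltW// (lt_trans _ L2).
have lip' : loglip (Lam q) (q / (y + e) - m%:R) (q / (y - e) - m%:R)
    (fun x => 1 * (q / (x + m%:R) ^+ 2 * (r / (2 * e)))).
  move=> u w /andP[u1 _] /andP[w1 _]; rewrite !mul1r mulrA ler_wpM2r//.
    by rewrite divr_ge0 ?mulr_ge0 ?(ltW e0).
  have u0 : 0 < u by apply: le_lt_trans u1.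
  have w0 : 0 < w by apply: le_lt_trans w1.
  have mu1 : 1 <= m%:R + u by rewrite ler_wpDr ?ler1n// ltW.
  have mw0 : 0 < m%:R + w by rewrite addr_gt0.
  rewrite ![_ + m%:R]addrC; apply: le_trans (gpsi_lip q1 mu1 mw0) _.
  apply: ler_wpM2r; first by rewrite divr_ge0 ?sqr_ge0// ltW.
  by rewrite ler_expR; apply: ler_wpM2r => //; exact: ltW.
have sab : y - e - n%:R < y + e - n%:R by rewrite ltrD2r.
have jab : q / (y + e) - m%:R < q / (y - e) - m%:R by rewrite ltrD2r.
pose p1 := @Atom R q rl _ _ _ _ _ c1 cr sa0 sab sb1 Sd lip.
pose p2 := @Atom R q rl _ _ _ _ _ c1' cr' ja0 jab jb1 SJd lip'.
have p1E : aval p1 = - S_op zeta v by rewrite /v /spike Sv -(bumpN _ Sd (itv_sub01 sa0 sb1)).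
have p2E : aval p2 = S_op eta (J_op v) by rewrite /v /spike Jv SJv.
have AE : A_op q zeta eta v = aval p1 + L_op zeta q (aval p2) by rewrite p1E p2E.
rewrite /green_domain /= (_ : (fun N => _) = (fun N => \sum_(j < N)
    iter j Q (aval p1 + L_op zeta q (aval p2)))); last first.
  by apply/funext => N; rewrite /green_sum AE.
apply: (cvg_orbit_sum q1 zeta1 eta1).
  move=> a b a00 b00; have [C C0 gr] := @growth R q q1 rl 1.
  exists (cost a b p1 + cost (a + b * C) (b * (2 * q ^- 1)) p2).
  apply: hullD; first exact: hull_val.
  apply: (gr a b [:: zeta] p2) => // w; rewrite inE => /eqP ->; split => //.
  by move=> /andP[/eqP].
move=> rt; have /andP[/eqP z1 /eqP e1] := rt.
have bt := @total_badditive R.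
rewrite (badditiveD bt) z1 total_L_atom// !total_atom p1E p2E normrN.
rewrite /v /spike Sn Jv SJn -Jv J_op_isometry//.
by rewrite /= z1 e1 !expr1n !mulr1 /= mulN1r mul1r addNr.
Qed.

End spikes.

(** * Conclusion *)
Section conclusion.
Context {R : realType}.
Variables (q : R) (zeta eta : R[i]).
Hypotheses (q1 : 1 < q) (trq : ~ algebraicOver (ratr : rat -> R) q).
Hypotheses (zeta1 : cmod zeta = 1) (eta1 : cmod eta = 1).
Local Notation X := (L1 (`]0, 1[ : interval R)).
Local Notation Y := (L1 (`]1, q[ : interval R)).
Local Notation Q := (Q_op q zeta eta).
Local Notation G := (green_sum q zeta eta).
Local Notation D := (green_domain q zeta eta).

Lemma A_op_badditive : bounded_additive 2 (A_op q zeta eta).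
Proof.
have bS w : cmod w = 1 -> bounded_additive 1 (@S_op R w q).
  by move=> w1; split=> [f g|f]; [exact: S_opD|rewrite mul1r; exact: S_op_norm].
have bJ : bounded_additive 1 (@J_op R q).
  by split=> [f g|f]; [exact: J_opD|rewrite mul1r J_op_isometry].
have bSJ := bounded_additive_comp ler01 bJ (bS _ eta1).
have bLSJ := bounded_additive_comp ler01 bSJ (L_op_badditive q1 zeta1).
have bN : bounded_additive 1 (fun f : Y => - S_op zeta f : X).
  split=> [f g|f]; first by rewrite (badditiveD (bS _ zeta1)) opprD.
  by rewrite normrN; exact: badditive_norm (bS _ zeta1) f.
by have := bounded_additiveD bN bLSJ; rewrite !mul1r.
Qed.

Lemma green_sum_badditive N : bounded_additive (2 * N%:R) (G N).
Proof.
apply: (bounded_additive_sum N (T := fun j f => iter j Q (A_op q zeta eta f))) => j.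
rewrite -[2]mul1r.
exact: (bounded_additive_comp ler01 A_op_badditive (iter_Q_badditive q1 zeta1 eta1 j)).
Qed.

Lemma green_sum_extremal N r : 0 < r ->
  exists v : Y, [/\ D v, `|v| = r & `|G N v| = 2 * N%:R * r].
Proof.
move=> r0; have [y [/andP[y1 yq] indep]] := exists_independent q1 trq.
have [e0 e00 eN] := green_sum_spike q1 y1 yq indep zeta1 eta1 N (ltW r0).
have [e1 e10 eD] := spike_in_domain q1 y1 yq indep zeta1 eta1 (ltW r0).
pose e := Num.min e0 e1 / 2.
have m0 : 0 < Num.min e0 e1 by rewrite lt_min e00.
have em : e < Num.min e0 e1 by rewrite ltr_pdivrMr// ltr_pMr// ltr1n.
have e_gt0 : 0 < e by rewrite divr_gt0.
move: em; rewrite lt_min => /andP[ee0 ee1].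
exists (spike q y r e); have [|-> ->] := eN e; first by rewrite e_gt0.
by split => //; apply: eD; rewrite e_gt0.
Qed.

Lemma opnorm_green_sum N : opnorm (G N) = (2 * N%:R)%:E.
Proof.
apply/le_anti/andP; split; last first.
  have [v [_ v1 Gv]] := green_sum_extremal N ltr01.
  apply: ereal_sup_ubound; exists v; rewrite /= ?v1//.
  by rewrite Gv mulr1.
apply: ge_ereal_sup => _ [v /= v1 <-]; rewrite lee_fin.
rewrite (le_trans (badditive_norm (green_sum_badditive N) v))//.
by rewrite ler_piMr// mulr_ge0.
Qed.

Lemma green_domain_proper : D `<` setT.
Proof.
apply: (cvg_domain_proper green_sum_badditive (@L1_complete_series _ _)) => // N r _ r0.
by have [v [_ vr Gv]] := green_sum_extremal N r0; exists v.
Qed.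

Lemma meagre_green_domain : meagre D.
Proof.
apply: (meagre_cvg_domain green_sum_badditive) => C r r0.
pose N := (Num.truncn (`|C| / r)).+1.
have [v [_ vr Gv]] := green_sum_extremal N r0; exists N, v; split; first by rewrite vr.
rewrite Gv (le_lt_trans (ler_norm _))// -ltr_pdivrMr//.
apply: lt_le_trans (truncnS_gt _) _; rewrite -/N.
by rewrite ler_peMl// ler1n.
Qed.

(** Passing to the limit in G_(N+M) v = G_N v + Q^N G_M v. *)
Lemma green_sum_le v N : D v -> `|G N v| <= 2 * `|green q zeta eta v|.
Proof.
move=> Dv; have cG : (fun M => G M v) @ \oo --> green q zeta eta v by exact: Dv.
have bN := iter_Q_badditive q1 zeta1 eta1 N.
have GE : green q zeta eta v = G N v + iter N Q (green q zeta eta v).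
  have c1 : (fun M => G (N + M)%N v) @ \oo --> green q zeta eta v.
    have := cG; rewrite -(cvg_shiftn N); apply: cvg_trans; apply: near_eq_cvg.
    by apply: nearW => M /=; rewrite addnC.
  have c2 : (fun M => G (N + M)%N v) @ \oo --> G N v + iter N Q (green q zeta eta v).
    have := cvgD (cvg_cst (G N v)) (badditive_cvg bN cG).
    move=> /(_ eventually_filter eventually_filter); apply: cvg_trans; apply: near_eq_cvg; apply: nearW => M /=.
    rewrite /green_sum big_split_ord/= fctE; congr (_ + _).
    apply: etrans (badditive_sum bN _ _) _.
    by apply: eq_bigr => j _; rewrite -iterD.
  exact: cvg_unique c1 c2.
have -> : G N v = green q zeta eta v - iter N Q (green q zeta eta v).
  by rewrite {1}GE addrK.
rewrite (le_trans (ler_normB _ _))// mulrDl mul1r lerD2l.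
by have := badditive_norm bN (green q zeta eta v); rewrite mul1r.
Qed.

Lemma green_unbounded : unbounded_on D (green q zeta eta).
Proof.
move=> [C CP]; pose N := (Num.truncn `|C|).+1.
have [v [Dv v1 Gv]] := green_sum_extremal N ltr01.
have := green_sum_le N Dv; rewrite Gv mulr1.
have := CP v Dv; rewrite v1 mulr1 => Cv.
have : C < N%:R by rewrite (le_lt_trans (ler_norm _))// truncnS_gt.
by move: Cv; set x := `|_|; set n := N%:R; lra.
Qed.

End conclusion.

Theorem proposition5p7 (R : realType) :
  exists E : set R,
    [/\ countable E,
        (forall q : R, E q -> 1 < q),
        (forall q : R, E q -> algebraicOver (ratr : rat -> R) q) &
        forall q : R, 1 < q -> ~ E q ->
        forall zeta eta : R[i], `|zeta| = 1 -> `|eta| = 1 ->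
        [/\ (forall N : nat, (1 <= N)%N ->
               opnorm (green_sum q zeta eta N) = (2 * N%:R)%:E),
            green_domain q zeta eta `<` setT,
            meagre (green_domain q zeta eta) &
            unbounded_on (green_domain q zeta eta)
              (green q zeta eta)]].
Proof.
exists [set q | 1 < q /\ algebraicOver (ratr : rat -> R) q]; split.
- apply: sub_countable (countable_roots (fun p : {poly rat} => map_poly ratr p)).
  apply: subset_card_le => q [_ [p p0 pq]]; exists p => //.
  by rewrite map_poly_eq0.
- by move=> q [].
- by move=> q [].
move=> q q1 nE zeta eta /Rcnorm1 zeta1 /Rcnorm1 eta1.
have trq : ~ algebraicOver (ratr : rat -> R) q by move=> aq; apply: nE.
split=> [N _|||].
- exact: opnorm_green_sum.
- exact: green_domain_proper.
- exact: meagre_green_domain.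
- exact: green_unbounded.
Qed.
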